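(* Let $\mu,k$ be integers with $1\le k<\mu$, let $p,\lambda\in[0,1]$, and let $(S_n)_{n\ge0}$ be the tampered memory elephant random walk (TMERW) with parameters $p,\lambda$ whose memory sets are the nested sequence generated according to the arithmetic progression with parameters $(\mu,k)$. Put $$s^*=\frac{(2\lambda-1)(\mu-k)}{\mu-(2p-1)k},\qquad \rho^*=1-(2p-1)\frac{k}{\mu}.$$ Then there are two positive constants $\Sigma$ and $\widetilde\Sigma$, depending on the parameters, such that the following hold. (i) If $k>\frac{\mu}{2}$, there is a phase transition into diffusive, critical and superdiffusive behaviour, characterised as follows. (a) If $p<\frac12+\frac{\mu}{4k}$, then $\dfrac{S_n-ns^*}{\sqrt n}\stackrel{d}{\longrightarrow}N(0,\Sigma)$. (b) If $p=\frac12+\frac{\mu}{4k}$, then $\dfrac{S_n-ns^*}{\sqrt{n\log n}}\stackrel{d}{\longrightarrow}N(0,\widetilde\Sigma)$. (c) If $\frac12+\frac{\mu}{4k}<p\le1$, then there exists a random variable $\xi$ such that $\dfrac{S_n-ns^*}{n^{1-\rho^*}}\longrightarrow\xi$ almost surely. (ii) Suppose $k=\frac{\mu}{2}$. If $0\le p<1$, then $\dfrac{S_n-ns^*}{\sqrt n}\stackrel{d}{\longrightarrow}N(0,\Sigma)$; if $p=1$, then $\dfrac{S_n-ns^*}{\sqrt{n\log n}}\stackrel{d}{\longrightarrow}N(0,\widetilde\Sigma)$. (iii) Suppose $k<\frac{\mu}{2}$. If $0\le p\le1$, then $\dfrac{S_n-ns^*}{\sqrt n}\stackrel{d}{\lo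ngrightarrow}N(0,\Sigma)$.
   Context: TMERW: Fix $p,\lambda\in[0,1]$. Let $\mathcal{D}=(D_n)_{n\ge1}$ be a sequence of sets with $D_n\subseteq\{1,\dots,n\}$. Let $X_1$ be a random variable with values in $\{-1,+1\}$ (arbitrary law); let $(Y_n)_{n\ge2}$ be i.i.d. with $P(Y_n=1)=1-P(Y_n=-1)=\lambda$; let $(\varepsilon_n)_{n\ge2}$ be i.i.d. with $P(\varepsilon_n=1)=1-P(\varepsilon_n=-1)=p$; let $(I_{n+1})_{n\ge1}$ be independent with $I_{n+1}$ uniform on $\{1,\dots,n\}$; $X_1$, $(Y_n)$, $(\varepsilon_n)$, $(I_n)$ are mutually independent. For $n\ge1$ define recursively $X_{n+1}=\varepsilon_{n+1}X_{I_{n+1}}$ if $I_{n+1}\notin D_n$, and $X_{n+1}=Y_{n+1}$ if $I_{n+1}\in D_n$. The TMERW is $S_0=0$, $S_n=X_1+\dots+X_n$. Arithmetic progression with parameters $(\mu,k)$: the (deterministic) memory sets in which runs of $k$ consecutive integers in the retained memory alternate with runs of $\mu-k$ consecutive integers in the tampered memory, starting with a retained run; i.e. $D_n^c=\{1,\dots,n\}\setminus D_n$ is the set of $i\in\{1,\dots,n\}$ of the form $i=j\mu+m$ with $j\ge0$, $1\le m\le k$, and $D_n$ is the set of $i\in\{1,\dots,n\}$ of the form $i=j\mu+m$ with $j\ge0$, $k+1\le m\le\mu$. Both $(D_n)$ and $(D_n^c)$ are non-decreasing in $n$ (the sequence is nested).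
   Formalization: The constants Σ and Σ̃ are positive except when k ≤ μ/2, p = 1 and λ ∈ {0,1}, where they are only claimed nonnegative and N(0,0) means the point mass at 0 (there X_1 = 2λ−1 gives S_n = n s* exactly, so a positive variance is impossible). *)

(* Defs.v *)
From HB Require Import structures.
From mathcomp Require Export all_boot all_order all_algebra.
From mathcomp Require Export finmap.
From mathcomp Require Export all_classical all_reals all_analysis.

Set Implicit Arguments.
Unset Strict Implicit.
Unset Printing Implicit Defensive.

Export Order.TTheory GRing.Theory Num.Theory.
Export numFieldNormedType.Exports.

Local Open Scope classical_set_scope.
Local Open Scope ring_scope.

Definition mutually_independent d (T : measurableType d) (R : realType)
    (P : probability T R) (K : choiceType) (F : K -> set_system T) : Prop :=
  forall (J : {fset K}) (E : K -> set T),
    (forall i, i \in J -> F i (E i)) ->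
    P (\bigcap_(i in [set` J]) E i) = (\prod_(i <- J) P (E i))%E.

Definition sigma_of d d' (T : measurableType d) (U : measurableType d')
    (X : T -> U) : set_system T :=
  preimage_set_system setT X measurable.

(* The normal law with mean m and variance v.  normal_prob takes the standard
   deviation as parameter and is the uniform law on [0, 1] when that is 0,
   hence the case distinction. *)
Definition normal_law (R : realType) (m v : R) :
    probability (measurableTypeR R) R :=
  if v == 0 then dirac (m : measurableTypeR R) : probability _ R
  else normal_prob m (Num.sqrt v) : probability _ R.

Definition cvg_in_law d (T : measurableType d) (R : realType)
    (P : probability T R) (Z : nat -> T -> R)
    (nu : probability (measurableTypeR R) R) : Prop :=
  forall f : R -> R, continuous f -> bounded_fun f ->
    ('E_P[f \o Z n])%E @[n --> \oo] --> (\int[nu]_x (f x)%:E)%E.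

(* The index set of the family X_1, (Y_n)_{n >= 2}, (eps_n)_{n >= 2},
   (I_n)_{n >= 2}, in this order. *)
Definition tmerw_index : choiceType := (unit + (nat + (nat + nat)))%type.

Definition tmerw_sigma d (T : measurableType d) (R : realType)
    (X1 : T -> R) (Y eps : nat -> T -> R) (I : nat -> T -> nat)
    (i : tmerw_index) : set_system T :=
  match i with
  | inl _ => sigma_of X1
  | inr (inl n) => sigma_of (Y n.+2)
  | inr (inr (inl n)) => sigma_of (eps n.+2)
  | inr (inr (inr n)) => sigma_of (I n.+2)
  end.

(* X_0, Y_0, Y_1, eps_0, eps_1, I_0 and I_1 are irrelevant. *)
Record is_tmerw d (T : measurableType d) (R : realType) (P : probability T R)
    (p lam : R) (D : nat -> set nat) (Y eps : nat -> {RV P >-> R})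
    (I : nat -> {RV P >-> nat}) (X : nat -> {RV P >-> R}) : Prop := IsTmerw {
  tmerw_memory : forall n, (1 <= n)%N -> D n `<=` [set i | (1 <= i <= n)%N] ;
  tmerw_first : forall w, X 1%N w = -1 \/ X 1%N w = 1 ;
  tmerw_Y : forall n, (2 <= n)%N ->
    P [set w | Y n w = 1] = lam%:E /\ P [set w | Y n w = -1] = (1 - lam)%:E ;
  tmerw_eps : forall n, (2 <= n)%N ->
    P [set w | eps n w = 1] = p%:E /\ P [set w | eps n w = -1] = (1 - p)%:E ;
  tmerw_I : forall n i, (1 <= i <= n)%N ->
    P [set w | I n.+1 w = i] = (n%:R^-1)%:E ;
  tmerw_indep : mutually_independent P (tmerw_sigma (X 1%N) Y eps I) ;
  tmerw_retained : forall n w, (1 <= n)%N -> ~ D n (I n.+1 w) ->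
    X n.+1 w = eps n.+1 w * X (I n.+1 w) w ;
  tmerw_tampered : forall n w, (1 <= n)%N -> D n (I n.+1 w) ->
    X n.+1 w = Y n.+1 w
}.

Definition walk d (T : measurableType d) (R : realType) (P : probability T R)
    (X : nat -> {RV P >-> R}) (n : nat) (w : T) : R :=
  \sum_(1 <= i < n.+1) X i w.

Definition ap_retained (mu k n : nat) : set nat :=
  [set i | (1 <= i <= n)%N /\
     exists j m, (1 <= m <= k)%N /\ i = (j * mu + m)%N].

Definition ap_tampered (mu k n : nat) : set nat :=
  [set i | (1 <= i <= n)%N /\
     exists j m, (k.+1 <= m <= mu)%N /\ i = (j * mu + m)%N].

Lemma ap_retainedE (mu k n : nat) : (k < mu)%N ->
  ap_retained mu k n = [set i | (1 <= i <= n)%N] `\` ap_tampered mu k n.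
Proof.
move=> kmu; have mu0 : (0 < mu)%N by apply: leq_trans kmu.
have pred_div i j m : (1 <= m <= mu)%N -> i = (j * mu + m)%N ->
    (i.-1 %% mu)%N = m.-1.
  case: m => // m /andP[_ mmu] ->; rewrite addnS /=.
  by rewrite modnMDl modn_small.
apply/seteqP; split => i /=.
  move=> [hi [j [m [/andP[m1 mk] e]]]]; split=> // -[_ [j' [m' [/andP[m1' mk'] e']]]].
  have m'1 : (1 <= m')%N by apply: leq_ltn_trans m1'.
  have h1 : (1 <= m <= mu)%N by rewrite m1 (leq_trans mk (ltnW kmu)).
  have h2 : (1 <= m' <= mu)%N by rewrite m'1 mk'.
  have := pred_div _ _ _ h1 e; rewrite (pred_div _ _ _ h2 e').
  move=> /(congr1 succn); rewrite !prednK// => mm.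
  by move: m1'; rewrite mm ltnNge mk.
move=> [hi ntamp]; split=> //; case: i hi ntamp => // i hi ntamp.
exists (i %/ mu)%N, (i %% mu).+1; split; last by rewrite addnS -divn_eq.
rewrite /= ltnNge; apply/negP => km; apply: ntamp; split=> //.
exists (i %/ mu)%N, (i %% mu).+1; split; last by rewrite addnS -divn_eq.
by rewrite ltnS km ltn_pmod.
Qed.

Definition ap_drift (R : realType) (mu k : nat) (p lam : R) : R :=
  (2 * lam - 1) * (mu%:R - k%:R) / (mu%:R - (2 * p - 1) * k%:R).

Definition ap_rho (R : realType) (mu k : nat) (p : R) : R :=
  1 - (2 * p - 1) * (k%:R / mu%:R).

(* If p = 1, lam is 0 or 1 and X_1 = 2 lam - 1, then X_n = X_1 for all n and
   S_n = n s^* almost surely.  When k <= mu / 2 the limiting variance is therefore 0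
   for these parameters, and N(0, 0) is the point mass at 0. *)
Definition ap_degenerate (R : realType) (mu k : nat) (p lam : R) : Prop :=
  [/\ k%:R <= mu%:R / 2 :> R, p = 1 & lam = 0 \/ lam = 1].

(* Main.v *)
(* Write a = 2p - 1, kap = k/mu, g = a kap = 1 - rho^*, let D_n = X_n - E[X_n | past]
   be the martingale increments and r_i in {0, 1} the indicator that i is retained.
   The number of retained i <= n differs from kap n by a bounded amount, and correcting
   for this discrepancy gives
     S_n - n s^* = sum_{i <= n} (1 - r_i / kap) D_i
                   + (n^g / kap) sum_{i <= n} r_i i^(-g) D_i + error,
   where the error is negligible pathwise.  The conditional variance of D_i tends to
   1 - s^*^2 in L^1, so for g < 1/2 and for g = 1/2 a telescoping estimate of the
   characteristic function gives the central limit theorem, with a limiting variance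
   computed by Stolz-Cesaro.  For g > 1/2 the second martingale converges almost surely
   and the first one is o(n^g), by Kolmogorov's inequality and Kronecker's lemma.

   Weak convergence is deduced from convergence of the expectations of cos (t x + c):
   by Weierstrass, bounded continuous functions are approximated by trigonometric
   polynomials on intervals, and the second moments control the rest. *)

Require Import Defs.
From mathcomp Require Import ring lra measurable_realfun.

Set Implicit Arguments.
Unset Strict Implicit.
Unset Printing Implicit Defensive.

Local Open Scope classical_set_scope.
Local Open Scope ring_scope.

(** * Trigonometric polynomials and weak convergence *)

Section taylor.
Variable R : realType.
Implicit Types (a d x y : R).

(** The steps are signs, so their conditional mean [m] alone fixes the conditional law, and the
    conditional variance is [1 - m ^+ 2]. Conditioning can therefore be done by the recursion [hexp]
    over lists of signs, without filtrations; [history_law] and [expectation_history] form the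
    bridge to the probability space, and [Y], [eps], [I] having the right values only almost surely
    is settled there. What shapes the estimates is that the memory has density [kap] only on
    average. Each step leaves a predictable term with factor [r - kap], too large to be summed in
    absolute value; it oscillates, and the corrections built into [walk_part] and [scaled_retained]
    cancel it exactly to leading order. Of the progression this uses only that the discrepancy is
    bounded. The factor [n^g] makes the weights a triangular array. They are deterministic, however,
    so the variance is an explicit sum, and the conditional variances need only converge in L^1.
    Cosines with an arbitrary phase serve as test functions: they are real, and products of a sine
    and such a cosine are again combinations of them. *)

Lemma MVT0 (f f' : R -> R) d : 0 <= d -> (forall x, is_derive x 1 f (f' x)) ->
  exists2 c, 0 <= c <= d & f d - f 0 = f' c * d.
Proof.
move=> d0 df; have [|c] := @MVT_segment R f f' 0 d d0 (fun x _ => df x).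
  apply: continuous_subspaceT => x; apply: differentiable_continuous.
  by apply/derivable1_diffP; have [] := df x.
by rewrite in_itv/= subr0 => cd ?; exists c.
Qed.

Lemma norm_sin_le d : `|sin d| <= `|d|.
Proof.
wlog d0 : d / 0 <= d.
  move=> H; have [/H//|d0] := leP 0 d.
  by rewrite -normrN -sinN -[leRHS]normrN H// oppr_ge0 ltW.
have [c _] := @MVT0 sin cos d d0 (fun x => is_derive_sin x).
rewrite sin0 subr0 => ->; rewrite normrM -[leRHS]mul1r ler_wpM2r//; exact: cos_max.
Qed.

Lemma norm_one_sub_cos_le d : `|1 - cos d| <= d ^+ 2.
Proof.
wlog d0 : d / 0 <= d.
  move=> H; have [/H//|d0] := leP 0 d.
  by rewrite -cosN -sqrrN H// oppr_ge0 ltW.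
have [c /andP[c0 cd]] := @MVT0 cos (fun x => - sin x) d d0 (fun x => is_derive_cos x).
rewrite cos0 distrC => ->; rewrite normrM normrN (ger0_norm d0) expr2 ler_wpM2r//.
by apply: le_trans (norm_sin_le c) _; rewrite ger0_norm.
Qed.

(** The bounds on sine and cosine at 0 climb one degree at a time: the derivative of each remainder
    is, up to sign, the previous remainder, so the mean value theorem costs one factor [d].
    Factorials are given up. *)
Lemma norm_sin_sub_le d : `|sin d - d| <= `|d| ^+ 3.
Proof.
wlog d0 : d / 0 <= d.
  move=> H; have [/H//|d0] := leP 0 d.
  have := H (- d); rewrite oppr_ge0 (ltW d0) => /(_ isT).
  by rewrite sinN -opprD !normrN.
have [c /andP[c0 cd]] := @MVT0 (fun x => sin x - x) (fun x => cos x - 1) d d0 _.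
rewrite sin0 !subr0 => ->; rewrite normrM exprSr ler_wpM2r// distrC.
apply: le_trans (norm_one_sub_cos_le c) _.
by rewrite (ger0_norm d0) ler_pXn2r// nnegrE.
Qed.

Lemma norm_cos_taylor2_le d : `|cos d - 1 + d ^+ 2 / 2| <= d ^+ 4.
Proof.
wlog d0 : d / 0 <= d.
  move=> H; have [/H//|d0] := leP 0 d.
  rewrite -cosN -[d ^+ 2]sqrrN (_ : d ^+ 4 = (- d) ^+ 4); last by ring.
  by rewrite H// oppr_ge0 ltW.
have df (x : R) : is_derive x 1 (fun x : R => cos x + x ^+ 2 / 2) (- sin x + x).
  by apply: is_derive_eq; rewrite /GRing.scale/=; field.
have [c /andP[c0 cd]] := MVT0 d0 df.
rewrite cos0 expr0n/= mul0r addr0 addrAC => ->.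
rewrite normrM (ger0_norm d0) exprSr ler_wpM2r// addrC distrC.
apply: le_trans (norm_sin_sub_le c) _.
by rewrite (ger0_norm c0) ler_pXn2r// nnegrE.
Qed.

Lemma cos_taylor2 a d :
  `|cos (a + d) - cos a + d * sin a + d ^+ 2 / 2 * cos a| <= `|d| ^+ 3 + d ^+ 4.
Proof.
have -> : cos (a + d) - cos a + d * sin a + d ^+ 2 / 2 * cos a =
    cos a * (cos d - 1 + d ^+ 2 / 2) - sin a * (sin d - d) by rewrite cosD; ring.
apply: le_trans (ler_normB _ _) _; rewrite addrC !normrM.
apply: lerD.
  by rewrite -[leRHS]mul1r ler_pM// ?norm_sin_sub_le ?sin_max.
by rewrite -[leRHS]mul1r ler_pM// ?norm_cos_taylor2_le ?cos_max.
Qed.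

Lemma cos_lipschitz a b : `|cos a - cos b| <= `|a - b|.
Proof.
wlog ab : a b / b <= a.
  by move=> H; have [/H//|/ltW/H] := leP b a; rewrite distrC [leRHS]distrC.
rewrite (_ : cos a - cos b = cos (b + (a - b)) - cos (b + 0)); last first.
  by rewrite addrCA subrr !addr0.
have df (x : R) : is_derive x 1 (fun x : R => cos (b + x)) (- sin (b + x)).
  by apply: is_derive_eq; rewrite add0r mulr1.
have d0 : 0 <= a - b by rewrite subr_ge0.
have [c _ ->] := MVT0 d0 df.
by rewrite normrM -[leRHS]mul1r ler_wpM2r// normrN sin_max.
Qed.

Lemma cos_taylor1 a d : `|cos (a + d) - cos a + d * sin a| <= d ^+ 2.
Proof.
wlog d0 : a d / 0 <= d.
  move=> H; have [/H//|d0] := leP 0 d.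
  have := H (- a) (- d); rewrite oppr_ge0 (ltW d0) => /(_ isT).
  by rewrite -opprD !cosN sinN mulrNN sqrrN.
(* The derivative [sin a - sin (a + x)] is written as a difference of shifted cosines so that
   [cos_lipschitz] applies to it. *)
have df (x : R) : is_derive x 1 (fun x : R => cos (a + x) + x * sin a)
    (cos (a + x + pi / 2) - cos (a + pi / 2)).
  by apply: is_derive_eq; rewrite /GRing.scale/= !cosDpihalf; ring.
have [c /andP[c0 cd]] := MVT0 d0 df.
rewrite addr0 mul0r addr0 addrAC => ->.
rewrite normrM (ger0_norm d0) expr2 ler_wpM2r//.
apply: le_trans (cos_lipschitz _ _) _.
by rewrite (_ : _ - _ = c); [rewrite ger0_norm|ring].
Qed.

Lemma expR_taylor1 y : 0 <= y -> `|expR (- y) - 1 + y| <= y ^+ 2.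
Proof.
move=> y0; have df (x : R) : is_derive x 1 (fun x : R => expR (- x) + x) (- expR (- x) + 1).
  by apply: is_derive_eq; ring.
have [c /andP[c0 cy]] := MVT0 y0 df.
rewrite oppr0 expR0 addr0 addrAC => ->.
rewrite normrM (ger0_norm y0) expr2 ler_wpM2r//.
have := expR_ge1Dx (- c); have : expR (- c) <= 1 by rewrite -expR0 ler_expR oppr_le0.
by move=> h1 h2; rewrite ger0_norm; lra.
Qed.

End taylor.

(** * Weierstrass approximation by Bernstein polynomials *)

Section weierstrass.
Variable R : realType.
Implicit Types (x y c e : R) (f g : R -> R).

(* [\sum_(k <= n) g k * 'C(n, k) * 'X^k * (1 - 'X)^(n - k)], by de Casteljau's recursion. *)
Fixpoint bernstein (n : nat) (g : nat -> R) : {poly R} :=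
  if n is n'.+1 then 'X * bernstein n' (g \o succn) + (1 - 'X) * bernstein n' g
  else (g 0%N)%:P.

Lemma horner_bernsteinS n (g : nat -> R) x : (bernstein n.+1 g).[x] =
  x * (bernstein n (g \o succn)).[x] + (1 - x) * (bernstein n g).[x].
Proof. by rewrite /= !hornerE. Qed.

Lemma bernstein_lin n (g h : nat -> R) a b x :
  (bernstein n (fun k => a * g k + b * h k)).[x] =
  a * (bernstein n g).[x] + b * (bernstein n h).[x].
Proof.
elim: n g h => [|n IH] g h; first by rewrite /= !hornerE.
rewrite !horner_bernsteinS -!/(_ \o _) IH.
by have /= -> := IH (g \o succn) (h \o succn); ring.
Qed.

Lemma bernstein_le n (g h : nat -> R) x : 0 <= x <= 1 ->
  (forall k, (k <= n)%N -> g k <= h k) ->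
  (bernstein n g).[x] <= (bernstein n h).[x].
Proof.
move=> /andP[x0 x1]; elim: n g h => [|n IH] g h gh; first by rewrite /= !hornerE gh.
rewrite !horner_bernsteinS lerD// ler_wpM2l ?subr_ge0// IH// => k kn; first exact: gh.
by rewrite gh// ltnW.
Qed.

Lemma bernstein_cst n a x : (bernstein n (fun=> a)).[x] = a.
Proof.
elim: n => [|n IH]; first by rewrite /= hornerE.
by rewrite horner_bernsteinS /comp IH; ring.
Qed.

(** This is the second moment of [B + c] for [B] binomial with parameters [n] and [x]: squared mean
    plus variance. The shift [c] is free because the recursion replaces [g] by [g \o succn]. *)
Lemma bernstein_sqr n c x : (bernstein n (fun k => (k%:R + c) ^+ 2)).[x] =
  (n%:R * x + c) ^+ 2 + n%:R * (x * (1 - x)).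
Proof.
elim: n c => [|n IH] c; first by rewrite /= hornerE; ring.
rewrite horner_bernsteinS IH (_ : _ \o _ = fun k => (k%:R + (1 + c)) ^+ 2); last first.
  by apply/funext => k /=; rewrite -natr1; ring.
by rewrite IH -natr1; ring.
Qed.

(* A substitute for uniform continuity: the quadratic term absorbs the pairs of
   points that are far apart. *)
Lemma bounded_continuous_quad f (M e : R) (A : set R) : compact A ->
  (forall x, A x -> {for x, continuous f}) -> (forall x, `|f x| <= M) -> 0 < e ->
  exists2 K, 0 <= K & forall x y, A x -> `|f x - f y| <= e + K * (x - y) ^+ 2.
Proof.
move=> /compact_near_coveringP cA cf fM e0.
pose P (K : R) x := forall y, `|f x - f y| <= e + K * (x - y) ^+ 2.
have M0 : 0 <= M by apply: le_trans (fM 0).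
have : \forall K \near +oo, A `<=` P K.
  apply: cA => x Ax.
  have /cvgrPdist_le /(_ (e / 2)) := cf _ Ax.
  rewrite divr_gt0// => /(_ isT) [d /= d0 dP].
  (* A point [y] at distance at least [d] from [x] is at least [d / 2] away from every [x'] in this
     ball, and then [K * (d / 2) ^+ 2] is at least [2 * M], the largest possible oscillation of
     [f]. *)
  exists (ball x (d / 2), [set K | 8 * M / d ^+ 2 <= K]) => /=.
    split; first by exists (d / 2) => //=; rewrite divr_gt0.
    by apply: nbhs_pinfty_ge; exact: num_real.
  move=> [x' K] /= [] xx' HK y.
  have K0 : 0 <= K by apply: le_trans HK; rewrite divr_ge0 ?exprn_ge0 ?mulr_ge0// ltW.
  have q0 : 0 <= K * (x' - y) ^+ 2 by rewrite mulr_ge0// sqr_ge0.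
  have [xy|xy] := ltP `|x - y| d.
    have h1 := dP y xy.
    have h2 : `|f x - f x'| <= e / 2.
      by apply: dP; rewrite /ball_/=; apply: lt_trans xx' _; rewrite ltr_pdivrMr//; lra.
    rewrite (_ : f x' - f y = (f x - f y) - (f x - f x')); last by ring.
    apply: le_trans (ler_normB _ _) _; lra.
  have h3 : d / 2 <= `|x' - y|.
    have := ler_normD (x - x') (x' - y); rewrite addrA subrK => h.
    move: xx'; rewrite /ball/= => xx'; lra.
  have h4 : (d / 2) ^+ 2 <= (x' - y) ^+ 2.
    by rewrite -[leRHS]real_normK ?num_real// ler_pXn2r// ?nnegrE// divr_ge0// ltW.
  have h5 : 2 * M <= K * (x' - y) ^+ 2.
    have : 8 * M / d ^+ 2 * (d / 2) ^+ 2 <= K * (x' - y) ^+ 2.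
      by rewrite ler_pM// ?sqr_ge0// divr_ge0 ?exprn_ge0 ?mulr_ge0// ltW.
    by rewrite (_ : 8 * M / d ^+ 2 * (d / 2) ^+ 2 = 2 * M)//; field; rewrite gt_eqF.
  apply: le_trans (ler_normB _ _) _; have := fM x'; have := fM y; lra.
case=> K0 [_ KP]; exists (Num.max 0 K0 + 1); first by rewrite addr_ge0// le_max lexx.
move=> x y Ax; apply: (KP _ _ _ Ax).
by rewrite (@le_lt_trans _ _ (Num.max 0 K0)) ?ltrDl// le_max lexx orbT.
Qed.

(** The second conclusion, that the approximant obeys the same bound [M], is what later controls the
    approximation error far from the origin. *)
Theorem weierstrass f (M e : R) :
  (forall x, 0 <= x <= 1 -> {for x, continuous f}) -> (forall x, `|f x| <= M) ->
  0 < e ->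
  exists q : {poly R}, forall x, 0 <= x <= 1 ->
    `|f x - q.[x]| <= e /\ `|q.[x]| <= M.
Proof.
move=> cf fM e0.
have [K K0 KP] : exists2 K, 0 <= K & forall x y, `[0, 1]%classic x ->
    `|f x - f y| <= e / 2 + K * (x - y) ^+ 2.
  apply: bounded_continuous_quad (@segment_compact _ _ _) _ fM (divr_gt0 e0 _) => //.
(* The quadratic error term averages to [K * x * (1 - x) / n], which this [n] makes at most
   [e / 2]. *)
pose n := (Num.truncn (K / e)).+1.
have nK : K / n%:R <= e.
  rewrite ler_pdivrMr ?ltr0n// mulrC -ler_pdivrMr//.
  by apply/ltW; exact: truncnS_gt.
have n0 : 0 < n%:R :> R by rewrite ltr0n.
have n1 : n%:R != 0 :> R by rewrite gt_eqF.
pose g k : R := f (k%:R / n%:R).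
exists (bernstein n g) => x x01.
have bnd (h1 h2 : R) (l : nat -> R) : (forall k, (k <= n)%N -> h1 - l k <= g k <= h2 + l k) ->
    h1 - (bernstein n l).[x] <= (bernstein n g).[x] <= h2 + (bernstein n l).[x].
  move=> H; apply/andP; split.
    have := @bernstein_le n (fun k => 1 * h1 + (-1) * l k) g x x01.
    rewrite bernstein_lin bernstein_cst mul1r mulN1r; apply => k kn.
    by have := H k kn; lra.
  have := @bernstein_le n g (fun k => 1 * h2 + 1 * l k) x x01.
  rewrite bernstein_lin bernstein_cst !mul1r; apply => k kn.
  by have := H k kn; lra.
split; last first.
  have := bnd (- M) M (fun=> 0); rewrite bernstein_cst oppr0 !addr0 ler_norml; apply.
  by move=> k _; rewrite -ler_norml; exact: fM.
pose l (k : nat) := K / n%:R ^+ 2 * (k%:R + - (n%:R * x)) ^+ 2.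
have lE : (bernstein n l).[x] = K / n%:R * (x * (1 - x)).
  transitivity ((bernstein n (fun k => K / n%:R ^+ 2 * (k%:R + - (n%:R * x)) ^+ 2 + 0 * 0)).[x]).
    by congr (bernstein n _).[x]; apply/funext => k; rewrite mul0r addr0.
  by rewrite (bernstein_lin _ _ (fun=> 0)) bernstein_sqr; field.
have h : K / n%:R * (x * (1 - x)) <= e / 2.
  have : x * (1 - x) <= 2^-1 by have := sqr_ge0 (x - 2^-1); nra.
  have : 0 <= x * (1 - x) by nra.
  have : 0 <= K / n%:R by rewrite divr_ge0// ltW.
  by move: nK; nra.
have /(bnd (f x - e / 2) (f x + e / 2)) : forall k, (k <= n)%N ->
    f x - e / 2 - l k <= g k <= f x + e / 2 + l k.
  move=> k kn; have := KP x (k%:R / n%:R); rewrite /= in_itv/= => /(_ x01).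
  have -> : K * (x - k%:R / n%:R) ^+ 2 = l k by rewrite /l; field.
  rewrite -/(g k) ler_distlC; lra.
rewrite lE ler_distlC; lra.
Qed.

End weierstrass.

Section trigonometric_approximation.
Variable R : realType.
Implicit Types (x y a b c e : R) (f g : R -> R).

(* Approximates [f \o asin] by a polynomial on the range of the sine. *)
Lemma trig_approx f (M A e : R) : continuous f -> (forall x, `|f x| <= M) ->
  0 < A -> 0 < e -> exists (q : {poly R}) (a : R), forall x,
    (`|x| <= A -> `|f x - q.[sin (a * x)]| <= e) /\ `|q.[sin (a * x)]| <= M.
Proof.
move=> cf fM A0 e0.
(* With this frequency [a * x] stays in [[- pi / 4, pi / 4]] when [|x| <= A]: there the sine is
   invertible and its values keep away from -1 and 1. *)
pose a := (pi / 4) / A : R.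
have pi0 := pi_gt0 R.
have a0 : 0 < a by rewrite !divr_gt0.
pose c := sin (pi / 4) : R.
have c0 : 0 < c by apply: sin_gt0_pi; apply/andP; split; lra.
have c1 : c < 1.
  by rewrite -sin_pihalf ltr_sin ?in_itv/=; lra.
(* Clamping to [[- c, c]] with [c < 1] makes [asin] continuous at every argument it receives,
   without changing [F] on the sines that matter. *)
pose cl (s : R) := Num.min c (Num.max (- c) s).
have clP s : - c <= cl s <= c.
  by rewrite /cl ge_min lexx le_min le_max lexx andbT/= andbT; lra.
pose F (t : R) := f (asin (cl (2 * t - 1)) / a).
have cF : forall t, 0 <= t <= 1 -> {for t, continuous F}.
  move=> t _.
  have cc : {for t, continuous (fun t : R => cl (2 * t - 1) : R)}.
    apply: continuous_min; first exact: cvg_cst.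
    apply: continuous_max; first exact: cvg_cst.
    apply: cvgB; last exact: cvg_cst.
    by apply: cvgM; [exact: cvg_cst|exact: cvg_id].
  have ca : {for t, continuous (asin \o (fun t : R => cl (2 * t - 1) : R))}.
    apply: continuous_comp cc _; apply: continuous_asin.
    by have := clP (2 * t - 1); lra.
  apply: (@continuous_comp _ _ _ (fun t : R => asin (cl (2 * t - 1)) / a : R) f); last exact: cf.
  by apply: cvgM ca _; exact: cvg_cst.
have [q qP] := @weierstrass R F M e cF (fun t => fM _) e0.
exists (q \Po (('X + 1) * (2^-1)%:P)), a => x; rewrite horner_comp !hornerE.
set s := sin (a * x).
have s01 : 0 <= (s + 1) * 2^-1 <= 1.
  by have := sin_le1 (a * x); have := sin_geN1 (a * x); rewrite -/s; lra.
have [H1 H2] := qP _ s01; split => // xA.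
have E : F ((s + 1) * 2^-1) = f x.
  have ax : - (pi / 4) <= a * x <= pi / 4.
    rewrite -ler_norml normrM (gtr0_norm a0).
    have -> : pi / 4 = a * A by rewrite /a; field; rewrite gt_eqF.
    by rewrite ler_wpM2l// ltW.
  have sc : - c <= s <= c.
    have smono u v : - (pi / 2) <= u -> v <= pi / 2 -> u <= v -> sin u <= sin v :> R.
      move=> hu hv; rewrite le_eqVlt => /predU1P[->//|uv].
      by apply/ltW; rewrite ltr_sin ?in_itv/=; lra.
    by rewrite /c -sinN !smono//; lra.
  rewrite /F (_ : 2 * ((s + 1) * 2^-1) - 1 = s); last by lra.
  have -> : cl s = s.
    have /andP[s1 s2] := sc.
    by rewrite /cl (max_idPr s1) (min_idPr s2).
  rewrite /s sinK; last by rewrite in_itv/=; lra.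
  by congr f; field; rewrite gt_eqF.
by rewrite -E.
Qed.

End trigonometric_approximation.

Section cos_convergence.
Variable R : realType.
Implicit Types (f g : R -> R) (L : (R -> R) -> R).

(** The class has to contain the bounded continuous functions and also [x ^+ 2], which dominates the
    approximation error at infinity. *)
Definition quadratic_growth f :=
  continuous f /\ exists K, forall x, `|f x| <= K * (1 + x ^+ 2).

(** One notion for three kinds of expectation: [hexp] over histories, the integral against a normal
    law, and evaluation at 0 for the degenerate limit. *)
Definition positive_linear L :=
  (forall f g a b, quadratic_growth f -> quadratic_growth g ->
    L (fun x => a * f x + b * g x) = a * L f + b * L g) /\
  (forall f g, quadratic_growth f -> quadratic_growth g ->
    (forall x, f x <= g x) -> L f <= L g).

Lemma bounded_quadratic_growth f M :
  continuous f -> (forall x, `|f x| <= M) -> quadratic_growth f.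
Proof.
move=> cf fM; split => //; exists M => x.
have M0 : 0 <= M by apply: le_trans (fM 0).
by apply: le_trans (fM x) _; have := sqr_ge0 x; nra.
Qed.

Lemma quadratic_growth_cst (c : R) : quadratic_growth (fun=> c).
Proof. by apply: (@bounded_quadratic_growth _ `|c|) => // x; exact: cvg_cst. Qed.

Lemma quadratic_growth_sqr : quadratic_growth (fun x : R => x ^+ 2).
Proof.
split; first exact: exprn_continuous.
by exists 1 => x; rewrite ger0_norm ?sqr_ge0// mul1r; lra.
Qed.

Lemma quadratic_growth_lin f g a b : quadratic_growth f -> quadratic_growth g ->
  quadratic_growth (fun x => a * f x + b * g x).
Proof.
move=> [cf [K fK]] [cg [K' gK]]; split.
  by move=> x; apply: cvgD; (apply: cvgM; [exact: cvg_cst|]); [exact: cf|exact: cg].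
exists (`|a| * K + `|b| * K') => x.
apply: le_trans (ler_normD _ _) _; rewrite !normrM mulrDl -!mulrA.
by rewrite lerD// ler_wpM2l.
Qed.

Lemma continuous_affine_cos (t u : R) : continuous (fun x => cos (t * x + u)).
Proof.
move=> x; apply: continuous_comp; last exact: continuous_cos.
by apply: cvgD; [apply: cvgM; [exact: cvg_cst|exact: cvg_id]|exact: cvg_cst].
Qed.

Lemma continuous_affine_sin (t u : R) : continuous (fun x => sin (t * x + u)).
Proof.
move=> x; apply: continuous_comp; last exact: continuous_sin.
by apply: cvgD; [apply: cvgM; [exact: cvg_cst|exact: cvg_id]|exact: cvg_cst].
Qed.

Lemma quadratic_growth_poly_sin_cos (q : {poly R}) (a t u : R) :
  quadratic_growth (fun x => q.[sin (a * x)] * cos (t * x + u)).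
Proof.
have [cq [K qK]] : continuous (fun x => q.[sin (a * x)]) /\
    exists K, forall x, `|q.[sin (a * x)]| <= K.
  elim/poly_ind: q => [|q c [cq [K qK]]].
    split; last by exists 0 => x; rewrite horner0 normr0.
    by under [X in continuous X]eq_fun do rewrite horner0; move=> x; exact: cvg_cst.
  under [X in continuous X]eq_fun do rewrite !hornerE.
  split.
    move=> x; apply: cvgD; last exact: cvg_cst.
    apply: cvgM; first exact: cq.
    have := @continuous_affine_sin a 0 x; rewrite /continuous_at addr0.
    by under eq_fun do rewrite addr0.
  exists (K + `|c|) => x; rewrite !hornerE.
  apply: le_trans (ler_normD _ _) _; rewrite lerD// normrM.
  by rewrite -[leRHS]mulr1 ler_pM// ?qK// sin_max.
apply: (@bounded_quadratic_growth _ K).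
  by move=> x; apply: cvgM; [exact: cq|exact: continuous_affine_cos].
by move=> x; rewrite normrM -[leRHS]mulr1 ler_pM// cos_max.
Qed.

(** Multiplying by a sine stays in the span of cosines with a phase, so convergence for
    [cos (t * x + u)] passes to every polynomial in [sin (a * x)] by induction. *)
Lemma sin_mul_cos (u v : R) :
  sin u * cos v = 2^-1 * cos (v + u - pi / 2) - 2^-1 * cos (v - u - pi / 2).
Proof. by rewrite !cosBpihalf sinD sinB; field. Qed.

Theorem cos_cvg_bounded_continuous (Ln : nat -> (R -> R) -> R) L (C : R) :
  (forall n, positive_linear (Ln n)) -> positive_linear L ->
  (forall n, Ln n (fun=> 1) = 1) -> L (fun=> 1) = 1 ->
  (forall n, Ln n (fun x => x ^+ 2) <= C) -> L (fun x => x ^+ 2) <= C ->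
  (forall t u, Ln n (fun x => cos (t * x + u)) @[n --> \oo] -->
    L (fun x => cos (t * x + u))) ->
  forall f M, continuous f -> (forall x, `|f x| <= M) -> Ln n f @[n --> \oo] --> L f.
Proof.
move=> pLn pL Ln1 L1 LnC LC Lcos f M cf fM.
have Lpoly q a t u : Ln n (fun x => q.[sin (a * x)] * cos (t * x + u)) @[n --> \oo] -->
    L (fun x => q.[sin (a * x)] * cos (t * x + u)).
  elim/poly_ind: q t u => [|q c IH] t u.
    have E : (fun x => (0 : {poly R}).[sin (a * x)] * cos (t * x + u)) =
        fun x => 0 * cos (t * x + u) + 0 * cos (t * x + u).
      by apply/funext => x; rewrite horner0 !mul0r addr0.
    have g := @quadratic_growth_poly_sin_cos 1 a t u.
    have {}g : quadratic_growth (fun x => cos (t * x + u)).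
      by move: g; under eq_fun do rewrite hornerE mul1r.
    rewrite E pL.1// !mul0r addr0; under eq_fun do rewrite (pLn _).1// !mul0r addr0.
    exact: cvg_cst.
  pose F1 x := q.[sin (a * x)] * cos ((t + a) * x + (u - pi / 2)).
  pose F2 x := q.[sin (a * x)] * cos ((t - a) * x + (u - pi / 2)).
  pose F3 x := 2^-1 * F1 x + (- 2^-1) * F2 x.
  pose F4 x := cos (t * x + u).
  have E : (fun x => (q * 'X + c%:P).[sin (a * x)] * cos (t * x + u)) =
      fun x => 1 * F3 x + c * F4 x.
    apply/funext => x; rewrite /F3 /F4 /F1 /F2 hornerMXaddC.
    have -> : (q.[sin (a * x)] * sin (a * x) + c) * cos (t * x + u) =
        q.[sin (a * x)] * (sin (a * x) * cos (t * x + u)) + c * cos (t * x + u).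
      by ring.
    rewrite sin_mul_cos.
    rewrite (_ : t * x + u + a * x - pi / 2 = (t + a) * x + (u - pi / 2)); last by ring.
    rewrite (_ : t * x + u - a * x - pi / 2 = (t - a) * x + (u - pi / 2)); last by ring.
    by ring.
  have g1 : quadratic_growth F1 by exact: quadratic_growth_poly_sin_cos.
  have g2 : quadratic_growth F2 by exact: quadratic_growth_poly_sin_cos.
  have g3 : quadratic_growth F3 by exact: quadratic_growth_lin.
  have g4 : quadratic_growth F4.
    apply: (@bounded_quadratic_growth _ 1); first exact: continuous_affine_cos.
    by move=> x; exact: cos_max.
  rewrite E pL.1// [L F3]pL.1//; under eq_fun do rewrite (pLn _).1// [Ln _ F3](pLn _).1//.
  apply: cvgD; apply: cvgM; try exact: cvg_cst; last exact: Lcos.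
  by apply: cvgD; (apply: cvgM; [exact: cvg_cst|exact: IH]).
have M0 : 0 <= M by apply: le_trans (fM 0).
have C0 : 0 <= C.
  apply: le_trans LC; rewrite -(mul0r (L (fun=> 1))) -[leLHS]addr0.
  rewrite -[X in _ + X](mul0r (L (fun=> 1))).
  have g1 := quadratic_growth_cst 1.
  rewrite -pL.1//; apply: pL.2; [exact: quadratic_growth_lin|exact: quadratic_growth_sqr|].
  by move=> x; rewrite !mul0r addr0 sqr_ge0.
apply/cvgrPdist_le => e' e'0; pose e := e' / 2; have e0 : 0 < e by rewrite divr_gt0.
(* Chosen so that [2 * M * C / A ^+ 2 <= e / 4], which is Chebyshev's bound for the part outside
   [[- A, A]]; the summand 1 keeps [A] positive when [M * C] vanishes. *)
pose A := Num.sqrt (1 + 8 * M * C / e).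
have B0 : 0 < 1 + 8 * M * C / e.
  by rewrite ltr_pwDl// divr_ge0 ?mulr_ge0// ltW.
have A0 : 0 < A by rewrite sqrtr_gt0.
have [q [a qP]] := @trig_approx R f M A (e / 4) cf fM A0 (divr_gt0 e0 (ltr0Sn _ _)).
(* The factor [cos 0 = 1] only puts [g] in the form to which [Lpoly] applies. *)
pose g x := q.[sin (a * x)] * cos (0 * x + 0).
have gE x : g x = q.[sin (a * x)] by rewrite /g mul0r addr0 cos0 mulr1.
have qg : quadratic_growth g by exact: quadratic_growth_poly_sin_cos.
have qf : quadratic_growth f by exact: bounded_quadratic_growth fM.
(* Inside [[- A, A]] the first term suffices; outside, both functions are bounded by [M] and
   [x ^+ 2 / A ^+ 2] is at least 1. *)
have fg x : `|f x - g x| <= e / 4 + 2 * M / A ^+ 2 * x ^+ 2.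
  rewrite gE; have [H1 H2] := qP x.
  have [xA|xA] := leP `|x| A.
    apply: le_trans (H1 xA) _; rewrite lerDl mulr_ge0 ?sqr_ge0// divr_ge0 ?sqr_ge0//.
    by rewrite mulr_ge0.
  have : 1 <= x ^+ 2 / A ^+ 2.
    rewrite ler_pdivlMr ?exprn_gt0// mul1r -[leRHS]real_normK ?num_real//.
    by rewrite ler_pXn2r ?nnegrE// ltW.
  move=> x1; apply: le_trans (ler_normB _ _) _.
  have -> : 2 * M / A ^+ 2 * x ^+ 2 = 2 * M * (x ^+ 2 / A ^+ 2).
    by field; rewrite gt_eqF.
  by have := fM x; move: H2 x1; nra.
have MA : 2 * M / A ^+ 2 * C <= e / 4.
  rewrite /A sqr_sqrtr ?(ltW B0)// mulrAC ler_pdivrMr//.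
  have -> : e / 4 * (1 + 8 * M * C / e) = e / 4 + 2 * M * C.
    by field; rewrite gt_eqF.
  by lra.
have MA0 : 0 <= 2 * M / A ^+ 2 by rewrite divr_ge0 ?sqr_ge0 ?mulr_ge0.
have approx L' : positive_linear L' -> L' (fun=> 1) = 1 -> L' (fun x => x ^+ 2) <= C ->
    `|L' f - L' g| <= e / 4 + e / 4.
  move=> pL' L'1 L'C.
  have g1 := quadratic_growth_cst 1.
  pose h x := e / 4 * 1 + 2 * M / A ^+ 2 * x ^+ 2.
  have qh : quadratic_growth h by apply: quadratic_growth_lin => //; exact: quadratic_growth_sqr.
  have hL : L' h <= e / 4 + e / 4.
    rewrite pL'.1//; last exact: quadratic_growth_sqr.
    rewrite L'1 mulr1 lerD2l; apply: le_trans MA.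
    by rewrite ler_wpM2l.
  have -> : L' f - L' g = L' (fun x => 1 * f x + (-1) * g x).
    by rewrite pL'.1//; ring.
  have qfg : quadratic_growth (fun x => 1 * f x + (-1) * g x) by exact: quadratic_growth_lin.
  have E x : `|1 * f x + -1 * g x| <= h x.
    by rewrite mul1r mulN1r /h mulr1.
  rewrite ler_norml; apply/andP; split.
    apply: (@le_trans _ _ (L' (fun x => (-1) * h x + 0 * h x))).
      by rewrite pL'.1//; lra.
    apply: pL'.2 => //; first exact: quadratic_growth_lin.
    by move=> x; have := E x; rewrite ler_norml; lra.
  apply: le_trans hL; apply: pL'.2 => // x.
  by have := E x; rewrite ler_norml; lra.
have /cvgrPdist_le /(_ _ (divr_gt0 e0 (ltr0Sn _ 3))) := Lpoly q a 0 0.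
have h1 := approx _ pL L1 LC.
apply: filterS => n Hn.
have h2 := approx _ (pLn n) (Ln1 n) (LnC n).
have -> : L f - Ln n f = (L f - L g) + (L g - Ln n g) - (Ln n f - Ln n g) by ring.
apply: le_trans (ler_normB _ _) _; apply: le_trans (lerD (ler_normD _ _) (lexx _)) _.
by move: h1 h2 Hn; rewrite -/g /e; lra.
Qed.

End cos_convergence.

Section second_moment.
Variables (R : realType) (nu : probability (measurableTypeR R) R).
Hypothesis nu2 : nu.-integrable setT (EFin \o (fun x : R => x ^+ 2)).

Lemma integrable_quadratic_growth (f : R -> R) : quadratic_growth f ->
  nu.-integrable setT (EFin \o f).
Proof.
move=> [cf [K fK]].
have i1 : nu.-integrable setT (EFin \o (fun x : R => K * (1 + x ^+ 2))).
  have i0 := integrableD measurableT (finite_measure_integrable_cst nu 1 measurableT) nu2.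
  by have := integrableZl measurableT K i0; exact: eq_integrable.
apply: le_integrable i1 => //.
  by apply/measurable_EFinP; exact: continuous_measurable_fun.
move=> x _ /=; rewrite lee_fin; apply: le_trans (fK x) _; exact: ler_norm.
Qed.

Lemma positive_linear_Rintegral :
  positive_linear (fun f : R -> R => \int[nu]_x f x).
Proof.
split.
- move=> f g a b /integrable_quadratic_growth qf /integrable_quadratic_growth qg.
  have zf h c : nu.-integrable setT (EFin \o h) -> nu.-integrable setT (EFin \o (fun x => c * h x)).
    by move=> ih; have := integrableZl measurableT c ih; exact: eq_integrable.
  by rewrite RintegralD//; [rewrite !RintegralZl//|exact: zf|exact: zf].
- move=> f g /integrable_quadratic_growth qf /integrable_quadratic_growth qg fg.
  by apply: le_Rintegral => // x _.
Qed.

Lemma Rintegral_probability1 : \int[nu]_x (1 : R) = 1.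
Proof. by rewrite Rintegral_cst//= probability_setT mulr1. Qed.

End second_moment.

(** * Second moment and cosine transform of the normal law *)

Section normal.
Variables (R : realType) (s : R).
Hypothesis s0 : s != 0.
Notation mu := (@lebesgue_measure R).
Notation nu := (normal_prob 0 s : probability (measurableTypeR R) R).
Notation g := (normal_pdf 0 s).

Lemma ge0_integral_normal_prob (f : R -> R) : (forall x, 0 <= f x) ->
  measurable_fun setT f ->
  (\int[nu]_x (f x)%:E = \int[mu]_x (f x * g x)%:E)%E.
Proof.
move=> f0 mf.
have dom := normal_prob_dominates 0 s.
have mf' : measurable_fun setT (EFin \o f) by exact/measurable_EFinP.
have mg' : measurable_fun setT (EFin \o g).
  by apply/measurable_EFinP; exact: measurable_normal_pdf.
rewrite -(Radon_Nikodym_SigmaFinite.change_of_variables dom)//.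
apply: ae_eq_integral => //.
- apply: emeasurable_funM => //.
  exact: measurable_int (Radon_Nikodym_SigmaFinite.f_integrable dom).
- by under eq_fun do rewrite EFinM; exact: emeasurable_funM.
under [in X in ae_eq _ _ _ X]eq_fun do rewrite EFinM.
apply: ae_eqe_mul2l; apply: integral_ae_eq => //.
- exact: Radon_Nikodym_SigmaFinite.f_integrable.
- move=> E _ mE; rewrite -Radon_Nikodym_SigmaFinite.f_integral//.
Qed.

(** The density with doubled standard deviation decays like [exp (- y)] where the given one decays
    like [exp (- 4 * y)]. The spare [exp (- 3 * y)] absorbs [x ^+ 2], a multiple of [y], so
    integrability of a density yields the second moment. *)
Lemma normal_pdf_sqr_le x : x ^+ 2 * g x <=
  8 * s ^+ 2 * normal_peak s / normal_peak (2 * s) * normal_pdf 0 (2 * s) x.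
Proof.
have s2 : 2 * s != 0 by rewrite mulf_neq0.
have p2 := normal_peak_gt0 s2.
rewrite !normal_pdfE// /normal_fun subr0.
set y := x ^+ 2 / (8 * s ^+ 2).
have s20 : 0 < s ^+ 2 by rewrite exprn_even_gt0.
have -> : - x ^+ 2 / (s ^+ 2 *+ 2) = - y + - (3 * y).
  by rewrite /y -mulr_natr; field.
have -> : - x ^+ 2 / ((2 * s) ^+ 2 *+ 2) = - y.
  by rewrite /y -mulr_natr; field.
have -> : 8 * s ^+ 2 * normal_peak s / normal_peak (2 * s) *
    (normal_peak (2 * s) * expR (- y)) = 8 * s ^+ 2 * normal_peak s * expR (- y).
  by field; rewrite gt_eqF.
have -> : x ^+ 2 = 8 * s ^+ 2 * y by rewrite /y; field.
have y0 : 0 <= y by rewrite divr_ge0 ?sqr_ge0// mulr_ge0// ltW.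
have h : y * expR (- (3 * y)) <= 1.
  rewrite expRN ler_pdivrMr ?expR_gt0// mul1r.
  have := expR_ge1Dx (3 * y); lra.
have e0 := expR_gt0 (- y).
have q0 := normal_peak_gt0 s0.
have K0 : 0 <= 8 * s ^+ 2 * normal_peak s * expR (- y) by apply/ltW; do 3![apply: mulr_gt0 => //].
have -> : 8 * s ^+ 2 * y * (normal_peak s * expR (- y + - (3 * y))) =
    8 * s ^+ 2 * normal_peak s * expR (- y) * (y * expR (- (3 * y))).
  by rewrite expRD; ring.
by rewrite -[leRHS]mulr1 ler_wpM2l.
Qed.

Lemma integrable_normal_pdf_sqr :
  mu.-integrable setT (EFin \o (fun x => x ^+ 2 * g x)).
Proof.
set C := 8 * s ^+ 2 * normal_peak s / normal_peak (2 * s).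
have i1 : mu.-integrable setT (fun x => C%:E * (normal_pdf 0 (2 * s) x)%:E)%E.
  by apply: integrableZl => //; exact: integrable_normal_pdf.
apply: le_integrable i1 => //.
  apply/measurable_EFinP; apply: measurable_funM; last exact: measurable_normal_pdf.
  exact: measurable_funX.
move=> x _ /=; rewrite lee_fin normrM [ `|g x|]ger0_norm ?normal_pdf_ge0//.
rewrite ger0_norm ?sqr_ge0//; apply: le_trans (normal_pdf_sqr_le x) _; exact: ler_norm.
Qed.

Lemma integrable_normal_prob_sqr : nu.-integrable setT (EFin \o (fun x : R => x ^+ 2)).
Proof.
have m2 : measurable_fun setT (fun x : R => x ^+ 2) by exact: measurable_funX.
apply/integrableP; split; first exact/measurable_EFinP.
under eq_integral do rewrite /= ger0_norm ?sqr_ge0//.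
rewrite ge0_integral_normal_prob//; last by move=> x; exact: sqr_ge0.
have /integrableP[_] := integrable_normal_pdf_sqr.
have pos x : 0 <= x ^+ 2 * g x by apply: mulr_ge0; [exact: sqr_ge0|exact: normal_pdf_ge0].
by under eq_integral do rewrite /= (ger0_norm (pos _)).
Qed.

Lemma quadratic_growth_normal_pdf (f : R -> R) : quadratic_growth f ->
  mu.-integrable setT (EFin \o (fun x => f x * g x)).
Proof.
move=> [cf [K fK]].
have i1 : mu.-integrable setT (EFin \o (fun x => K * (g x + x ^+ 2 * g x))).
  have i0 := integrableD measurableT (integrable_normal_pdf 0 s) integrable_normal_pdf_sqr.
  by have := integrableZl measurableT K i0; exact: eq_integrable.
apply: le_integrable i1 => //.
  apply/measurable_EFinP; apply: measurable_funM; last exact: measurable_normal_pdf.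
  exact: continuous_measurable_fun.
move=> x _ /=; rewrite lee_fin normrM [ `|g x|]ger0_norm ?normal_pdf_ge0//.
apply: le_trans (ler_norm _).
rewrite (_ : K * _ = K * (1 + x ^+ 2) * g x); last by ring.
by rewrite ler_wpM2r ?normal_pdf_ge0.
Qed.

Lemma Rintegral_normal_prob (f : R -> R) : quadratic_growth f ->
  \int[nu]_x f x = \int[mu]_x (f x * g x).
Proof.
move=> qf; have [cf [K fK]] := qf.
(* Change of variables is available for nonnegative functions: it is applied to [h] and to [f + h],
   and [h] is subtracted. *)
pose h x := K * (1 + x ^+ 2).
have qh : quadratic_growth h.
  have -> : h = fun x => K * 1 + K * x ^+ 2 by apply/funext => x; rewrite /h; ring.
  by apply: quadratic_growth_lin; [exact: quadratic_growth_cst|exact: quadratic_growth_sqr].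
have ge0 k : quadratic_growth k -> (forall x, 0 <= k x) -> \int[nu]_x k x = \int[mu]_x (k x * g x).
  move=> [ck _] k0; rewrite /Rintegral ge0_integral_normal_prob//.
  exact: continuous_measurable_fun.
have h0 x : 0 <= h x by apply: le_trans (fK x).
have qfh : quadratic_growth (fun x => 1 * f x + 1 * h x) by exact: quadratic_growth_lin.
have [pl _] := positive_linear_Rintegral integrable_normal_prob_sqr.
have := pl f h 1 1 qf qh; rewrite ge0//; last first.
  by move=> x; have := fK x; rewrite -/(h x) ler_norml; lra.
rewrite (ge0 h)// !mul1r.
have -> : (fun x => (1 * f x + 1 * h x) * g x) = fun x => f x * g x + h x * g x.
  by apply/funext => x; ring.
by rewrite RintegralD//; [move/addIr|exact: quadratic_growth_normal_pdf..].
Qed.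

Lemma is_derive_normal_pdf (x : R) : is_derive x 1 (g : R -> R) (- (x / s ^+ 2) * g x).
Proof.
rewrite normal_pdfE//.
have -> : (fun x => normal_peak s * normal_fun 0 s x) =
    (fun x : R => normal_peak s * expR (- (2 * s ^+ 2)^-1 * x ^+ 2)).
  apply/funext => y; rewrite /normal_fun subr0; congr (_ * expR _).
  by rewrite -mulr_natr; field.
apply: is_derive_eq.
rewrite /normal_fun subr0.
have -> : - x ^+ 2 / (s ^+ 2 *+ 2) = - (2 * s ^+ 2)^-1 * x ^+ 2.
  by rewrite -mulr_natr; field.
rewrite /GRing.scale/=.
by field.
Qed.

Let h (t u x : R) : R := cos (t * x + u) * g x.
Let h' (t u x : R) : R := (- t * sin (t * x + u) - s ^- 2 * (x * cos (t * x + u))) * g x.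

Let is_derive_h (t u x : R) : is_derive x 1 (h t u : R -> R) (h' t u x).
Proof.
have dg := is_derive_normal_pdf x.
have dc : is_derive x 1 (fun x : R => cos (t * x + u)) (- t * sin (t * x + u)).
  apply: is_derive_eq.
  by rewrite /GRing.scale/=; ring.
have := is_deriveM dc dg; rewrite /h /h' => H.
apply: (is_derive_eq H).
by rewrite /GRing.scale/=; field.
Qed.

Lemma quadratic_growth_mul_cos (t u : R) : quadratic_growth (fun x : R => x * cos (t * x + u)).
Proof.
split.
  by move=> x; apply: cvgM; [exact: cvg_id|exact: continuous_affine_cos].
exists 1 => x; rewrite normrM mul1r.
have : `|x| <= 1 + x ^+ 2.
  by rewrite -[x ^+ 2]real_normK ?num_real//; have := sqr_ge0 (`|x| - 2^-1); nra.
move=> h1; apply: le_trans _ h1; by rewrite -[leRHS]mulr1 ler_wpM2l// cos_max.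
Qed.

Let qgsin (t u : R) : quadratic_growth (fun x : R => sin (t * x + u)).
Proof.
apply: (@bounded_quadratic_growth _ _ 1); first exact: continuous_affine_sin.
by move=> x; exact: sin_max.
Qed.

Let qgcos (t u : R) : quadratic_growth (fun x : R => cos (t * x + u)).
Proof.
apply: (@bounded_quadratic_growth _ _ 1); first exact: continuous_affine_cos.
by move=> x; exact: cos_max.
Qed.

Let qgh' (t u : R) : quadratic_growth
  (fun x : R => - t * sin (t * x + u) - s ^- 2 * (x * cos (t * x + u))).
Proof.
have := quadratic_growth_lin (- t) (- s ^- 2) (qgsin t u) (quadratic_growth_mul_cos t u).
by under eq_fun do rewrite (mulNr (s ^- 2)).
Qed.

Let cvg_pdf (f : R^nat) : (forall n, n%:R <= `|f n|) -> g (f n) @[n --> \oo] --> (0 : R).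
Proof.
move=> fn; have s20 : 0 < 2 * s ^+ 2 by rewrite mulr_gt0// exprn_even_gt0.
have p0 := normal_peak_gt0 s0.
apply: (@squeeze_cvgr _ _ _ _ (cst 0) (fun n : nat => normal_peak s * (2 * s ^+ 2) * n%:R^-1)).
- near=> n; rewrite normal_pdf_ge0/= normal_pdfE// /normal_fun subr0 -mulrA.
  rewrite ler_wpM2l ?(ltW p0)//.
  have n0 : 0 < n%:R :> R by near: n; exact: nbhs_infty_gtr.
  have n1 : 1 <= n%:R :> R by rewrite -[1]/(1%:R) ler_nat -(ltr0n R).
  have f2 : n%:R <= f n ^+ 2.
    by have := fn n; rewrite -[f n ^+ 2]real_normK ?num_real//; nra.
  have -> : - f n ^+ 2 / (s ^+ 2 *+ 2) = - (f n ^+ 2 / (2 * s ^+ 2)).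
    by rewrite -mulr_natr; field.
  have c0 : 0 < n%:R / (2 * s ^+ 2) :> R by rewrite divr_gt0.
  apply: (@le_trans _ _ (n%:R / (2 * s ^+ 2))^-1); last by rewrite invf_div.
  rewrite expRN lef_pV2 ?posrE ?expR_gt0//.
  apply: le_trans (expR_ge1Dx _).
  rewrite -[leLHS]add0r lerD// ler_wpM2r// invr_ge0 ltW//.
- exact: cvg_cst.
- rewrite -[X in _ --> X](mulr0 (normal_peak s * (2 * s ^+ 2))).
  apply: cvgM; first exact: cvg_cst.
  by apply/gtr0_cvgV0; [near=> n; near: n; exact: nbhs_infty_gtr|exact: cvgr_idn].
Unshelve. all: by end_near. Qed.

(** [h'] is the derivative of [h], which vanishes at both ends: the fundamental theorem on growing
    intervals, then dominated convergence. *)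
Let integral_h' (t u : R) : \int[mu]_x h' t u x = 0.
Proof.
have ih' : mu.-integrable setT (EFin \o h' t u) by exact: quadratic_growth_normal_pdf.
have ch' : continuous (h' t u).
  move=> x; apply: cvgM; last exact: continuous_normal_pdf.
  by have [+ _] := qgh' t u; apply.
pose B n : set R := `[- n.+1%:R, n.+1%:R]%classic.
have FTC n : \int[mu]_(x in B n) h' t u x = h t u n.+1%:R - h t u (- n.+1%:R).
  rewrite /Rintegral (@continuous_FTC2 _ _ (h t u))//.
  - by rewrite -subr_gt0 opprK addr_gt0// ltr0n.
  - exact: continuous_subspaceT.
  - have ch : continuous (h t u).
      move=> x; apply: differentiable_continuous; apply/derivable1_diffP.
      by have [] := is_derive_h t u x.
    split.
    + by move=> x _; have [] := is_derive_h t u x.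
    + exact/cvg_at_right_filter/ch.
    + exact/cvg_at_left_filter/ch.
  - by move=> x _; rewrite derive1E; have [_ ->] := is_derive_h t u x.
have lim1 : \int[mu]_(x in B n) h' t u x @[n --> \oo] --> (0 : R).
  under eq_fun do rewrite FTC.
  rewrite -(subrr 0).
  have hb (f : R^nat) : (forall n, n%:R <= `|f n|) -> h t u (f n) @[n --> \oo] --> (0 : R).
    move=> fn; apply: norm_cvg0; apply: (@squeeze_cvgr _ _ _ _ (cst 0) (fun n => g (f n))).
    - near=> n; rewrite normr_ge0/= /h normrM (ger0_norm (normal_pdf_ge0 _ _ _)).
      by rewrite -[leRHS]mul1r ler_wpM2r ?normal_pdf_ge0// cos_max.
    - exact: cvg_cst.
    - exact: cvg_pdf.
  by apply: cvgB; apply: hb => n; rewrite ?normrN ger0_norm// ler_nat.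
suff lim2 : \int[mu]_(x in B n) h' t u x @[n --> \oo] --> \int[mu]_x h' t u x.
  by have := cvg_unique _ lim2 lim1; apply.
rewrite /Rintegral; apply: fine_cvg; rewrite fineK; last exact: integrable_fin_num.
pose f_ n : R -> \bar R := (EFin \o h' t u) \_ (B n).
have mB n : measurable (B n) by exact: measurable_itv.
have mh' : measurable_fun setT (EFin \o h' t u) by exact: measurable_int ih'.
have [|||||_ _ H] := @dominated_convergence _ _ _ mu setT measurableT f_ (EFin \o h' t u)
  (fun x => `|(h' t u x)%:E|%E).
- by move=> n; apply/(measurable_restrictT _ _).1; [exact: mB|exact: measurable_funTS].
- by [].
- apply: aeW => x _; apply: cvg_near_cst; near=> n.
  rewrite /f_ patchE mem_set// /B/= in_itv/= -ler_norml ltW//.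
  apply: (@le_lt_trans _ _ n%:R); last by rewrite ltr_nat.
  by near: n; exact: nbhs_infty_ger.
- exact: integrable_abse.
- apply: aeW => x n _; rewrite /f_ patchE; case: ifPn => //.
  by rewrite abse0.
by move: H; under eq_fun do rewrite -integral_mkcond.
Unshelve. all: by end_near. Qed.

Let L (f : R -> R) : R := \int[nu]_x f x.

Let positive_linear_L : positive_linear L.
Proof. exact: positive_linear_Rintegral integrable_normal_prob_sqr. Qed.

(** Stein's identity is [integral_h'] with the two terms of [h'] separated. *)
Let stein (t u : R) : L (fun x => x * cos (t * x + u)) = - s ^+ 2 * t * L (fun x => sin (t * x + u)).
Proof.
have [pl _] := positive_linear_L.
have := pl _ _ (- t) (- s ^- 2) (qgsin t u) (quadratic_growth_mul_cos t u).
have -> : (fun x => - t * sin (t * x + u) + - s ^- 2 * (x * cos (t * x + u))) =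
    fun x => - t * sin (t * x + u) - s ^- 2 * (x * cos (t * x + u)).
  by apply/funext => x; ring.
move=> H; have := etrans (esym H) (etrans (Rintegral_normal_prob (qgh' t u)) (integral_h' t u)).
set A := L _; set A' := L _ => {}H.
have : s ^+ 2 * (s ^- 2 * A') = s ^+ 2 * (- t * A).
  by congr (_ * _); lra.
by rewrite mulrA divff ?mul1r ?expf_neq0// => ->; ring.
Qed.

Let derive_cos (t u : R) : is_derive t 1 (fun t : R => L (fun x => cos (t * x + u)) : R)
  (- s ^+ 2 * t * L (fun x => cos (t * x + u))).
Proof.
have [pl mono] := positive_linear_L.
set F := fun t : R => _; set V := L (fun x => x ^+ 2).
have V0 : 0 <= V by apply: Rintegral_ge0 => x _; exact: sqr_ge0.
(* Differentiation under the integral sign: the Taylor remainder [(d * x) ^+ 2] integrates to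
   [d ^+ 2 * V], so the second moment replaces a domination argument. *)
have key d : `|F (t + d) - F t + d * (s ^+ 2 * t * F t)| <= d ^+ 2 * V.
  (* Shifting the phase by [pi / 2] turns Stein's identity for the cosine into the one for the sine,
     which is the derivative needed. *)
  have E : s ^+ 2 * t * F t = L (fun x => x * cos (t * x + (u - pi / 2))).
    rewrite stein.
    have -> : (fun x => sin (t * x + (u - pi / 2))) = fun x => (-1) * cos (t * x + u) + 0 * cos (t * x + u).
      by apply/funext => x; rewrite addrA sinBpihalf; ring.
    by rewrite pl// /F; ring.
  pose G1 x := 1 * cos ((t + d) * x + u) + (-1) * cos (t * x + u).
  have q1 : quadratic_growth G1 by exact: quadratic_growth_lin.
  have q2 := quadratic_growth_mul_cos t (u - pi / 2).
  have -> : F (t + d) - F t + d * (s ^+ 2 * t * F t) =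
      L (fun x => 1 * G1 x + d * (x * cos (t * x + (u - pi / 2)))).
    by rewrite E pl// /G1 pl//; rewrite /F; ring.
  have q3 : quadratic_growth (fun x => 1 * G1 x + d * (x * cos (t * x + (u - pi / 2)))).
    exact: quadratic_growth_lin.
  have b x : `|1 * G1 x + d * (x * cos (t * x + (u - pi / 2)))| <= d ^+ 2 * x ^+ 2.
    have := cos_taylor1 (t * x + u) (d * x).
    rewrite /G1 addrA cosBpihalf exprMn.
    rewrite (_ : t * x + u + d * x = (t + d) * x + u); last by ring.
    by congr (`|_| <= _); ring.
  have q4 c : quadratic_growth (fun x : R => c * x ^+ 2 + 0 * x ^+ 2).
    by apply: quadratic_growth_lin; exact: quadratic_growth_sqr.
  have L4 c : L (fun x => c * x ^+ 2 + 0 * x ^+ 2) = c * V.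
    by rewrite pl; [rewrite -/V; ring|exact: quadratic_growth_sqr..].
  rewrite ler_norml -mulNr -!L4; apply/andP; split; apply: mono => // x.
    by have := b x; rewrite ler_norml; lra.
  by have := b x; rewrite ler_norml; lra.
have lim : d^-1 *: (F (d *: 1 + t) - F t) @[d --> 0^'] --> - s ^+ 2 * t * F t.
  apply/cvgrPdist_le => e e0; near=> d.
  have d0 : d != 0 by near: d; exact: nbhs_dnbhs_neq.
  rewrite /GRing.scale/= mulr1 addrC (addrC d).
  have -> : - (d^-1 * (F (t + d) - F t)) + - s ^+ 2 * t * F t =
     - (d^-1 * (F (t + d) - F t + d * (s ^+ 2 * t * F t))) by field.
  rewrite normrN normrM normfV ler_pdivrMl ?normr_gt0//.
  apply: le_trans (key d) _.
  rewrite -[d ^+ 2]real_normK ?num_real// expr2 -mulrA ler_wpM2l//.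
  have : `|d| <= e / (V + 1).
    by near: d; apply: dnbhs0_le; rewrite divr_gt0//; lra.
  rewrite ler_pdivlMr; last lra.
  by have := normr_ge0 d; nra.
apply: DeriveDef; first by apply/cvg_ex; eexists; exact: lim.
exact: cvg_lim lim.
Unshelve. all: by end_near. Qed.

(* By Stein's identity, [t |-> \int cos (t x + u)] solves [y' = - s^2 t y]. *)
Theorem Rintegral_normal_cos (t u : R) :
  \int[nu]_x cos (t * x + u) = cos u * expR (- (s ^+ 2 * t ^+ 2 / 2)).
Proof.
pose F (t : R) : R := L (fun x => cos (t * x + u)).
pose G (t : R) : R := F t * expR (s ^+ 2 / 2 * t ^+ 2).
have dG (x : R) : is_derive x 1 (G : R -> R) 0.
  have dF := derive_cos x u.
  have dE : is_derive x 1 (fun t : R => expR (s ^+ 2 / 2 * t ^+ 2)) (s ^+ 2 * x * expR (s ^+ 2 / 2 * x ^+ 2)).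
    by apply: is_derive_eq; rewrite /GRing.scale/=; field.
  apply: (is_derive_eq (is_deriveM dF dE)).
  by rewrite /GRing.scale/=; ring.
have := is_derive_0_is_cst t 0 dG.
rewrite /G expr0n/= mulr0 expR0 mulr1.
have -> : F 0 = cos u.
  rewrite /F /L; under eq_Rintegral do rewrite mul0r add0r.
  by rewrite /L Rintegral_cst//= probability_setT mulr1.
move=> <-; rewrite -mulrA -expRD (_ : _ + _ = 0) ?expR0 ?mulr1//; ring.
Qed.

End normal.

(** * Martingale transforms of a sign process *)

Section history_expectation.
Variables (R : realType) (m : seq R -> R).
Implicit Types (l : seq R) (F G H : seq R -> R).

Definition sign_history n : pred (seq R) :=
  fun l => (size l == n) && all (fun x => (x == 1) || (x == -1)) l.

(* Expectation of [F (X_n, ..., X_1)] for the sign process whose conditional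
   mean given the history [l], most recent step first, is [m l]. *)
Fixpoint hexp n F : R :=
  if n is n'.+1
  then hexp n' (fun l => (1 + m l) / 2 * F (1 :: l) + (1 - m l) / 2 * F (-1 :: l))
  else F [::].

(* The martingale [\sum_i H (X_i, ..., X_1) (X_(i+1) - m (X_i, ..., X_1))]. *)
Fixpoint transform H l : R :=
  if l is x :: l' then transform H l' + H l' * (x - m l') else 0.

Hypothesis m_le1 : forall n l, sign_history n l -> `|m l| <= 1.

Lemma sign_history_cons n x l :
  sign_history n.+1 (x :: l) = ((x == 1) || (x == -1)) && sign_history n l.
Proof. by rewrite /sign_history /= eqSS andbCA. Qed.

Lemma hexp_le n F G : (forall l, sign_history n l -> F l <= G l) ->
  hexp n F <= hexp n G.
Proof.
elim: n F G => [|n IH] F G FG /=; first exact: FG.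
apply: IH => l hl; have := m_le1 hl; rewrite ler_norml => /andP[h1 h2].
by apply: lerD; apply: ler_wpM2l; [lra| |lra|]; apply: FG;
  rewrite sign_history_cons hl eqxx ?orbT.
Qed.

Lemma eq_hexp n F G : (forall l, sign_history n l -> F l = G l) ->
  hexp n F = hexp n G.
Proof.
by move=> FG; apply: le_anti; rewrite !hexp_le// => l hl; rewrite FG.
Qed.

Lemma hexp_lin n F G a b :
  hexp n (fun l => a * F l + b * G l) = a * hexp n F + b * hexp n G.
Proof.
elim: n F G => [//|n IH] F G /=; rewrite -IH.
by congr hexp; apply/funext => l; ring.
Qed.

Lemma hexpD n F G : hexp n (fun l => F l + G l) = hexp n F + hexp n G.
Proof.
rewrite -[hexp n F]mul1r -[hexp n G]mul1r -hexp_lin.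
by congr hexp; apply/funext => l; ring.
Qed.

Lemma hexpZ n F a : hexp n (fun l => a * F l) = a * hexp n F.
Proof.
rewrite -[RHS]addr0 -[X in _ = _ + X](mul0r (hexp n F)) -hexp_lin.
by congr hexp; apply/funext => l; ring.
Qed.

Lemma hexp_cst n a : hexp n (fun=> a) = a.
Proof.
elim: n => [//|n IH] /=; rewrite -[RHS]IH.
by congr hexp; apply/funext => l; field.
Qed.

Lemma norm_hexp_le n F G : (forall l, sign_history n l -> `|F l| <= G l) ->
  `|hexp n F| <= hexp n G.
Proof.
move=> FG; rewrite ler_norml -mulN1r -hexpZ; apply/andP; split.
  by apply: hexp_le => l /FG; rewrite ler_norml mulN1r => /andP[].
by apply: hexp_le => l /FG; rewrite ler_norml => /andP[].
Qed.

Lemma hexp_ge0 n F : (forall l, sign_history n l -> 0 <= F l) -> 0 <= hexp n F.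
Proof. by move=> F0; rewrite -(hexp_cst n 0) hexp_le. Qed.

(** Martingale increments are orthogonal: the cross term has conditional mean zero, and a sign with
    mean [m l] has variance [1 - m l ^+ 2]. *)
Lemma hexp_sqr_transformS n H : hexp n.+1 (fun l => transform H l ^+ 2) =
  hexp n (fun l => transform H l ^+ 2) + hexp n (fun l => H l ^+ 2 * (1 - m l ^+ 2)).
Proof. by rewrite -hexpD /=; congr hexp; apply/funext => l; field. Qed.

Lemma hexp_sqr_transform n H (c : nat -> R) :
  (forall i l, (i < n)%N -> sign_history i l -> H l ^+ 2 <= c i) ->
  hexp n (fun l => transform H l ^+ 2) <= \sum_(i < n) c i.
Proof.
elim: n => [|n IH] Hc; first by rewrite big_ord0 /= expr0n.
rewrite hexp_sqr_transformS big_ord_recr/=; apply: lerD.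
  by apply: IH => i l ni; apply: Hc; exact: ltnW.
rewrite -[leRHS](hexp_cst n); apply: hexp_le => l hl.
have h1 := Hc _ _ (ltnSn n) hl.
apply: le_trans h1; rewrite -[leRHS]mulr1 ler_wpM2l ?sqr_ge0//.
by rewrite gerBl sqr_ge0.
Qed.

(* Telescoping: the characteristic function gains the factor
   [expR (- v * c n ^+ 2 / 2)] at each step, up to a Taylor remainder and the
   fluctuation of the conditional variance around [v]. *)
Lemma hexp_cos_transform n (c : nat -> R) (v u : R) : 0 <= v <= 1 ->
  `|hexp n (fun l => cos (transform (c \o size) l + u)) -
    expR (- (v * (\sum_(i < n) c i ^+ 2) / 2)) * cos u| <=
  \sum_(i < n) (c i ^+ 2 * hexp i (fun l => `|1 - m l ^+ 2 - v|) +
    (8 * `|c i| ^+ 3 + 17 * c i ^+ 4)).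
Proof.
move=> /andP[v0 v1]; elim: n => [|n IH].
  by rewrite !big_ord0 /= mulr0 mul0r oppr0 expR0 mul1r add0r subrr normr0.
pose f l := cos (transform (c \o size) l + u).
rewrite !big_ord_recr/=.
set S := \sum_(i < n) c i ^+ 2 in IH *.
set E := \sum_(i < n) _ in IH *.
set g := fun l => (1 + m l) / 2 * _ + _.
pose e := expR (- (v * c n ^+ 2 / 2)).
have e1 : e <= 1.
  by rewrite -expR0 ler_expR oppr_le0 divr_ge0// mulr_ge0// sqr_ge0.
have e0 : 0 <= e by exact: expR_ge0.
have step : `|hexp n g - e * hexp n f| <=
    c n ^+ 2 * hexp n (fun l => `|1 - m l ^+ 2 - v|) +
    (8 * `|c n| ^+ 3 + 17 * c n ^+ 4).
  have -> : hexp n g - e * hexp n f = hexp n (fun l => 1 * g l + (- e) * f l).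
    by rewrite hexp_lin; ring.
  have -> : c n ^+ 2 * hexp n (fun l => `|1 - m l ^+ 2 - v|) +
      (8 * `|c n| ^+ 3 + 17 * c n ^+ 4) =
      hexp n (fun l => c n ^+ 2 * `|1 - m l ^+ 2 - v| + (8 * `|c n| ^+ 3 + 17 * c n ^+ 4)).
    by rewrite hexpD hexpZ hexp_cst.
  apply: norm_hexp_le => l hl.
  have ml := m_le1 hl; have ml' := ml; move: ml'; rewrite ler_norml => /andP[ml1 ml2].
  have sz : size l = n by move: hl => /andP[/eqP].
  rewrite /g /f /= sz; set A := transform _ l; set M := m l in ml1 ml2 *.
  (* An increment is at most [2 * |c n|] in absolute value, hence the constants [2 ^+ 3 = 8] and
     [2 ^+ 4 = 16]; the seventeenth fourth power comes from expanding the exponential. *)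
  have bound s : s = 1 \/ s = -1 ->
      `|cos (A + c n * (s - M) + u) - cos (A + u) + c n * (s - M) * sin (A + u) +
       (c n * (s - M)) ^+ 2 / 2 * cos (A + u)| <= 8 * `|c n| ^+ 3 + 16 * c n ^+ 4.
    move=> hs; have sM : `|s - M| <= 2.
      by apply: le_trans (ler_normB _ _) _; case: hs => ->;
        rewrite ?normrN normr1 -[2]/(1 + 1) lerD2l.
    rewrite (addrAC A); apply: le_trans (cos_taylor2 _ _) _; apply: lerD.
      rewrite normrM exprMn mulrC ler_wpM2r ?exprn_ge0//.
      by rewrite (_ : 8 = 2 ^+ 3); [rewrite ler_pXn2r// nnegrE|ring].
    rewrite exprMn mulrC ler_wpM2r//; first by rewrite (_ : 4%N = 2 * 2)%N// exprM sqr_ge0.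
    rewrite -[leLHS]ger0_norm; last by rewrite (_ : 4%N = 2 * 2)%N// exprM sqr_ge0.
    by rewrite normrX (_ : 16 = 2 ^+ 4); [rewrite ler_pXn2r// nnegrE|ring].
  have b1 := bound 1 (or_introl erefl); have b2 := bound (-1) (or_intror erefl).
  set c1 := cos (A + c n * (1 - M) + u) in b1 *.
  set c2 := cos (A + c n * (-1 - M) + u) in b2 *.
  set C := cos (A + u) in b1 b2 *.
  have y0 : 0 <= v * c n ^+ 2 / 2 by rewrite divr_ge0// mulr_ge0// sqr_ge0.
  have be := expR_taylor1 y0; rewrite -/e in be.
  set y := v * c n ^+ 2 / 2 in be y0.
  have be' : `|e - 1 + y| <= c n ^+ 4.
    apply: le_trans be _; rewrite /y.
    have -> : (v * c n ^+ 2 / 2) ^+ 2 = v ^+ 2 / 4 * c n ^+ 4 by field.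
    rewrite -[leRHS]mul1r ler_wpM2r//; first by rewrite (_ : 4%N = 2 * 2)%N// exprM sqr_ge0.
    nra.
  set t1 := _ - _ + _ + _ in b1; set t2 := _ - _ + _ + _ in b2.
  (* Averaging over the two signs kills the first-order terms and turns the second-order ones into
     the conditional variance [1 - M ^+ 2], of which [v] is matched by [e]. *)
  have -> : 1 * ((1 + M) / 2 * c1 + (1 - M) / 2 * c2) + - e * C =
     (1 + M) / 2 * t1 + (1 - M) / 2 * t2 - C * (e - 1 + y)
     - C * (c n ^+ 2 / 2) * (1 - M ^+ 2 - v).
    by rewrite /t1 /t2 /y; field.
  apply: le_trans (ler_normB _ _) _; rewrite addrC; apply: lerD.
    rewrite normrM ler_wpM2r// normrM -[leRHS]mul1r ler_pM//; first exact: cos_max.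
    by rewrite ger0_norm ?divr_ge0 ?sqr_ge0// ler_pdivrMr//; have := sqr_ge0 (c n); lra.
  apply: le_trans (ler_normB _ _) _.
  rewrite (_ : 8 * `|c n| ^+ 3 + 17 * c n ^+ 4 = 8 * `|c n| ^+ 3 + 16 * c n ^+ 4 + c n ^+ 4); last by ring.
  apply: lerD; last first.
    rewrite normrM -[leRHS]mul1r ler_pM//; exact: cos_max.
  have p1 : 0 <= (1 + M) / 2 by lra.
  have p2 : 0 <= (1 - M) / 2 by lra.
  apply: le_trans (ler_normD _ _) _.
  rewrite (normrM _ t1) (normrM _ t2) (ger0_norm p1) (ger0_norm p2).
  move: (ler_wpM2l p1 b1) (ler_wpM2l p2 b2); rewrite -/t1 -/t2.
  by lra.
have -> : expR (- (v * (S + c n ^+ 2) / 2)) = expR (- (v * S / 2)) * e.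
  by rewrite /e -expRD; congr expR; field.
(* Since [e <= 1], the error accumulated so far is carried along without growing. *)
rewrite (_ : _ - _ = (hexp n g - e * hexp n f) + e * (hexp n f - expR (- (v * S / 2)) * cos u)); last by ring.
apply: le_trans (ler_normD _ _) _; rewrite [leRHS]addrC; apply: lerD; [exact: step|].
rewrite normrM (ger0_norm e0); apply: le_trans IH.
by rewrite -[leRHS]mul1r ler_wpM2r.
Qed.

End history_expectation.

(** * The law of the first steps of the walk *)

Section memory_drift.
Variables (R : realType) (ret : pred nat) (p lam q : R).
Implicit Types (l : seq R).

Definition retained_count n : R := \sum_(1 <= i < n.+1) (ret i)%:R.

(** The most recent step comes first, and [l] inside the branch is still the whole list: its head is
    step number [size l]. *)
Fixpoint retained_sum l : R :=
  if l is x :: l' then retained_sum l' + (ret (size l))%:R * x else 0.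

(* The conditional mean of the next step given the history [l]; [q] is the mean of [X_1]. *)
Definition memory_drift l : R :=
  if l is [::] then q
  else (2 * p - 1) * (retained_sum l / (size l)%:R) +
       (2 * lam - 1) * (((size l)%:R - retained_count (size l)) / (size l)%:R).

Lemma retained_countS n : retained_count n.+1 = retained_count n + (ret n.+1)%:R.
Proof. by rewrite /retained_count big_nat_recr. Qed.

Lemma retained_count_bounds n : 0 <= retained_count n <= n%:R.
Proof.
elim: n => [|n /andP[h1 h2]]; first by rewrite /retained_count big_nil lexx.
by rewrite retained_countS -natr1; case: (ret _) => /=; lra.
Qed.

Lemma norm_retained_sum_le n l : sign_history n l -> `|retained_sum l| <= retained_count n.
Proof.
elim: n l => [|n IH] [|x l]; rewrite ?sign_history_cons//.
  by move=> _; rewrite /= normr0 /retained_count big_nil.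
move=> /andP[hx hl]; rewrite /= retained_countS.
have -> : size l = n by move: hl => /andP[/eqP].
apply: le_trans (ler_normD _ _) _; apply: lerD; first exact: IH.
rewrite normrM normr_nat -[leRHS]mulr1 ler_wpM2l//.
by case/orP: hx => /eqP ->; rewrite ?normrN normr1.
Qed.

Lemma norm_memory_drift_le1 n l : 0 <= p <= 1 -> 0 <= lam <= 1 -> `|q| <= 1 ->
  sign_history n l -> `|memory_drift l| <= 1.
Proof.
move=> p01 lam01 q1; case: l => [//|x l] hl.
have hs := norm_retained_sum_le hl; rewrite /memory_drift.
have -> : size (x :: l) = n by move: hl => /andP[/eqP].
have n0 : 0 < n%:R :> R.
  by move: hl => /andP[/eqP <-] _; rewrite ltr0n.
move: (retained_count_bounds n) => /andP[c0 cn].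
rewrite 2!mulrA -mulrDl normrM normfV (gtr0_norm n0) ler_pdivrMr// mul1r.
apply: le_trans (ler_normD _ _) _; rewrite !normrM.
have a1 : `|2 * p - 1| <= 1 by rewrite ler_norml; lra.
have b1 : `|2 * lam - 1| <= 1 by rewrite ler_norml; lra.
rewrite (ger0_norm (_ : 0 <= n%:R - _)) ?subr_ge0//.
have := ler_pM (normr_ge0 _) (normr_ge0 _) a1 hs.
have h : 0 <= n%:R - retained_count n by rewrite subr_ge0.
have := ler_wpM2r h b1; lra.
Qed.

Lemma retained_sumE n l : size l = n ->
  retained_sum l = \sum_(i < n) (ret i.+1)%:R * nth 0 l (n - i.+1).
Proof.
elim: n l => [|n IH] [|x l]//=; first by rewrite big_ord0.
move=> [sl]; rewrite big_ord_recr/= subnn sl (IH _ sl); congr (_ + _).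
by apply: eq_bigr => i _; rewrite subSS -(subnSK (ltn_ord i)).
Qed.

(** For a sign [s], the left side is the conditional probability that the next step is [s]; the
    right side is the same probability split along the uniform index, with [eps] acting on retained
    indices and [Y] on tampered ones. *)
Lemma memory_drift_step n l (s : R) : size l = n.+1 ->
  (1 + s * memory_drift l) / 2 = \sum_(i < n.+1) (n.+1)%:R^-1 *
    (if ret i.+1 then (1 + s * nth 0 l (n - i) * (2 * p - 1)) / 2
     else (1 + s * (2 * lam - 1)) / 2).
Proof.
move=> sl; rewrite /memory_drift; case: l sl => [//|x l] sl.
rewrite sl (retained_sumE sl) /retained_count big_add1 big_mkord/=.
rewrite -mulr_sumr.
have n0 : n.+1%:R != 0 :> R by rewrite pnatr_eq0.
set Sr := \sum_(i < n.+1) (ret i.+1)%:R; set W := \sum_(i < n.+1) _ * _.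
have -> : \sum_(i < n.+1) (if ret i.+1 then (1 + s * nth 0 (x :: l) (n - i) * (2 * p - 1)) / 2
     else (1 + s * (2 * lam - 1)) / 2) =
  n.+1%:R / 2 + s * (2 * p - 1) / 2 * W + (s * (2 * lam - 1) / 2) * (n.+1%:R - Sr).
  have -> : n.+1%:R = \sum_(i < n.+1) 1 :> R by rewrite sumr_const card_ord.
  rewrite /W /Sr -sumrB mulr_suml !mulr_sumr -!big_split/=.
  by apply: eq_bigr => i _; rewrite subSS; case: (ret i.+1) => /=; field.
by field; rewrite nat1r.
Qed.

End memory_drift.

(** The sets need to cover the space only up to a null set: the index variables take their
    prescribed values almost surely. *)
Lemma probability_partition d (T : measurableType d) (R : realType)
    (P : probability T R) n (U : 'I_n -> set T) (S : set T) :
  (forall i, measurable (U i)) -> trivIset setT U ->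
  (\sum_(i < n) P (U i) = 1)%E -> measurable S ->
  P S = (\sum_(i < n) P (S `&` U i))%E.
Proof.
move=> mU tU sU mS; pose V := \big[setU/set0]_(i < n) U i.
have mV : measurable V by exact: bigsetU_measurable.
have PV : P V = 1%E by rewrite measure_bigsetU_ord.
have mSU i : measurable (S `&` U i) by exact: measurableI.
rewrite -(measure_bigsetU_ord P xpredT)//; last first.
  by apply: trivIset_setIl.
rewrite -big_distrr/= -/V.
rewrite -{1}(setIT S) -(setUv V) setIUr measureU//.
- rewrite [X in (_ + X)%E](_ : _ = 0%E) ?adde0//.
  apply/eqP; rewrite eq_le measure_ge0 andbT.
  apply: (@le_trans _ _ (P (~` V))).
    by apply: le_measure; rewrite ?inE//; [apply: measurableI => //; exact: measurableC|exact: measurableC].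
  by rewrite probability_setC// PV subee.
- exact: measurableI.
- by apply: measurableI => //; exact: measurableC.
- by rewrite setIACA setICr setI0.
Qed.

(** Adjoins one event to a family indexed by a finite set while keeping the form in which mutual
    independence is stated. *)
Lemma bigcap_fset_override (K : choiceType) d (T : measurableType d)
    (a : K) (A : set T) (J : {fset K}) (E : K -> set T) : a \notin J ->
  \bigcap_(j in [set` (a |` J)%fset]) (if j == a then A else E j) =
  A `&` \bigcap_(j in [set` J]) E j.
Proof.
move=> aJ; rewrite bigcap_fsetU1 eqxx; congr (_ `&` _).
apply: eq_bigcapr => j /= jJ; case: eqVneq => // ja.
by rewrite -ja jJ in aJ.
Qed.

Lemma prode_fset_override (K : choiceType) (R : realType)
    (a : K) d (T : measurableType d) (P : set T -> \bar R) (A : set T)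
    (J : {fset K}) (E : K -> set T) : a \notin J ->
  (\prod_(j <- (a |` J)%fset) P (if j == a then A else E j) =
   P A * \prod_(j <- J) P (E j))%E.
Proof.
move=> aJ; rewrite big_fsetU1//= eqxx; congr (_ * _)%E.
apply: eq_big_seq => j /= jJ; case: eqVneq => // ja.
by rewrite -ja jJ in aJ.
Qed.

Section history_law.
Variables (d : measure_display) (T : measurableType d) (R : realType).
Variables (P : probability T R) (p lam : R) (D : nat -> set nat) (ret : pred nat).
Variables (Y eps : nat -> {RV P >-> R}) (I : nat -> {RV P >-> nat}).
Variable X : nat -> {RV P >-> R}.
Hypothesis hX : is_tmerw p lam D Y eps I X.
Hypothesis hret : forall n i, (1 <= i <= n)%N -> (D n i <-> ~~ ret i).

Definition first_mean : R := 2 * fine (P (X 1%N @^-1` [set 1])) - 1.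

Let m := memory_drift ret p lam first_mean.

Fixpoint history n (w : T) : seq R :=
  if n is n'.+1 then X n w :: history n' w else [::].

Lemma size_history n w : size (history n w) = n.
Proof. by elim: n => //= n ->. Qed.

Lemma nth_history n i w : (i < n)%N -> nth 0 (history n w) (n - i.+1) = X i.+1 w.
Proof.
elim: n => [//|n IH]; rewrite ltnS leq_eqVlt subSS => /predU1P[->|i_n].
  by rewrite subnn.
by rewrite -(subnSK i_n) /= IH.
Qed.

Lemma history_preimage n s l :
  [set w | history n.+1 w = s :: l] = X n.+1 @^-1` [set s] `&` [set w | history n w = l].
Proof. by apply/seteqP; split => w /= [-> ->]. Qed.

Lemma measurable_history n l : measurable [set w | history n w = l].
Proof.
elim: n l => [|n IH] [|s l].
- by rewrite (_ : [set _ | _] = setT)//; apply/seteqP; split.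
- by rewrite (_ : [set _ | _] = set0)//; apply/seteqP; split.
- by rewrite (_ : [set _ | _] = set0)//; apply/seteqP; split.
- by rewrite history_preimage; apply: measurableI => //; exact: measurable_funPTI.
Qed.

Definition index_time (i : tmerw_index) : nat :=
  match i with
  | inl _ => 1
  | inr (inl n) => n.+2
  | inr (inr (inl n)) => n.+2
  | inr (inr (inr n)) => n.+2
  end.

Lemma measurable_tmerw_sigma j A : tmerw_sigma (X 1%N) Y eps I j A -> measurable A.
Proof.
by case: j => [?|[n|[n|n]]] [B mB <-]; rewrite setTI; exact: measurable_funPTI.
Qed.

Lemma hexp_eq_cons n s l : (s == 1) || (s == -1) ->
  hexp m n.+1 (fun l' => (l' == s :: l)%:R) =
  (1 + s * m l) / 2 * hexp m n (fun l' => (l' == l)%:R).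
Proof.
move=> hs; rewrite -hexpZ /=; congr hexp; apply/funext => l'.
rewrite !eqseq_cons; have [->|ll] := eqVneq l' l; last by rewrite !andbF !mulr0 addr0.
rewrite !andbT mulr1; have n11 : (-1 == 1 :> R) = false by apply/eqP; lra.
by case/orP: hs => /eqP ->; rewrite ?eqxx ?[1 == -1]eq_sym n11 ?mulr1 ?mulr0 ?addr0 ?add0r//; ring.
Qed.

Lemma preimage_sigma_of d' (U : measurableType d') (Z : T -> U) (B : set U) :
  measurable B -> sigma_of Z (Z @^-1` B).
Proof. by move=> mB; exists B => //; rewrite setTI. Qed.

Let sign_law (Z : {RV P >-> R}) (r s x : R) :
  P [set w | Z w = 1] = r%:E /\ P [set w | Z w = -1] = (1 - r)%:E ->
  (s == 1) || (s == -1) -> (x == 1) || (x == -1) ->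
  P (Z @^-1` [set s * x]) = ((1 + s * x * (2 * r - 1)) / 2)%:E.
Proof.
move=> [h1 h2] /orP[] /eqP -> /orP[] /eqP ->; rewrite ?mulNr ?mulrN ?mulr1 ?opprK ?mul1r.
- by rewrite [LHS]h1; congr EFin; field.
- by rewrite [LHS]h2; congr EFin; field.
- by rewrite [LHS]h2; congr EFin; field.
- by rewrite [LHS]h1; congr EFin; field.
Qed.

(** The family [J] of events about later variables is what the induction feeds: splitting along [I]
    rewrites the last step as one event on [I] and one on [eps] or [Y]. Both join [J], and the
    history left over is one step shorter. With no history left, the claim is mutual
    independence. *)
Lemma history_law n l (J : {fset tmerw_index}) E : sign_history n l ->
  (forall j, j \in J -> (n < index_time j)%N) ->
  (forall j, j \in J -> tmerw_sigma (X 1%N) Y eps I j (E j)) ->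
  P ([set w | history n w = l] `&` \bigcap_(j in [set` J]) E j) =
  ((hexp m n (fun l' => (l' == l)%:R))%:E * \prod_(j <- J) P (E j))%E.
Proof.
elim: n l J E => [|n IH] l J E.
  case: l => // _ _ JE; rewrite (_ : [set _ | _] = setT); last by apply/seteqP; split.
  by rewrite setTI /= mul1e; exact: (tmerw_indep hX).
case: l => // s l; rewrite sign_history_cons => /andP[hs hl] Jn JE.
have mJ : measurable (\bigcap_(j in [set` J]) E j).
  by apply: fin_bigcap_measurable => // j /= /JE; exact: measurable_tmerw_sigma.
rewrite hexp_eq_cons//.
(* The first step uses no index: its law is that of [X 1], which takes only the values -1 and 1 and
   so is determined by [first_mean]. *)
case: n IH hl Jn => [|k] IH hl Jn.
  have aJ : (inl tt : tmerw_index) \notin J by apply/negP => /Jn.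
  move: hl; case: l => // _; rewrite /= mulr1 history_preimage.
  rewrite (_ : [set _ | history 0 _ = _] = setT); last by apply/seteqP; split.
  rewrite setIT -(bigcap_fset_override _ _ aJ) (tmerw_indep hX); last first.
    move=> j; rewrite in_fset1U; case: eqVneq => [->|_] /=; last exact: JE.
    by move=> _; apply: preimage_sigma_of; exact: measurable_set1.
  rewrite prode_fset_override//; congr (_ * _)%E.
  have m1 : measurable (X 1%N @^-1` [set 1]) by apply: measurable_funPTI; exact: measurable_set1.
  have P1 : P (X 1%N @^-1` [set 1]) = ((1 + first_mean) / 2)%:E.
    rewrite -[LHS]fineK; first by congr EFin; rewrite /first_mean; field.
    exact: fin_num_measure.
  case/orP: hs => /eqP ->; first by rewrite P1 mul1r.
  have -> : X 1%N @^-1` [set -1] = ~` (X 1%N @^-1` [set 1]).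
    have n11 : (-1 : R) <> 1 by lra.
    apply/seteqP; split => w /=; first by move=> -> /n11.
    by case: (tmerw_first hX w).
  by rewrite probability_setC// P1 -EFinB; congr EFin; field.
have sl : size l = k.+1 by move: hl => /andP[/eqP].
set S := _ `&` _.
have mS : measurable S by apply: measurableI => //; exact: measurable_history.
pose U (i : 'I_k.+1) := I k.+2 @^-1` [set i.+1].
have PU i : P (U i) = (k.+1%:R^-1)%:E by rewrite [LHS](tmerw_I hX)//= ltn_ord.
rewrite (@probability_partition _ _ _ _ k.+1 U)//; first last.
- under eq_bigr do rewrite PU.
  by rewrite sumEFin sumr_const card_ord -[_ *+ _]mulr_natr mulVf// pnatr_eq0.
- move=> i j _ _ [w [/= h1 h2]]; apply/val_inj => /=.
  by apply: succn_inj; rewrite -h1 -h2.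
- by move=> i; exact: measurable_funPTI.
pose x (i : 'I_k.+1) := nth 0 l (k - i).
have hx i : (x i == 1) || (x i == -1).
  move: hl => /andP[_ /allP]; apply; apply: mem_nth; rewrite sl ltnS.
  exact: leq_subr.
pose a1 : tmerw_index := inr (inr (inr k)).
pose a2 (i : 'I_k.+1) : tmerw_index :=
  if ret i.+1 then inr (inr (inl k)) else inr (inl k).
(* Given the history and the index, the next step is [s] exactly when [eps] equals [s * x i], as
   [x i] squares to 1, or when [Y] equals [s]. Writing [s * 1] lets [sign_law] serve both cases. *)
pose A2 (i : 'I_k.+1) :=
  if ret i.+1 then eps k.+2 @^-1` [set s * x i] else Y k.+2 @^-1` [set s * 1].
have a2J i : a2 i \notin J.
  by apply/negP => /Jn; rewrite /a2; case: ifP => _ /=; rewrite ltnn.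
have [r pE] : exists r, (\prod_(j <- J) P (E j) = r%:E)%E.
  exists (\prod_(j <- J) fine (P (E j))); rewrite -prodEFin.
  apply: eq_big_seq => j jJ; rewrite fineK// fin_num_measure//.
  exact: measurable_tmerw_sigma (JE _ jJ).
have a1J i : a1 \notin (a2 i |` J)%fset.
  rewrite in_fset1U negb_or; apply/andP; split; first by rewrite /a2; case: ifP.
  by apply/negP => /Jn; rewrite /= ltnn.
have SU i : S `&` U i = [set w | history k.+1 w = l] `&`
    (U i `&` (A2 i `&` \bigcap_(j in [set` J]) E j)).
  have ik : (1 <= i.+1 <= k.+1)%N by rewrite /= ltn_ord.
  have hxi w : history k.+1 w = l -> X i.+1 w = x i.
    by move=> hw; rewrite -(nth_history w (ltn_ord i)) hw subSS.
  have xx : x i * x i = 1 by case/orP: (hx i) => /eqP ->; rewrite ?mulrNN mulr1.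
  rewrite /S history_preimage /A2; apply/seteqP; split => w /=.
    move=> [[[Xs hw] JEw] Iw]; split => //; split => //; split => //.
    case: ifPn => ri.
      have := @tmerw_retained _ _ _ _ _ _ _ _ _ _ _ hX k.+1 w isT.
      rewrite Iw => /(_ _)/wrap[|]; first by move/(hret ik); rewrite ri.
      by rewrite Xs (hxi w hw) => ->; rewrite -mulrA xx mulr1.
    have := @tmerw_tampered _ _ _ _ _ _ _ _ _ _ _ hX k.+1 w isT.
    by rewrite Iw => /(_ ((hret ik).2 ri)) /= <-; rewrite Xs mulr1.
  move=> [hw [Iw [Aw JEw]]]; split => //; split => //; split => //.
  move: Aw; case: ifPn => ri /= Aw.
    have := @tmerw_retained _ _ _ _ _ _ _ _ _ _ _ hX k.+1 w isT.
    rewrite Iw => /(_ _)/wrap[|]; first by move/(hret ik); rewrite ri.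
    by move=> ->; rewrite Aw (hxi w hw) -mulrA xx mulr1.
  have := @tmerw_tampered _ _ _ _ _ _ _ _ _ _ _ hX k.+1 w isT.
  by rewrite Iw => /(_ ((hret ik).2 ri)) ->; rewrite Aw mulr1.
under eq_bigr => i _.
  rewrite SU -(bigcap_fset_override (A2 i) E (a2J i)).
  rewrite -(bigcap_fset_override (U i) _ (a1J i)) IH//; first last.
  - move=> j; rewrite in_fset1U; case: eqVneq => [->|_] /=.
      by move=> _; exact: preimage_sigma_of.
    rewrite in_fset1U; case: eqVneq => [->|_] /=; last exact: JE.
    by move=> _; rewrite /a2 /A2; case: ifP => _ /=; apply: preimage_sigma_of; exact: measurable_set1.
  - move=> j; rewrite !in_fset1U => /orP[/eqP ->//|/orP[/eqP ->|/Jn/ltnW//]].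
    by rewrite /a2; case: ifP.
  rewrite prode_fset_override// prode_fset_override// PU.
  have -> : P (A2 i) = (if ret i.+1 then (1 + s * x i * (2 * p - 1)) / 2
      else (1 + s * (2 * lam - 1)) / 2)%:E.
    rewrite /A2; case: ifP => _; first exact: sign_law (tmerw_eps hX _) _ _.
    by rewrite (sign_law (tmerw_Y hX _))// ?eqxx// mulr1.
  rewrite pE -!EFinM.
  over.
rewrite sumEFin pE -EFinM; congr EFin.
rewrite (memory_drift_step _ _ _ _ s sl) !mulr_suml; apply: eq_bigr => i _.
by rewrite -/(x i); ring.
Qed.

Lemma probability_history n l : sign_history n l ->
  P [set w | history n w = l] = (hexp m n (fun l' => (l' == l)%:R))%:E.
Proof.
move=> hl; have := @history_law n l fset0 (fun=> setT) hl.
by rewrite set_fset0 bigcap_set0 setIT big_seq_fset0 mule1; apply.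
Qed.

Lemma norm_first_mean_le1 : `|first_mean| <= 1.
Proof.
have m1 : measurable (X 1%N @^-1` [set 1]) by apply: measurable_funPTI; exact: measurable_set1.
have h0 : 0 <= fine (P (X 1%N @^-1` [set 1])) by exact: fine_ge0.
have h1 : fine (P (X 1%N @^-1` [set 1])) <= 1.
  by rewrite -lee_fin fineK ?fin_num_measure// probability_le1.
by rewrite /first_mean ler_norml; lra.
Qed.

End history_law.

Section sign_histories.
Variables (R : realType) (m : seq R -> R).
Hypothesis m_le1 : forall n l, sign_history n l -> `|m l| <= 1.

Fixpoint sign_histories n : seq (seq R) :=
  if n is n'.+1
  then map (cons 1) (sign_histories n') ++ map (cons (-1)) (sign_histories n')
  else [:: [::]].

Lemma mem_sign_histories n l : (l \in sign_histories n) = sign_history n l.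
Proof.
elim: n l => [|n IH] [|x l] //=.
  by rewrite mem_cat; apply/negP => /orP[] /mapP[].
rewrite sign_history_cons mem_cat -IH.
apply/orP/andP => [[] /mapP[l' hl' [-> ->]]|[/orP[] /eqP -> hl]].
- by rewrite eqxx.
- by rewrite eqxx orbT.
- by left; exact: map_f.
- by right; exact: map_f.
Qed.

Lemma uniq_sign_histories n : uniq (sign_histories n).
Proof.
elim: n => [//|n IH] /=; rewrite cat_uniq !map_inj_uniq// ?IH/= ?andbT; try by move=> ? ? [].
apply/hasPn => _ /mapP[l hl ->]; apply/negP => /mapP[l' _ [h _]].
by have : (-1 : R) <> 1 by lra.
Qed.

Lemma hexp_sum n (s : seq (seq R)) (F : seq R -> seq R -> R) :
  hexp m n (fun l => \sum_(i <- s) F i l) = \sum_(i <- s) hexp m n (F i).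
Proof.
elim: s => [|i s IH].
  rewrite big_nil -[RHS](hexp_cst m n); congr hexp.
  by apply/funext => l; rewrite big_nil.
rewrite big_cons -IH -hexpD; congr hexp; apply/funext => l; by rewrite big_cons.
Qed.

Lemma hexp_sign_histories n F : hexp m n F =
  \sum_(l <- sign_histories n) F l * hexp m n (fun l' => (l' == l)%:R).
Proof.
under eq_bigr do rewrite -hexpZ; rewrite -hexp_sum.
apply: (eq_hexp m_le1) => l hl.
rewrite (bigD1_seq l)/= ?uniq_sign_histories ?mem_sign_histories// eqxx mulr1.
rewrite big1 ?addr0// => l' ll'; by rewrite eq_sym (negbTE ll') mulr0.
Qed.

End sign_histories.

Section expectation_history.
Variables (d : measure_display) (T : measurableType d) (R : realType).
Variables (P : probability T R) (p lam : R) (D : nat -> set nat) (ret : pred nat).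
Variables (Y eps : nat -> {RV P >-> R}) (I : nat -> {RV P >-> nat}).
Variable X : nat -> {RV P >-> R}.
Hypotheses (hp : 0 <= p <= 1) (hlam : 0 <= lam <= 1).
Hypothesis hX : is_tmerw p lam D Y eps I X.
Hypothesis hret : forall n i, (1 <= i <= n)%N -> (D n i <-> ~~ ret i).

Let m := memory_drift ret p lam (first_mean X).

Let m_le1 n l : sign_history n l -> `|m l| <= 1.
Proof. exact: norm_memory_drift_le1 (norm_first_mean_le1 X). Qed.

Let hA n (l : seq R) := [set w | history X n w = l].

Let step n (F : seq R -> R) w := \sum_(l <- sign_histories R n) F l * \1_(hA n l) w.

Let stepE n F w :
  step n F w = if sign_history n (history X n w) then F (history X n w) else 0.
Proof.
rewrite /step -mem_sign_histories; case: ifPn => hw.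
  rewrite (bigD1_seq _ hw (uniq_sign_histories _ _))/= indicE mem_set// mulr1.
  rewrite big1 ?addr0// => l hl; rewrite indicE memNset ?mulr0//= => E.
  by rewrite -E eqxx in hl.
rewrite big_seq big1// => l hl; rewrite indicE memNset ?mulr0//= => E.
by rewrite E hl in hw.
Qed.

Let measurable_step n F : measurable_fun setT (step n F).
Proof.
apply: measurable_sum => l; apply: measurable_funM => //.
by apply: measurable_indic; exact: measurable_history.
Qed.

Let integral_step n F : (\int[P]_w (step n F w)%:E)%E = (hexp m n F)%:E.
Proof.
under eq_integral do rewrite -sumEFin.
have iA l : P.-integrable setT (EFin \o \1_(hA n l)).
  by apply: integrable_indic; exact: measurable_history.
have iFA l : P.-integrable setT (fun w => (F l * \1_(hA n l) w)%:E).
  by have := integrableZl measurableT (F l) (iA l); exact: eq_integrable.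
rewrite integral_sum//.
rewrite (hexp_sign_histories m_le1) -sumEFin.
apply: eq_big_seq => l; rewrite mem_sign_histories => hl.
under eq_integral do rewrite EFinM.
rewrite (integralZl measurableT (iA l)) /= integral_indic//; last exact: measurable_history.
rewrite setIT EFinM; congr (_ * _)%E; exact (probability_history hX hret hl).
Qed.

(** The masses that [hexp] gives to the sign histories add up to [hexp] of the constant 1. *)
Lemma ae_sign_history : {ae P, forall w n, sign_history n (history X n w)}.
Proof.
apply: ae_foralln => n.
pose A := [set w | sign_history n (history X n w)].
have AE : \1_A = step n (fun=> 1).
  apply/funext => w; rewrite stepE indicE; case: ifPn => h; first by rewrite mem_set.
  by rewrite memNset//; exact/negP.
have mA : measurable A.
  have := @measurable_step n (fun=> 1); rewrite -AE => mA.
  rewrite (_ : A = setT `&` \1_A @^-1` [set (1 : R)]).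
    by apply: mA => //; exact: measurable_set1.
  rewrite setTI; apply/seteqP; split => w /=; rewrite indicE.
    by move=> Aw; rewrite mem_set.
  case: (boolP (w \in A)) => [/set_mem//|_ /=] h.
  by exfalso; have : (0 : R) <> 1 by lra.
have PA : P A = 1%E.
  have := integral_indic P measurableT mA; rewrite setIT => <-.
  by rewrite AE integral_step hexp_cst.
have PA0 : P (~` A) = 0%E by rewrite probability_setC// PA subee.
exists (~` A); split; [exact: measurableC|exact: PA0|by move=> w].
Qed.

(** Off a null set the composite equals the simple function [step], whose integral is a finite sum.
    On the null set [F] is arbitrary, so measurability of the composite has to be assumed. *)
Theorem expectation_history n (F : seq R -> R) :
  measurable_fun setT (F \o history X n) ->
  ('E_P[F \o history X n] = (hexp m n F)%:E)%E.
Proof.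
move=> mF; rewrite unlock -integral_step; apply: ae_eq_integral => //.
- exact/measurable_EFinP.
- exact/measurable_EFinP.
apply: filterS ae_sign_history => w hw _ /=.
by rewrite stepE hw.
Qed.

End expectation_history.

(** * Asymptotics of power sums *)

Section power_increments.
Variable R : realType.
Implicit Types (x y r s : R).

(** The absolute value in the constant covers negative exponents as well. *)
Lemma powR_le_comparable x y r : 0 < x -> x <= y <= 2 * x ->
  y `^ r <= 2 `^ `|r| * x `^ r.
Proof.
move=> x0 /andP[xy y2].
have -> : y = (y / x) * x by field; rewrite gt_eqF.
have yx0 : 0 <= y / x by rewrite divr_ge0 ?(ltW x0)// (le_trans (ltW x0)).
have yx1 : 1 <= y / x by rewrite ler_pdivlMr// mul1r.
rewrite powRM ?(ltW x0)// ler_wpM2r ?powR_ge0//.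
apply: (@le_trans _ _ ((y / x) `^ `|r|)); first by rewrite ler_powR// ler_norm.
by apply: ge0_ler_powR; rewrite ?nnegrE// ler_pdivrMr.
Qed.

Lemma MVT_powR x y s : 0 < x -> x <= y ->
  exists2 c, x <= c <= y & y `^ s - x `^ s = s * c `^ (s - 1) * (y - x).
Proof.
move=> x0 xy.
have df z : z \in `]x, y[ -> is_derive z 1 (@powR R ^~ s) (s * z `^ (s - 1)).
  by rewrite in_itv/= => /andP[xz _]; apply: is_derive1_powR; exact: lt_trans xz.
have [|c] := MVT_segment xy df.
  apply: derivable_within_continuous => z; rewrite in_itv/= => /andP[xz _].
  by apply: derivable_powR; rewrite in_itv/= andbT; exact: lt_le_trans xz.
by rewrite in_itv/= => cxy E; exists c.
Qed.

Lemma powR_increment1 s : exists2 C, 0 <= C & forall x y, 1 <= x -> x <= y <= x + 1 ->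
  `|y `^ s - x `^ s| <= C * x `^ (s - 1).
Proof.
exists (`|s| * 2 `^ `|s - 1|); first by rewrite mulr_ge0// powR_ge0.
move=> x y x1 /andP[xy yx]; have x0 : 0 < x by lra.
have [c /andP[xc cy] ->] := MVT_powR s x0 xy.
have c2 : c `^ (s - 1) <= 2 `^ `|s - 1| * x `^ (s - 1).
  by apply: powR_le_comparable => //; lra.
rewrite !normrM (ger0_norm (powR_ge0 _ _)) -[leRHS]mulr1.
apply: ler_pM => //; first by rewrite mulr_ge0// powR_ge0.
  by rewrite -mulrA ler_wpM2l.
by rewrite ger0_norm; lra.
Qed.

Lemma powR_increment2 s : exists2 C, 0 <= C & forall x, 1 <= x ->
  `|(x + 1) `^ s - x `^ s - s * x `^ (s - 1)| <= C * x `^ (s - 2).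
Proof.
have [C C0 HC] := powR_increment1 (s - 1).
exists (`|s| * C); first by rewrite mulr_ge0.
move=> x x1; have x0 : 0 < x by lra.
have [|c /andP[xc cy] ->] := @MVT_powR x (x + 1) s x0; first lra.
have -> : s * c `^ (s - 1) * (x + 1 - x) - s * x `^ (s - 1) =
    s * (c `^ (s - 1) - x `^ (s - 1)) by ring.
rewrite normrM -mulrA ler_wpM2l// (_ : s - 2 = s - 1 - 1); last by ring.
by apply: HC => //; rewrite xc.
Qed.

Lemma powR_mul_self x s : 0 < x -> x `^ s = x * x `^ (s - 1).
Proof.
by move=> x0; rewrite -{2}(powRr1 (ltW x0)) -powRD ?(gt_eqF x0) ?implybT//; congr powR; ring.
Qed.

End power_increments.

Section stolz_cesaro.
Variable R : realType.
Implicit Types (a b : R^nat) (L s : R).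

Lemma cvg_near0 a b : a @ \oo --> (0 : R) ->
  (\forall n \near \oo, `|b n| <= a n) -> b @ \oo --> (0 : R).
Proof.
move=> a0 ab; apply: norm_cvg0; apply: (@squeeze_cvgr _ _ _ _ (cst 0) a) => //.
  by near=> n; rewrite normr_ge0/=; near: n.
exact: cvg_cst.
Unshelve. all: by end_near. Qed.

Lemma eq_cvg_seq a b (L : set_system R) : a =1 b -> a @ \oo --> L -> b @ \oo --> L.
Proof. by move=> /funext ->. Qed.

Lemma cvg_seqD a b (x y : R) : a @ \oo --> x -> b @ \oo --> y ->
  (fun n => a n + b n) @ \oo --> x + y.
Proof. exact: cvgD. Qed.

Lemma cvg_seqM a b (x y : R) : a @ \oo --> x -> b @ \oo --> y ->
  (fun n => a n * b n) @ \oo --> x * y.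
Proof. exact: cvgM. Qed.

Lemma cvg_seq_cst (c : R) : (fun=> c : R) @ \oo --> c.
Proof. exact: cvg_cst. Qed.

Lemma near_eq_cvg_seq a b (L : set_system R) :
  (\forall n \near \oo, a n = b n) -> a @ \oo --> L -> b @ \oo --> L.
Proof. by move=> ab aL; apply: cvg_trans aL; exact: near_eq_cvg. Qed.

Lemma stolz_cesaro a b L : (forall n, b n < b n.+1) -> b @ \oo --> +oo ->
  (a n.+1 - a n) / (b n.+1 - b n) @[n --> \oo] --> L ->
  a n / b n @[n --> \oo] --> L.
Proof.
move=> bS by_ abL; apply/cvgrPdist_le => e e0.
have e20 : 0 < e / 2 by rewrite divr_gt0.
have /cvgrPdist_le/(_ _ e20)[N _ HN] := abL.
pose c n := a n - L * b n.
have cS n : (N <= n)%N -> `|c n.+1 - c n| <= e / 2 * (b n.+1 - b n).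
  move=> /HN /=; have bn : 0 < b n.+1 - b n by rewrite subr_gt0.
  have -> : L - (a n.+1 - a n) / (b n.+1 - b n) = - (c n.+1 - c n) / (b n.+1 - b n).
    by rewrite /c; field; rewrite gt_eqF.
  by rewrite normrM normrN normfV (gtr0_norm bn) ler_pdivrMr.
have cN n : `|c (n + N)%N| <= `|c N| + e / 2 * (b (n + N)%N - b N).
  elim: n => [|n IH]; first by rewrite add0n subrr mulr0 addr0.
  have := cS (n + N)%N (leq_addl _ _).
  have := ler_normD (c (n + N).+1 - c (n + N)%N) (c (n + N)%N).
  by rewrite subrK addSn; lra.
near=> n.
have Nn : (N <= n)%N by near: n; exact: nbhs_infty_ge.
have bn0 : 0 < b n by near: n; exact: (cvgry_gt by_).
(* This makes the error inherited from rank [N] at most half of the allowed [e * b n]. *)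
have bK : (`|c N| + e / 2 * `|b N|) / (e / 2) <= b n by near: n; exact: (cvgry_ge by_).
have -> : L - a n / b n = - c n / b n by rewrite /c; field; rewrite gt_eqF.
rewrite normrM normrN normfV (gtr0_norm bn0) ler_pdivrMr//.
have := cN (n - N)%N; rewrite subnK// => h; apply: le_trans h _.
move: bK; rewrite ler_pdivrMr// => bK.
have : - b N <= `|b N| by rewrite -normrN ler_norm.
by nra.
Unshelve. all: by end_near. Qed.

Lemma cvg_of_shift a (L : set_system R) : a n.+1 @[n --> \oo] --> L -> a @ \oo --> L.
Proof. by move=> h; rewrite -(cvg_shiftS a); exact: h. Qed.

Lemma cvg_to_shift a (L : set_system R) : a @ \oo --> L -> a n.+1 @[n --> \oo] --> L.
Proof. by rewrite -(cvg_shiftS a) => h; exact: h. Qed.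

Lemma cvg_natr_powR_y s : 0 < s -> (n%:R : R) `^ s @[n --> \oo] --> +oo.
Proof.
move=> s0; apply/cvgryPge => A; near=> n.
have n0 : 0 < n%:R :> R by near: n; exact: nbhs_infty_gtr.
have nA : (Num.max 0 A) `^ s^-1 <= n%:R by near: n; exact: nbhs_infty_ger.
apply: (@le_trans _ _ (Num.max 0 A)); first by rewrite le_max lexx orbT.
have M0 : 0 <= Num.max 0 A by rewrite le_max lexx.
have -> : Num.max 0 A = (Num.max 0 A `^ s^-1) `^ s.
  by rewrite -powRrM mulVf ?gt_eqF// powRr1.
by apply: ge0_ler_powR; rewrite ?nnegrE ?powR_ge0 ?(ltW s0) ?(ltW n0).
Unshelve. all: by end_near. Qed.

Lemma cvg_natr_powR_0 s : s < 0 -> (n%:R : R) `^ s @[n --> \oo] --> (0 : R).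
Proof.
move=> s0; rewrite -[s]opprK; under eq_fun do rewrite powRN.
apply/gtr0_cvgV0; last by apply: cvg_natr_powR_y; rewrite oppr_gt0.
by near=> n; apply: powR_gt0; near: n; exact: nbhs_infty_gtr.
Unshelve. all: by end_near. Qed.

Lemma cvg_invS : (n.+1%:R^-1 : R) @[n --> \oo] --> (0 : R).
Proof. exact: cvg_harmonic. Qed.

Lemma cvg_powRS_ratio s : ((n.+2%:R : R) `^ s / n.+1%:R `^ s) @[n --> \oo] --> (1 : R).
Proof.
have [C C0 HC] := powR_increment1 s.
rewrite -[X in _ --> X](addr0 1).
have -> : (fun n => (n.+2%:R : R) `^ s / n.+1%:R `^ s) =
    (fun n => 1 + ((n.+2%:R : R) `^ s / n.+1%:R `^ s - 1)).
  by apply/funext => n; ring.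
apply: cvgD; first exact: cvg_cst.
apply: (@cvg_near0 (fun n => C * n.+1%:R^-1)).
  rewrite -(mulr0 C); apply: cvgM; [exact: cvg_cst|exact: cvg_invS].
apply: nearW => n; have n0 : 0 < n.+1%:R :> R by rewrite ltr0n.
have p0 : 0 < (n.+1%:R : R) `^ s by rewrite powR_gt0.
rewrite (_ : _ - 1 = ((n.+2%:R : R) `^ s - n.+1%:R `^ s) / n.+1%:R `^ s); last first.
  by field; rewrite gt_eqF.
rewrite normrM normfV (gtr0_norm p0) ler_pdivrMr//.
have := HC n.+1%:R n.+2%:R; rewrite -[n.+2%:R]natr1 => H.
apply: le_trans (H _ _) _; rewrite ?lerDl ?lexx ?andbT ?ler01//.
  by rewrite ler1n.
by rewrite [n.+1%:R `^ s in leRHS]powR_mul_self// -mulrA mulKf// gt_eqF.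
Qed.

Lemma cvg_powRS_increment s :
  ((n.+2%:R : R) `^ s - n.+1%:R `^ s) / n.+2%:R `^ (s - 1) @[n --> \oo] --> s.
Proof.
have [C C0 HC] := powR_increment2 s.
have h1 : ((n.+2%:R : R) `^ s - n.+1%:R `^ s) / n.+1%:R `^ (s - 1) @[n --> \oo] --> s.
  rewrite -[X in _ --> X](addr0 s).
  have -> : (fun n => ((n.+2%:R : R) `^ s - n.+1%:R `^ s) / n.+1%:R `^ (s - 1)) =
    (fun n => s + (((n.+2%:R : R) `^ s - n.+1%:R `^ s) / n.+1%:R `^ (s - 1) - s)).
    by apply/funext => n; ring.
  apply: cvgD; first exact: cvg_cst.
  apply: (@cvg_near0 (fun n => C * n.+1%:R^-1)).
    rewrite -(mulr0 C); apply: cvgM; [exact: cvg_cst|exact: cvg_invS].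
  apply: nearW => n; have n0 : 0 < n.+1%:R :> R by rewrite ltr0n.
  have p0 : 0 < (n.+1%:R : R) `^ (s - 1) by rewrite powR_gt0.
  rewrite (_ : _ - s = ((n.+2%:R : R) `^ s - n.+1%:R `^ s - s * n.+1%:R `^ (s - 1)) / n.+1%:R `^ (s - 1)); last first.
    by field; rewrite gt_eqF.
  rewrite normrM normfV (gtr0_norm p0) ler_pdivrMr//.
  have := HC n.+1%:R; rewrite ler1n/= natr1 => /(_ isT) H.
  apply: le_trans H _.
  rewrite [n.+1%:R `^ (s - 1) in leRHS]powR_mul_self// -mulrA mulKf ?gt_eqF//.
  by rewrite (_ : s - 1 - 1 = s - 2)//; ring.
have h2 := cvg_powRS_ratio (s - 1).
have :=  cvgM h1 (cvgV (oner_neq0 _) h2); rewrite invr1 mulr1.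
move=> /(_ _ _) H; apply: eq_cvg_seq H => n /=.
have p1 : (n.+1%:R : R) `^ (s - 1) != 0 by rewrite gt_eqF// powR_gt0.
have p2 : (n.+2%:R : R) `^ (s - 1) != 0 by rewrite gt_eqF// powR_gt0.
by rewrite ?fctE; field; rewrite p1 p2.
Qed.

Lemma power_sum_cvg a s L : 0 < s ->
  (a n.+1 - a n) / n.+1%:R `^ (s - 1) @[n --> \oo] --> L ->
  a n / n%:R `^ s @[n --> \oo] --> L / s.
Proof.
move=> s0 aL; apply: (@cvg_of_shift (fun n => a n / n%:R `^ s)).
apply: (@stolz_cesaro (fun n => a n.+1) (fun n => n.+1%:R `^ s)).
- by move=> n; apply: gt0_ltr_powR; rewrite ?nnegrE ?ler0n// ltr_nat.
- exact: cvg_to_shift (cvg_natr_powR_y s0).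
have h1 := @cvg_powRS_increment s.
have h2 : (a n.+2 - a n.+1) / n.+2%:R `^ (s - 1) @[n --> \oo] --> L.
  exact: cvg_to_shift aL.
have s1 : s != 0 by rewrite gt_eqF.
have :=  cvgM h2 (cvgV s1 h1).
move=> /(_ _ _) H; apply: eq_cvg_seq H => n /=.
have p2 : (n.+2%:R : R) `^ (s - 1) != 0 by rewrite gt_eqF// powR_gt0.
have p1 : (n.+2%:R : R) `^ s - n.+1%:R `^ s != 0.
  by rewrite subr_eq0 gt_eqF//; apply: gt0_ltr_powR; rewrite ?nnegrE ?ler0n// ltr_nat.
by rewrite ?fctE; field; rewrite p1 p2.
Qed.

Lemma power_sum_small (x : R^nat) s : 0 < s ->
  x n / n.+1%:R `^ (s - 1) @[n --> \oo] --> (0 : R) ->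
  (\sum_(i < n) x i) / n%:R `^ s @[n --> \oo] --> (0 : R).
Proof.
move=> s0 h; rewrite -[X in _ --> X](mul0r s^-1).
apply: (@power_sum_cvg (fun n => \sum_(i < n) x i)) => //.
by under eq_fun do rewrite big_ord_recr/= addrAC subrr add0r.
Qed.

Lemma powR_ratio (x t r : R) : 0 < x -> x `^ t / x `^ r = x `^ (t - r).
Proof. by move=> x0; rewrite powRB// (gt_eqF x0) implybT. Qed.

Lemma cvg_powR_ratio t r : t < r ->
  (n.+1%:R : R) `^ t / n.+1%:R `^ r @[n --> \oo] --> (0 : R).
Proof.
move=> tr; have h : t - r < 0 by rewrite subr_lt0.
apply: eq_cvg_seq (cvg_to_shift (cvg_natr_powR_0 h)) => n.
by rewrite powR_ratio// ltr0n.
Qed.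

Lemma power_sum_powR_small t s : 0 < s -> t < s - 1 ->
  (\sum_(i < n) (i.+1%:R : R) `^ t) / n%:R `^ s @[n --> \oo] --> (0 : R).
Proof.
move=> s0 ts; apply: (@power_sum_small (fun i => i.+1%:R `^ t)) => //.
exact: cvg_powR_ratio.
Qed.

(** Both bounds are the inequality [ln (1 + x) <= x], at [- 1 / (n + 2)] for the lower and at
    [1 / (n + 1)] for the upper one. *)
Lemma ln_increment n :
  1 <= (n.+2%:R : R) * (ln n.+2%:R - ln n.+1%:R) <= 1 + n.+1%:R^-1.
Proof.
have n1 : 0 < n.+1%:R :> R by rewrite ltr0n.
have n2 : 0 < n.+2%:R :> R by rewrite ltr0n.
have E : n.+2%:R = n.+1%:R + 1 :> R by rewrite natr1.
rewrite -ln_div ?posrE//; apply/andP; split.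
  have := @le_ln1Dx R (n.+1%:R / n.+2%:R - 1).
  have -> : 1 + (n.+1%:R / n.+2%:R - 1) = (n.+2%:R / n.+1%:R : R)^-1.
    by rewrite invf_div; ring.
  rewrite lnV ?posrE ?divr_gt0// => /(_ _)/wrap[|h].
    by rewrite ltrBrDl subrr divr_gt0.
  have : 1 - n.+1%:R / n.+2%:R <= ln (n.+2%:R / n.+1%:R : R).
    by rewrite -lerN2 opprB.
  move/(ler_wpM2l (ltW n2)); apply: le_trans.
  have -> : n.+2%:R * (1 - n.+1%:R / n.+2%:R) = 1 :> R.
    by rewrite mulrBr mulrCA divff ?gt_eqF// E; ring.
  by [].
have := @le_ln1Dx R n.+1%:R^-1.
have -> : 1 + n.+1%:R^-1 = n.+2%:R / n.+1%:R :> R by rewrite E; field; rewrite gt_eqF.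
move=> /(_ _)/wrap[|h]; first by rewrite (lt_trans (ltrN10 _))// invr_gt0.
by rewrite ler_wpM2l// ltW.
Qed.

Lemma cvg_ln_nat_y : ln (n%:R : R) @[n --> \oo] --> +oo.
Proof.
apply/cvgryPge => A; near=> n.
have h : expR A <= n%:R by near: n; exact: nbhs_infty_ger.
by rewrite -[leLHS]expRK ler_ln ?posrE ?expR_gt0// (lt_le_trans (expR_gt0 A)).
Unshelve. all: by end_near. Qed.

Lemma log_sum_cvg a L : (a n.+1 - a n) * n.+1%:R @[n --> \oo] --> L ->
  a n / ln n%:R @[n --> \oo] --> L.
Proof.
(* The shift matters: [ln 0] and [ln 1] are both 0, so the logarithm is strictly increasing along
   the integers only from 1 on. *)
move=> aL; apply: (@cvg_of_shift (fun n => a n / ln n%:R)).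
apply: (@stolz_cesaro (fun n => a n.+1) (fun n => ln n.+1%:R)).
- by move=> n; rewrite ltr_ln ?posrE ?ltr0n// ltr_nat.
- exact: cvg_to_shift cvg_ln_nat_y.
have h1 : n.+2%:R * (ln n.+2%:R - ln n.+1%:R) @[n --> \oo] --> (1 : R).
  apply: (@squeeze_cvgr _ _ _ _ (cst 1) (fun n => 1 + n.+1%:R^-1)).
  - by apply: nearW => n; exact: ln_increment.
  - exact: cvg_cst.
  - rewrite -[X in _ --> X]addr0; apply: cvgD; [exact: cvg_cst|exact: cvg_invS].
have h2 : (a n.+2 - a n.+1) * n.+2%:R @[n --> \oo] --> L.
  exact: cvg_to_shift aL.
have :=  cvgM h2 (cvgV (oner_neq0 _) h1); rewrite invr1 mulr1.
move=> /(_ _ _) H; apply: eq_cvg_seq H => n /=.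
have p2 : (n.+2%:R : R) != 0 by rewrite pnatr_eq0.
have p1 : ln (n.+2%:R : R) - ln n.+1%:R != 0.
  by rewrite subr_eq0 gt_eqF// ltr_ln ?posrE ?ltr0n// ltr_nat.
rewrite ?fctE; move: p2 p1; set z := ln _ - ln _; set x := n.+2%:R => x0 z0.
by field; rewrite z0 -(natrD _ 2) pnatr_eq0.
Qed.

Lemma sum_powR_bounded s : 0 < s ->
  exists C, forall n, \sum_(i < n) (i.+1%:R : R) `^ (- s - 1) <= C.
Proof.
move=> s0; exists (1 + s^-1) => n.
(* The bound is the integral of [x ^ (- s - 1)] from 1 to [k + 1], proved by comparing one increment
   at a time through the mean value theorem. *)
have H k : \sum_(i < k.+1) (i.+1%:R : R) `^ (- s - 1) <= 1 + s^-1 * (1 - k.+1%:R `^ (- s)).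
  elim: k => [|k IH]; first by rewrite big_ord1 !powR1; lra.
  rewrite big_ord_recr/=.
  have k0 : 0 < k.+1%:R :> R by rewrite ltr0n.
  have k1 : k.+1%:R <= k.+2%:R :> R by rewrite ler_nat.
  have [c /andP[c1 c2]] := MVT_powR (- s) k0 k1.
  have -> : k.+2%:R - k.+1%:R = 1 :> R by rewrite -[k.+2%:R]natr1; ring.
  rewrite mulr1 => E.
  have cc : k.+2%:R `^ (- s - 1) <= c `^ (- s - 1).
    have c0 : 0 < c by apply: lt_le_trans c1.
    rewrite (_ : - s - 1 = - (s + 1)); last by ring.
    rewrite !powRN lef_pV2 ?posrE ?powR_gt0//.
    by apply: ge0_ler_powR; rewrite ?nnegrE ?(ltW c0)//; lra.
  have -> : k.+2%:R `^ (- s) = k.+1%:R `^ (- s) - s * c `^ (- s - 1).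
    by rewrite -mulNr -E; ring.
  have -> : 1 + s^-1 * (1 - (k.+1%:R `^ (- s) - s * c `^ (- s - 1))) =
    1 + s^-1 * (1 - k.+1%:R `^ (- s)) + c `^ (- s - 1) by field; rewrite gt_eqF.
  exact: lerD.
apply: (@le_trans _ _ (\sum_(i < n.+1) (i.+1%:R : R) `^ (- s - 1))).
  by rewrite big_ord_recr/= lerDl powR_ge0.
by apply: le_trans (H n) _; rewrite lerD2l -[leRHS]mulr1 ler_wpM2l ?invr_ge0 ?(ltW s0)//.
Qed.

End stolz_cesaro.

(** * Pathwise decomposition *)

Section pathwise.
Variables (R : realType) (ret : pred nat) (p lam q kap K : R).
Hypotheses (hp : 0 <= p <= 1) (hlam : 0 <= lam <= 1) (hq : `|q| <= 1).
Hypotheses (kap0 : 0 < kap) (kap1 : kap < 1).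
Implicit Types (l : seq R).

(** All later estimates see the shape of the memory only through a bound [K] on this discrepancy. *)
Definition retained_excess n : R := retained_count R ret n - kap * n%:R.
Hypothesis hK : forall n, `|retained_excess n| <= K.

Local Notation a := (2 * p - 1).
Local Notation b := (2 * lam - 1).
Local Notation g := (a * kap).
Local Notation m := (memory_drift ret p lam q).
Local Notation del := retained_excess.
Local Notation r i := ((ret i)%:R : R).

Definition limit_mean : R := b * (1 - kap) / (1 - g).
Local Notation s := limit_mean.

Let a1 : `|a| <= 1. Proof. by rewrite ler_norml; move: hp hlam; lra. Qed.
Let b1 : `|b| <= 1. Proof. by rewrite ler_norml; move: hp hlam; lra. Qed.
Let g1 : `|g| < 1.
Proof.
rewrite normrM (gtr0_norm kap0); apply: le_lt_trans kap1.
by rewrite -[leRHS]mul1r ler_wpM2r// ltW.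
Qed.
Let g_lt1 : 0 < 1 - g.
Proof. by rewrite subr_gt0; apply: le_lt_trans g1; exact: ler_norm. Qed.
Let K0 : 0 <= K. Proof. exact: le_trans (hK 0). Qed.

Lemma limit_meanE : (1 - g) * s = b * (1 - kap).
Proof. by rewrite /limit_mean; field; rewrite gt_eqF. Qed.

Lemma norm_limit_mean_le1 : `|s| <= 1.
Proof.
have k1 : 0 < 1 - kap by rewrite subr_gt0.
rewrite /limit_mean !normrM normfV (gtr0_norm g_lt1) ler_pdivrMr// mul1r (gtr0_norm k1).
apply: (@le_trans _ _ (1 - kap)); first by rewrite -[leRHS]mul1r ler_wpM2r// ltW.
have : a <= 1 by move: hp; lra.
by move: kap0; nra.
Qed.

Let m_le1 n l : sign_history n l -> `|m l| <= 1.
Proof. exact: norm_memory_drift_le1. Qed.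

Let retained_sum_cons x l :
  retained_sum ret (x :: l) = retained_sum ret l + r (size l).+1 * x.
Proof. by []. Qed.

Let memory_driftE n l : size l = n.+1 -> m l =
  a * (retained_sum ret l / n.+1%:R) + b * ((n.+1%:R - retained_count R ret n.+1) / n.+1%:R).
Proof. by case: l => // x l sz; rewrite /memory_drift sz. Qed.

Definition centered_retained l := retained_sum ret l - s * retained_count R ret (size l).
Local Notation w := centered_retained.

Let delS n : del n.+1 = del n + (r n.+1 - kap).
Proof. by rewrite /retained_excess retained_countS -natr1; ring. Qed.

Let r01 i : 0 <= r i <= 1.
Proof. by case: (ret i) => /=; lra. Qed.

Lemma norm_centered_retained_le n l : sign_history n l -> `|w l| <= 2 * n%:R.
Proof.
move=> hl; have sz : size l = n by move: hl => /andP[/eqP].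
have h1 := norm_retained_sum_le ret hl; have /andP[c0 c1] := retained_count_bounds R ret n.
rewrite /w sz; apply: le_trans (ler_normB _ _) _; rewrite normrM (ger0_norm c0).
have := ler_wpM2r c0 norm_limit_mean_le1; lra.
Qed.

(* [limit_mean] is the fixed point of the mean drift, which is what removes the
   constant term here. *)
Lemma memory_drift_centered n l : sign_history n.+1 l ->
  m l - s = a * (w l / n.+1%:R) + (a * s - b) * (del n.+1 / n.+1%:R).
Proof.
move=> hl; have sz : size l = n.+1 by move: hl => /andP[/eqP].
have n0 : n.+1%:R != 0 :> R by rewrite pnatr_eq0.
rewrite (memory_driftE sz) /centered_retained sz /retained_excess.
set W := retained_sum _ _; set C := retained_count _ _ _.
have E := limit_meanE.
have -> : a * (W / n.+1%:R) + b * ((n.+1%:R - C) / n.+1%:R) - s =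
  a * ((W - s * C) / n.+1%:R) + (a * s - b) * ((C - kap * n.+1%:R) / n.+1%:R)
  - ((1 - g) * s - b * (1 - kap)) by field.
by rewrite E subrr subr0.
Qed.

Lemma memory_drift_increment n x l : sign_history n.+1 (x :: l) ->
  `|m (x :: l) - m l| <= 4 / n.+1%:R.
Proof.
move=> hxl; have := hxl; rewrite sign_history_cons => /andP[hx hl].
case: n hxl hl => [|n] hxl hl.
  rewrite divr1; apply: le_trans (ler_normB _ _) _.
  by have := m_le1 hxl; have := m_le1 hl; lra.
have sz : size l = n.+1 by move: hl => /andP[/eqP].
have n0 : 0 < n.+1%:R :> R by rewrite ltr0n.
have n1 : 0 < n.+2%:R :> R by rewrite ltr0n.
have E2 : n.+2%:R = n.+1%:R + 1 :> R by rewrite natr1.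
have hW := norm_retained_sum_le ret hl; have /andP[c0 c1] := retained_count_bounds R ret n.+1.
rewrite (@memory_driftE n.+1 (x :: l)) ?[size _]/= ?sz// (memory_driftE sz).
rewrite retained_sum_cons retained_countS sz.
set W := retained_sum _ l in hW *; set C := retained_count _ _ _ in c0 c1 hW *.
have rr := r01 n.+2.
have hr : `|r n.+2 * x| <= 1.
  rewrite normrM ger0_norm; last by case/andP: rr.
  by case/orP: hx => /eqP ->; rewrite ?normrN normr1 mulr1; case/andP: rr.
have -> : a * ((W + r n.+2 * x) / n.+2%:R) + b * ((n.+2%:R - (C + r n.+2)) / n.+2%:R) -
    (a * (W / n.+1%:R) + b * ((n.+1%:R - C) / n.+1%:R)) =
  (a * (r n.+2 * x) - a * (W / n.+1%:R) + (b * (C / n.+1%:R) - b * r n.+2)) / n.+2%:R.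
  rewrite E2; move: (n.+1%:R : R) n0 => N N0.
  by field; rewrite !gt_eqF//; lra.
rewrite normrM normfV (gtr0_norm n1) ler_pdivrMr// divfK ?gt_eqF//.
have WN : `|W / n.+1%:R| <= 1.
  rewrite normrM normfV (gtr0_norm n0) ler_pdivrMr// mul1r; exact: le_trans hW _.
have CN : `|C / n.+1%:R| <= 1.
  by rewrite normrM normfV (gtr0_norm n0) ler_pdivrMr// mul1r ger0_norm.
have rN : `|r n.+2| <= 1 by rewrite ger0_norm; case/andP: rr.
have tri (c d : R) : `|c| <= 1 -> `|d| <= 1 -> `|c * d| <= 1.
  by move=> hc hd; rewrite normrM -[leRHS]mulr1 ler_pM.
apply: le_trans (ler_normD _ _) _.
apply: le_trans (lerD (ler_normB _ _) (ler_normB _ _)) _.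
have := tri _ _ a1 hr; have := tri _ _ a1 WN; have := tri _ _ b1 CN.
by have := tri _ _ b1 rN; lra.
Qed.

(* The last term plays the same role as the correction in [scaled_retained]: by summation
   by parts it cancels the predictable part of the increments. *)
Definition walk_part l := \sum_(x <- l) x - retained_sum ret l / kap + del (size l) * m l / kap.
Local Notation z := walk_part.

Lemma walk_part_step n x l : sign_history n.+1 (x :: l) ->
  `|z (x :: l) - z l - (1 - r n.+1 / kap) * (x - m l)| <= 4 * K / kap * n.+1%:R^-1.
Proof.
move=> hxl; have := hxl; rewrite sign_history_cons => /andP[hx hl].
have sz : size l = n by move: hl => /andP[/eqP].
(* The increment of [del * m] contains [(r - kap) * m], which is exactly the predictable part to be
   removed; only [del] times a change of drift, of order [1 / n], is left. *)
have -> : z (x :: l) - z l - (1 - r n.+1 / kap) * (x - m l) =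
    del n.+1 / kap * (m (x :: l) - m l).
  rewrite /z big_cons [size (x :: l)]/= retained_sum_cons sz delS.
  by field; rewrite gt_eqF.
rewrite !normrM normfV (gtr0_norm kap0).
have h := memory_drift_increment hxl.
rewrite (_ : 4 * K / kap * _ = K / kap * (4 / n.+1%:R)); last first.
  by rewrite mulrA [K / kap * 4]mulrC !mulrA.
by apply: ler_pM => //; [rewrite divr_ge0// ltW|rewrite ler_wpM2r// invr_ge0 ltW].
Qed.

(* The factor [1 - a del_n / n] absorbs the discrepancy [del] of the memory, so that the
   increments are those of a martingale up to an error of order [n^(-g-1)]. *)
Definition scaled_retained l :=
  w l * ((size l)%:R `^ (- g) * (1 - a * (del (size l) / (size l)%:R))).
Local Notation u := scaled_retained.

(** The predictable part of an increment of [w] is [r * a * w / n] up to order [1 / n]. Write [r] as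
    [kap + (r - kap)]: the decay of [n ^ (- g)] offsets the term with [kap], and the change of
    [- a * del / n], where [del] grows by [r - kap], offsets the other. *)
Lemma scaled_retained_step : exists2 C, 0 <= C & forall n x l, sign_history n.+1 (x :: l) ->
  `|u (x :: l) - u l - r n.+1 * n.+1%:R `^ (- g) * (x - m l)| <= C * n.+1%:R `^ (- g - 1).
Proof.
have [C1 C10 HC1] := powR_increment2 (- g).
have [C2 C20 HC2] := powR_increment1 (- g - 1).
pose B := 1 + C1 + K * (1 + C2).
have B0 : 0 <= B by rewrite /B !addr_ge0// mulr_ge0// addr_ge0.
pose C := 2 * (K * (1 + C2)) + 2 * B + 2 * (K * (1 + B)) + 2 * (C1 + K * C2).
pose C' := 2 * (1 + K) + 2.
have C0 : 0 <= C.
  by rewrite /C !addr_ge0// !mulr_ge0// ?addr_ge0// mulr_ge0// addr_ge0.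
have C'0 : 0 <= C' by rewrite /C'; move: K0; lra.
exists (C * 2 `^ `|g + 1| + C'); first by rewrite addr_ge0// mulr_ge0// powR_ge0.
move=> n x l hxl; have := hxl; rewrite sign_history_cons => /andP[hx hl].
have sz : size l = n by move: hl => /andP[/eqP].
have x1 : `|x| <= 1 by case/orP: hx => /eqP ->; rewrite ?normrN normr1.
have D2 : `|x - m l| <= 2.
  by apply: le_trans (ler_normB _ _) _; have := m_le1 hl; lra.
have rr := r01 n.+1; have hw := norm_centered_retained_le hl.
have hwx := norm_centered_retained_le hxl.
have rN : `|r n.+1| <= 1 by rewrite ger0_norm; case/andP: rr.
case: n => [|n] in hxl hl sz rr rN hw hwx *.
  have -> : u l = 0 by case: l sz {hxl hl D2 hw hwx} => // _; rewrite /u /w /= /retained_count big_nil mulr0 subrr mul0r.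
  rewrite /u [size (x :: l)]/= sz !powR1 divr1 subr0 mul1r mulr1 mulr1.
  apply: (@le_trans _ _ C'); last by rewrite lerDr mulr_ge0// powR_ge0.
  apply: le_trans (ler_normB _ _) _; rewrite /C' !normrM; apply: lerD.
    rewrite mulr1 in hwx; apply: ler_pM => //.
    apply: le_trans (ler_normB _ _) _; rewrite normr1 lerD2l normrM.
    by rewrite -[leRHS]mul1r ler_pM.
  by rewrite -[leRHS]mul1r ler_pM.
set N := n.+1%:R in hw; have N1 : 1 <= N by rewrite /N ler1n.
have N0 : 0 < N by lra.
have EN : n.+2%:R = N + 1 :> R by rewrite natr1.
pose P := N `^ (- g - 1).
have P0 : 0 < P by rewrite powR_gt0.
have PN : N `^ (- g) = P * N by rewrite powR_mul_self// mulrC.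
have PV : N `^ (- g - 2) = P / N.
  by rewrite /P [N `^ (- g - 1)]powR_mul_self// (_ : - g - 1 - 1 = - g - 2); [field; rewrite gt_eqF|ring].
(* [e1] and [e2] are the Taylor remainders of the two powers of [N + 1], scaled to be bounded. They
   turn the increment into a rational expression in [N] times the common factor [P]. *)
pose e1 := ((N + 1) `^ (- g) - P * N + g * P) * N / P.
have E1 : (N + 1) `^ (- g) = P * (N - g + e1 / N).
  by rewrite /e1; field; rewrite !gt_eqF.
have he1 : `|e1| <= C1.
  have := HC1 N N1; rewrite PN PV -/P => h.
  rewrite /e1 !normrM normfV (gtr0_norm P0) (gtr0_norm N0) ler_pdivrMr// -ler_pdivlMr//.
  by rewrite -[C1 * P / N]mulrA; move: h; rewrite mulNr opprK.
pose e2 := ((N + 1) `^ (- g - 1) - P) * N / P.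
have E2 : (N + 1) `^ (- g - 1) = P * (1 + e2 / N).
  by rewrite /e2; field; rewrite !gt_eqF.
have he2 : `|e2| <= C2.
  have := HC2 N (N + 1) N1; rewrite lexx andbT lerDl ler01 => /(_ isT).
  rewrite (_ : - g - 1 - 1 = - g - 2); last by ring.
  rewrite PV -/P => h.
  rewrite /e2 !normrM normfV (gtr0_norm P0) (gtr0_norm N0) ler_pdivrMr// -ler_pdivlMr//.
  by rewrite -[C2 * P / N]mulrA.
have N10 : 0 < N + 1 by lra.
have E3 : (N + 1) `^ (- g) = (N + 1) * (N + 1) `^ (- g - 1) by rewrite -powR_mul_self.
have hm := memory_drift_centered hl.
pose om := w l / N.
have wE : w l = om * N by rewrite /om divfK ?gt_eqF.
have hom : `|om| <= 2 by rewrite /om normrM normfV (gtr0_norm N0) ler_pdivrMr.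
have wx : w (x :: l) = w l + r n.+2 * (x - s).
  by rewrite /w [size (x :: l)]/= retained_sum_cons sz retained_countS; ring.
pose D := x - m l.
have xE : x - s = D + (a * om + (a * s - b) * (del n.+1 / N)) by rewrite /D -hm; ring.
pose BB := - g + e1 / N - a * del n.+2 * (1 + e2 / N).
have key : u (x :: l) - u l - r n.+2 * n.+2%:R `^ (- g) * (x - m l) =
  P * (- (r n.+2 * D * (a * (del n.+2 * (1 + e2 / N)))) + r n.+2 * a * om * BB +
       r n.+2 * (a * s - b) * (del n.+1 * (1 + BB / N)) + om * (e1 - a * (del n.+2 * e2))).
  rewrite /u [size (x :: l)]/= sz wx xE -/D -/N EN PN.
  have -> : (N + 1) `^ (- g) * (1 - a * (del n.+2 / (N + 1))) =
     P * (N - g + e1 / N) - a * del n.+2 * (P * (1 + e2 / N)).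
    by rewrite -E1 -E2 {1 2}E3; field; rewrite gt_eqF.
  rewrite E1 wE /BB !(delS n.+1).
  by move: (del n.+1) (r n.+2) => dn rn; field; rewrite gt_eqF.
rewrite key normrM (gtr0_norm P0).
have iN : `|N^-1| <= 1 by rewrite normfV (gtr0_norm N0) invf_le1.
have hd i := hK i.
have tri (c d Cc Cd : R) : `|c| <= Cc -> `|d| <= Cd -> `|c * d| <= Cc * Cd.
  by move=> hc hdd; rewrite normrM ler_pM.
have h2 : `|1 + e2 / N| <= 1 + C2.
  by apply: le_trans (ler_normD _ _) _; rewrite normr1 lerD2l; have := tri _ _ _ _ he2 iN; rewrite mulr1.
have hBB : `|BB| <= B.
  rewrite /BB /B; apply: le_trans (ler_normB _ _) _; apply: lerD.
    apply: le_trans (ler_normD _ _) _; apply: lerD; first by rewrite normrN ltW.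
    by have := tri _ _ _ _ he1 iN; rewrite mulr1.
  by have := tri _ _ _ _ (tri _ _ _ _ a1 (hd n.+2)) h2; rewrite mul1r.
have hBN : `|1 + BB / N| <= 1 + B.
  by apply: le_trans (ler_normD _ _) _; rewrite normr1 lerD2l; have := tri _ _ _ _ hBB iN; rewrite mulr1.
have has : `|a * s - b| <= 2.
  apply: le_trans (ler_normB _ _) _.
  by have := tri _ _ _ _ a1 norm_limit_mean_le1; have := b1; lra.
have main : `|- (r n.+2 * D * (a * (del n.+2 * (1 + e2 / N)))) + r n.+2 * a * om * BB +
       r n.+2 * (a * s - b) * (del n.+1 * (1 + BB / N)) + om * (e1 - a * (del n.+2 * e2))| <= C.
  rewrite /C; apply: le_trans (ler_normD _ _) _; apply: lerD; last first.
    apply: (tri _ _ _ _ _ _) => //; apply: le_trans (ler_normB _ _) _; apply: lerD => //.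
    by have := tri _ _ _ _ a1 (tri _ _ _ _ (hd n.+2) he2); rewrite mul1r.
  apply: le_trans (ler_normD _ _) _; apply: lerD; last first.
    by have := tri _ _ _ _ (tri _ _ _ _ rN has) (tri _ _ _ _ (hd n.+1) hBN); rewrite !mul1r.
  apply: le_trans (ler_normD _ _) _; apply: lerD; last first.
    by have := tri _ _ _ _ (tri _ _ _ _ (tri _ _ _ _ rN a1) hom) hBB; rewrite !mul1r.
  rewrite normrN; have := tri _ _ _ _ (tri _ _ _ _ rN D2) (tri _ _ _ _ a1 (tri _ _ _ _ (hd n.+2) h2)).
  by rewrite !mul1r.
(* The estimates are in powers of [n + 1], the claim in powers of [n + 2]. *)
have PP : P <= 2 `^ `|g + 1| * n.+2%:R `^ (- g - 1).
  rewrite EN /P -opprD !powRN -ler_pdivrMr ?invr_gt0 ?powR_gt0// invrK mulrC.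
  by rewrite ler_pdivrMr ?powR_gt0// powR_le_comparable//; lra.
apply: (@le_trans _ _ (P * C)); first by rewrite ler_wpM2l// ltW.
rewrite mulrDl mulrC -[leLHS]addr0; apply: lerD; last by rewrite mulr_ge0// powR_ge0.
by rewrite -mulrA ler_wpM2l.
Qed.

End pathwise.

Section transform_linear.
Variables (R : realType) (m : seq R -> R).

Lemma transform_lin (H G : seq R -> R) (c : R) l :
  transform m (fun l => H l + c * G l) l = transform m H l + c * transform m G l.
Proof. by elim: l => [|x l /= ->]; [rewrite /= mulr0 addr0|ring]. Qed.

Lemma transform_approx (F H : seq R -> R) (c : nat -> R) :
  F [::] = 0 ->
  (forall n x l, sign_history n.+1 (x :: l) ->
    `|F (x :: l) - F l - H l * (x - m l)| <= c n) ->
  forall n l, sign_history n l -> `|F l - transform m H l| <= \sum_(i < n) c i.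
Proof.
move=> F0 Fc; elim=> [|n IH] [|x l] // hl; first by rewrite big_ord0 F0 subr0 normr0.
rewrite big_ord_recr/=.
have hl' : sign_history n l by move: hl; rewrite sign_history_cons => /andP[].
rewrite (_ : _ - _ = (F l - transform m H l) + (F (x :: l) - F l - H l * (x - m l))); last by ring.
by apply: le_trans (ler_normD _ _) _; apply: lerD; [exact: IH|exact: Fc].
Qed.

End transform_linear.

Section periodic_sums.
Variables (R : realType) (ret : pred nat) (kap K : R).
Hypothesis hK : forall n, `|retained_excess ret kap n| <= K.
Local Notation del := (retained_excess ret kap).
Local Notation r i := ((ret i)%:R : R).

Let K0 : 0 <= K. Proof. exact: le_trans (hK 0). Qed.

(* Summation by parts against the bounded discrepancy [retained_excess]. *)
Lemma retained_power_increment t : exists2 C, 0 <= C & forall n,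
  `|(\sum_(i < n.+1) r i.+1 * i.+1%:R `^ t - del n.+1 * n.+2%:R `^ t) -
    (\sum_(i < n) r i.+1 * i.+1%:R `^ t - del n * n.+1%:R `^ t) -
    kap * n.+1%:R `^ t| <= C * n.+1%:R `^ (t - 1).
Proof.
have [C C0 HC] := powR_increment1 t.
exists (K * C); first by rewrite mulr_ge0.
move=> n; rewrite big_ord_recr/=; set S := \sum_(i < n) _.
have dS : del n.+1 = del n + (r n.+1 - kap).
  by rewrite /retained_excess retained_countS -natr1; ring.
rewrite (_ : _ - _ - _ = - (del n.+1 * (n.+2%:R `^ t - n.+1%:R `^ t))); last first.
  by rewrite dS; ring.
rewrite normrN normrM -mulrA; apply: ler_pM => //.
have := HC n.+1%:R n.+2%:R; rewrite ler1n -[n.+2%:R]natr1 lerDl ler01 lexx; exact.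
Qed.

Lemma retained_power_sum t : -1 < t ->
  (\sum_(i < n) r i.+1 * i.+1%:R `^ t) / n%:R `^ (t + 1) @[n --> \oo] --> kap / (t + 1).
Proof.
move=> t1; have s0 : 0 < t + 1 by lra.
have [C C0 HC] := retained_power_increment t.
pose A n := \sum_(i < n) r i.+1 * i.+1%:R `^ t - del n * n.+1%:R `^ t.
have hA : A n / n%:R `^ (t + 1) @[n --> \oo] --> kap / (t + 1).
  apply: power_sum_cvg => //; rewrite addrK -[X in _ --> X]addr0.
  have -> : (fun n => (A n.+1 - A n) / n.+1%:R `^ t) =
      (fun n => kap + (A n.+1 - A n - kap * n.+1%:R `^ t) / n.+1%:R `^ t).
    apply/funext => n; field; rewrite ?nat1r gt_eqF// powR_gt0//.
  apply: cvgD; first exact: cvg_cst.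
  apply: (@cvg_near0 _ (fun n => C * n.+1%:R^-1)).
    rewrite -(mulr0 C); apply: cvgM; [exact: cvg_cst|exact: cvg_invS].
  apply: nearW => n; have n0 : 0 < n.+1%:R :> R by rewrite ltr0n.
  have p0 : 0 < (n.+1%:R : R) `^ t by rewrite powR_gt0.
  rewrite normrM normfV (gtr0_norm p0) ler_pdivrMr//.
  apply: le_trans (HC n) _.
  by rewrite [n.+1%:R `^ t in leRHS]powR_mul_self// -mulrA mulKf// gt_eqF.
have hB : del n * n.+1%:R `^ t / n%:R `^ (t + 1) @[n --> \oo] --> (0 : R).
  apply: (@cvg_of_shift _ (fun n => del n * n.+1%:R `^ t / n%:R `^ (t + 1))).
  apply: (@cvg_near0 _ (fun n => K * ((n.+2%:R `^ t / n.+1%:R `^ t) * n.+1%:R^-1))).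
    rewrite -(mulr0 K) -[X in _ * X](mul1r 0); apply: cvgM; first exact: cvg_cst.
    by apply: cvgM; [exact: cvg_powRS_ratio|exact: cvg_invS].
  apply: nearW => n; have n0 : 0 < n.+1%:R :> R by rewrite ltr0n.
  rewrite normrM normrM -mulrA; apply: ler_pM => //.
  rewrite ger0_norm ?powR_ge0// ger0_norm ?invr_ge0 ?powR_ge0//.
  rewrite (@powR_mul_self _ _ (t + 1))// addrK invfM [_^-1 * _]mulrC mulrA.
  by [].
have := cvgD hA hB; rewrite addr0 => /(_ _ _) H; apply: eq_cvg_seq H => n.
by rewrite ?fctE /A -mulrDl subrK.
Qed.

Lemma retained_log_sum :
  (\sum_(i < n) r i.+1 * i.+1%:R^-1) / ln n%:R @[n --> \oo] --> kap.
Proof.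
have [C C0 HC] := retained_power_increment (-1).
pose A n := \sum_(i < n) r i.+1 * i.+1%:R `^ (-1) - del n * n.+1%:R `^ (-1).
have hA : A n / ln n%:R @[n --> \oo] --> kap.
  apply: log_sum_cvg; rewrite -[X in _ --> X]addr0.
  have -> : (fun n => (A n.+1 - A n) * n.+1%:R) =
      (fun n => kap + (A n.+1 - A n - kap * n.+1%:R `^ (-1)) * n.+1%:R).
    apply/funext => n; rewrite [n.+1%:R `^ (-1)]powR_inv1//.
    by rewrite [in RHS]mulrBl divfK ?pnatr_eq0// addrCA subrr addr0.
  apply: cvgD; first exact: cvg_cst.
  apply: (@cvg_near0 _ (fun n => C * n.+1%:R^-1)).
    rewrite -(mulr0 C); apply: cvgM; [exact: cvg_cst|exact: cvg_invS].
  apply: nearW => n; have n0 : 0 < n.+1%:R :> R by rewrite ltr0n.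
  rewrite normrM (gtr0_norm n0) -ler_pdivlMr//.
  apply: le_trans (HC n) _; rewrite -mulrA ler_wpM2l//.
  by rewrite -powR_inv1 ?(ltW n0)// -powRD ?(gt_eqF n0) ?implybT.
have hB : del n * n.+1%:R `^ (-1) / ln n%:R @[n --> \oo] --> (0 : R).
  apply: (@cvg_near0 _ (fun n => K * n.+1%:R^-1)).
    rewrite -(mulr0 K); apply: cvgM; [exact: cvg_cst|exact: cvg_invS].
  near=> n; have n0 : 0 < n.+1%:R :> R by rewrite ltr0n.
  have l1 : 1 <= ln n%:R :> R by near: n; exact: (cvgry_ge (@cvg_ln_nat_y R)).
  rewrite powR_inv1 ?(ltW n0)// normrM normrM.
  rewrite -[leRHS]mulr1; apply: ler_pM => //; last first.
    by rewrite normfV ger0_norm ?invf_le1//; lra.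
  by apply: ler_pM => //; rewrite gtr0_norm ?invr_gt0.
have := cvgD hA hB; rewrite addr0 => /(_ _ _) H; apply: eq_cvg_seq H => n.
rewrite ?fctE /A -mulrDl subrK; congr (_ / _); apply: eq_bigr => i _.
by rewrite powR_inv1.
Unshelve. all: by end_near. Qed.

Lemma retained_frequency : retained_count R ret n / n%:R @[n --> \oo] --> kap.
Proof.
have := @retained_power_sum 0; rewrite ltrN10 add0r divr1 => /(_ isT) H.
apply: eq_cvg_seq H => n; rewrite powRr1// /retained_count big_add1 big_mkord/=.
by congr (_ / _); apply: eq_bigr => i _; rewrite powRr0 mulr1.
Qed.

End periodic_sums.

(** * Central limit theorems *)

Section functional_clt.
Variables (R : realType) (ret : pred nat) (p lam q kap K : R).
Hypotheses (hp : 0 <= p <= 1) (hlam : 0 <= lam <= 1) (hq : `|q| <= 1).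
Hypotheses (kap0 : 0 < kap) (kap1 : kap < 1).
Implicit Types (l : seq R).
Hypothesis hK : forall n, `|retained_excess ret kap n| <= K.

Local Notation a := (2 * p - 1).
Local Notation b := (2 * lam - 1).
Local Notation g := (a * kap).
Local Notation m := (memory_drift ret p lam q).
Local Notation del := (retained_excess ret kap).
Local Notation r i := ((ret i)%:R : R).
Local Notation s := (limit_mean p lam kap).
Local Notation u := (scaled_retained ret p lam kap).
Local Notation z := (walk_part ret p lam q kap).
Local Notation w := (centered_retained ret p lam kap).

Let K0 : 0 <= K. Proof. exact: le_trans (hK 0). Qed.

Let m_le1 n l : sign_history n l -> `|m l| <= 1.
Proof. exact: norm_memory_drift_le1. Qed.

Lemma memory_exponent_lt1 : `|g| < 1.
Proof.
rewrite normrM (gtr0_norm kap0); apply: le_lt_trans kap1.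
rewrite -[leRHS]mul1r ler_wpM2r ?(ltW kap0)// ler_norml; move: hp; lra.
Qed.

Definition retained_weight i : R := r i.+1 * i.+1%:R `^ (- g).
Definition walk_weight i : R := 1 - r i.+1 / kap.
Definition clt_weight n i : R := walk_weight i + n%:R `^ g / kap * retained_weight i.

(** The 1 accounts for the bounded error of [walk_decomposition], the sum of [1 / i] for
    [walk_part_transform], and the product for the error of [scaled_retained_transform], which
    enters the walk multiplied by [n ^ g]. *)
Definition remainder_bound (n : nat) : R :=
  1 + n%:R `^ g + n%:R `^ g * (\sum_(i < n) i.+1%:R `^ (- g - 1)) + \sum_(i < n) i.+1%:R^-1.

Lemma remainder_bound_ge0 n : 0 <= remainder_bound n.
Proof.
rewrite /remainder_bound !addr_ge0// ?powR_ge0//.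
  by rewrite mulr_ge0 ?powR_ge0// sumr_ge0// => i _; exact: powR_ge0.
by rewrite sumr_ge0.
Qed.

Let scaled_retained_nil : u [::] = 0.
Proof. by rewrite /u /w /= /retained_count big_nil mulr0 subrr mul0r. Qed.

Let walk_part_nil : z [::] = 0.
Proof.
rewrite /z big_nil /= mul0r subr0 add0r /retained_excess /retained_count big_nil.
by rewrite mulr0 subrr !mul0r.
Qed.

Lemma scaled_retained_transform : exists2 C, 0 <= C & forall n l, sign_history n l ->
  `|u l - transform m (retained_weight \o size) l| <=
    C * \sum_(i < n) i.+1%:R `^ (- g - 1).
Proof.
have [C C0 HC] := scaled_retained_step hp hlam hq kap0 kap1 hK.
exists C => // n l hl; rewrite mulr_sumr.
apply: (transform_approx (c := fun i => C * i.+1%:R `^ (- g - 1))) hl.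
  exact: scaled_retained_nil.
move=> {}n x {}l hl; have sz : size l = n.
  by move: hl; rewrite sign_history_cons => /andP[_ /andP[/eqP]].
by rewrite /= /retained_weight sz; exact: HC.
Qed.

Lemma walk_part_transform n l : sign_history n l ->
  `|z l - transform m (walk_weight \o size) l| <=
    4 * K / kap * \sum_(i < n) i.+1%:R^-1.
Proof.
move=> hl; rewrite mulr_sumr.
apply: (transform_approx (c := fun i => 4 * K / kap * i.+1%:R^-1)) hl.
  exact: walk_part_nil.
move=> {}n x {}l hl; have sz : size l = n.
  by move: hl; rewrite sign_history_cons => /andP[_ /andP[/eqP]].
by rewrite /= /walk_weight sz; exact: (walk_part_step hp hlam hq kap0 hK).
Qed.

Lemma centered_retained_scaled n l : sign_history n.+1 l ->
  `|w l - n.+1%:R `^ g * u l| <= 2 * K.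
Proof.
move=> hl; have sz : size l = n.+1 by move: hl => /andP[/eqP].
have n0 : 0 < n.+1%:R :> R by rewrite ltr0n.
have hw := norm_centered_retained_le ret hp hlam kap0 kap1 hl.
have pg : n.+1%:R `^ g != 0 :> R by rewrite gt_eqF// powR_gt0.
rewrite /u sz powRN.
have -> : w l - n.+1%:R `^ g * (w l * ((n.+1%:R `^ g)^-1 * (1 - a * (del n.+1 / n.+1%:R)))) =
    w l / n.+1%:R * (a * del n.+1).
  move: (n.+1%:R : R) n0 pg => N N0 pg.
  by field; rewrite pg gt_eqF.
rewrite normrM; apply: ler_pM => //.
  by rewrite normrM normfV (gtr0_norm n0) ler_pdivrMr.
rewrite normrM -[leRHS]mul1r; apply: ler_pM => //.
by rewrite ler_norml; move: hp; lra.
Qed.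

Lemma walk_decomposition : exists2 C, 0 <= C & forall n l, sign_history n l ->
  `|\sum_(x <- l) x - n%:R * s - (z l + n%:R `^ g / kap * u l)| <= C.
Proof.
exists (4 * K / kap) => [|n l hl]; first by rewrite divr_ge0 ?mulr_ge0// ltW.
have sz : size l = n by move: hl => /andP[/eqP].
case: n hl sz => [|n] hl sz.
  case: l sz {hl} => // _; rewrite scaled_retained_nil walk_part_nil big_nil.
  rewrite mul0r mulr0 addr0 !subrr normr0.
  by rewrite divr_ge0 ?mulr_ge0// ltW.
have hcs := centered_retained_scaled hl.
(* In [z + w / kap] the retained sums cancel, leaving [(s - m l) * del / kap]; passing from [w] to
   [n ^ g * u] costs another bounded term. *)
have -> : \sum_(x <- l) x - n.+1%:R * s - (z l + n.+1%:R `^ g / kap * u l) =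
   ((w l - n.+1%:R `^ g * u l) + (s - m l) * del n.+1) / kap.
  rewrite /z {1}/w sz /retained_excess.
  by field; rewrite gt_eqF.
rewrite normrM normfV (gtr0_norm kap0) ler_wpM2r ?invr_ge0 ?(ltW kap0)//.
apply: le_trans (ler_normD _ _) _; rewrite (_ : 4 * K = 2 * K + 2 * K); last by ring.
apply: lerD => //; rewrite normrM; apply: ler_pM => //.
apply: le_trans (ler_normB _ _) _.
have := norm_limit_mean_le1 hp hlam kap0 kap1; have := m_le1 hl; lra.
Qed.

Lemma walk_transform : exists2 C, 0 <= C & forall n l, sign_history n l ->
  `|\sum_(x <- l) x - n%:R * s - transform m (clt_weight n \o size) l| <=
    C * remainder_bound n.
Proof.
have [C1 C10 H1] := scaled_retained_transform.
have [C2 C20 H2] := walk_decomposition.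
have k0 := ltW kap0.
have C30 : 0 <= 4 * K / kap by rewrite divr_ge0 ?mulr_ge0.
have C40 : 0 <= C1 / kap by rewrite divr_ge0.
exists (C2 + C1 / kap + 4 * K / kap); first by rewrite !addr_ge0.
move=> n l hl.
have -> : transform m (clt_weight n \o size) l =
    transform m (walk_weight \o size) l +
    n%:R `^ g / kap * transform m (retained_weight \o size) l.
  by rewrite -transform_lin.
set T1 := transform _ _ _; set T2 := transform _ _ _.
set S := \sum_(x <- l) x - n%:R * s.
rewrite (_ : S - _ = (S - (z l + n%:R `^ g / kap * u l)) + (z l - T1) + n%:R `^ g / kap * (u l - T2)); last by ring.
apply: le_trans (ler_normD _ _) _; apply: le_trans (lerD (ler_normD _ _) (lexx _)) _.
have h1 := H1 _ _ hl; have h2 := H2 _ _ hl; have h3 := walk_part_transform hl.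
have gk0 : 0 <= n%:R `^ g / kap by rewrite divr_ge0// powR_ge0.
rewrite [X in _ + X]normrM (ger0_norm gk0).
have h4 := ler_wpM2l gk0 h1.
rewrite /remainder_bound.
set A := \sum_(i < n) _ `^ _ in h4 *; set B := \sum_(i < n) _^-1 in h3 *.
have A0 : 0 <= A by rewrite sumr_ge0// => i _; exact: powR_ge0.
have B0 : 0 <= B by rewrite sumr_ge0.
have P0 : 0 <= n%:R `^ g :> R by exact: powR_ge0.
set G := n%:R `^ g in h4 P0 *.
have GA : 0 <= G * A by rewrite mulr_ge0.
have E : G / kap * (C1 * A) = C1 / kap * (G * A).
  by rewrite mulrAC [in RHS]mulrAC; congr (_ / _); ring.
rewrite E in h4; set c1 := C1 / kap in h4 C40 *; set c3 := 4 * K / kap in h3 C30 *.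
apply: le_trans (lerD (lerD h2 h3) h4) _.
rewrite -subr_ge0.
have -> : (C2 + c1 + c3) * (1 + G + G * A + B) - (C2 + c3 * B + c1 * (G * A)) =
  C2 * (G + G * A + B) + c1 * (1 + G + B) + c3 * (1 + G + G * A) by ring.
by rewrite !addr_ge0// mulr_ge0// !addr_ge0.
Qed.

Lemma sqr_le3 (x y t : R) : (x + y + t) ^+ 2 <= 3 * (x ^+ 2 + y ^+ 2 + t ^+ 2).
Proof.
have := sqr_ge0 (x - y); have := sqr_ge0 (x - t); have := sqr_ge0 (y - t); nra.
Qed.

(** A law of large numbers in L^2: [m - s] is [w / n] up to a factor and an error of order [1 / n],
    [w] is close to [n ^ g] times a martingale, and the second moment of that martingale is at most
    the sum of [i ^ (- 2 g)]. Only [g < 1] is needed. *)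
Lemma cvg_hexp_drift_sqr : hexp m n (fun l => (m l - s) ^+ 2) @[n --> \oo] --> (0 : R).
Proof.
have [C C0 HC] := scaled_retained_transform.
have g1 := memory_exponent_lt1.
have gl : g < 1 by apply: le_lt_trans g1; exact: ler_norm.
pose A n := \sum_(i < n) (i.+1%:R : R) `^ (- g - 1).
pose Q n := \sum_(i < n) (i.+1%:R : R) `^ (- (2 * g)).
(* The three summands bound the martingale, its pathwise error and the terms of order [1 / n]; the
   numerical constants are generous. *)
pose B n := 27 * (Q n / n%:R `^ (2 - 2 * g)) + 27 * C ^+ 2 * (A n / n%:R `^ (1 - g)) ^+ 2
    + (27 * (2 * K) ^+ 2 + 12 * K ^+ 2) * (n%:R^-1) ^+ 2.
have inv0 : (n%:R^-1 : R) @[n --> \oo] --> (0 : R).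
  exact: (@cvg_of_shift _ (fun n => n%:R^-1)) (@cvg_invS R).
have sq0 (f : R^nat) : f @ \oo --> (0 : R) -> (f n) ^+ 2 @[n --> \oo] --> (0 : R).
  by move=> f0; rewrite -[X in _ --> X](mulr0 0); apply: cvgM.
have B0 : B n @[n --> \oo] --> (0 : R).
  rewrite -(addr0 0) -{1}(addr0 0); apply: cvgD; first apply: cvgD.
  - rewrite -(mulr0 27); apply: cvgM; first exact: cvg_cst.
    by apply: power_sum_powR_small; lra.
  - rewrite -(mulr0 (27 * C ^+ 2)); apply: cvgM; first exact: cvg_cst.
    apply: sq0.
    by apply: power_sum_powR_small; lra.
  - rewrite -(mulr0 (27 * (2 * K) ^+ 2 + 12 * K ^+ 2)); apply: cvgM; first exact: cvg_cst.
    exact: sq0.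
apply: cvg_near0 B0 _; near=> n.
have n0 : (0 < n)%N by near: n; exact: nbhs_infty_gt.
rewrite ger0_norm; last by apply: (hexp_ge0 m_le1) => l _; exact: sqr_ge0.
have N0 : 0 < n%:R :> R by rewrite ltr0n.
pose c := 27 * (n%:R `^ (2 * g) / n%:R ^+ 2).
pose T l := transform m (retained_weight \o size) l.
pose c' := 27 * C ^+ 2 * (A n / n%:R `^ (1 - g)) ^+ 2
    + (27 * (2 * K) ^+ 2 + 12 * K ^+ 2) * (n%:R^-1) ^+ 2.
apply: (@le_trans _ _ (hexp m n (fun l => c * T l ^+ 2 + c' * 1))).
  apply: (hexp_le m_le1) => l hl.
  have EG : n%:R `^ (1 - g) = n%:R / n%:R `^ g :> R.
    by rewrite powRB ?powRr1 ?(ltW N0)// (gt_eqF N0) implybT.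
  have [k nk] : exists k, n = k.+1 by exists n.-1; rewrite prednK.
  have h1 := HC _ _ hl.
  have h2 : `|w l - n%:R `^ g * u l| <= 2 * K.
    by move: hl; rewrite nk; exact: centered_retained_scaled.
  have -> : m l - s = a * (w l / n%:R) + (a * s - b) * (del n / n%:R).
    by move: hl; rewrite nk; exact: (memory_drift_centered ret q hp hlam kap0 kap1).
  have -> : a * (w l / n%:R) + (a * s - b) * (del n / n%:R) =
    (a * (n%:R `^ g * T l) + a * (n%:R `^ g * (u l - T l))
     + (a * (w l - n%:R `^ g * u l) + (a * s - b) * del n)) / n%:R.
    move: (n%:R : R) N0 (n%:R `^ g) => N N0 G.
    by field; rewrite gt_eqF.
  have G2 : n%:R `^ (2 * g) = (n%:R `^ g) ^+ 2 :> R.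
    by rewrite -powR_mulrn ?powR_ge0// -powRrM mulrC.
  have G0 : 0 <= n%:R `^ g :> R by exact: powR_ge0.
  rewrite /c /c' EG G2; set G := n%:R `^ g in h1 h2 G0 *.
  set t1 := a * (G * T l); set t2 := a * _; set t3 := _ + _ * del _.
  have a1 : `|a| <= 1 by rewrite ler_norml; move: hp; lra.
  have b1 : `|b| <= 1 by rewrite ler_norml; move: hlam; lra.
  have s1 := norm_limit_mean_le1 hp hlam kap0 kap1.
  have sqle (x y : R) : `|x| <= y -> x ^+ 2 <= y ^+ 2.
    move=> xy; rewrite -[leLHS]real_normK ?num_real// ler_pXn2r// nnegrE//.
    exact: le_trans xy.
  have ht1 : t1 ^+ 2 <= G ^+ 2 * T l ^+ 2.
    rewrite -exprMn -[leRHS]real_normK ?num_real//; apply: sqle.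
    by rewrite normrM -[leRHS]mul1r ler_wpM2r.
  have ht2 : t2 ^+ 2 <= (G * (C * A n)) ^+ 2.
    apply: sqle; rewrite normrM -[leRHS]mul1r; apply: ler_pM => //.
    by rewrite normrM (ger0_norm G0) ler_wpM2l.
  have ht3 : t3 ^+ 2 <= (4 * K) ^+ 2.
    apply: sqle; rewrite (_ : 4 * K = 1 * (2 * K) + 2 * K); last by ring.
    apply: le_trans (ler_normD _ _) _; rewrite !normrM; apply: lerD.
      by apply: ler_pM.
    apply: ler_pM => //; apply: le_trans (ler_normB _ _) _; rewrite normrM.
    have := ler_pM (normr_ge0 a) (normr_ge0 s) a1 s1; move: b1; lra.
  rewrite exprMn; apply: (@le_trans _ _ (3 * (G ^+ 2 * T l ^+ 2 + (G * (C * A n)) ^+ 2 + (4 * K) ^+ 2) * n%:R^-1 ^+ 2)).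
    rewrite ler_wpM2r ?sqr_ge0//; apply: le_trans (sqr_le3 _ _ _) _.
    by rewrite ler_wpM2l// !lerD.
  have I0 : 0 <= (n%:R^-1 : R) ^+ 2 by exact: sqr_ge0.
  have -> : A n / (n%:R / G) = A n * G * n%:R^-1 by rewrite invf_div mulrA mulrAC.
  rewrite -exprVn !mulr1 -subr_ge0.
  have -> : 27 * (G ^+ 2 * n%:R^-1 ^+ 2) * T l ^+ 2 +
     (27 * C ^+ 2 * (A n * G * n%:R^-1) ^+ 2 + (27 * (2 * K) ^+ 2 + 12 * K ^+ 2) * n%:R^-1 ^+ 2) -
     3 * (G ^+ 2 * T l ^+ 2 + (G * (C * A n)) ^+ 2 + (4 * K) ^+ 2) * n%:R^-1 ^+ 2 =
     n%:R^-1 ^+ 2 * (24 * (G * T l) ^+ 2 + 24 * (C * A n * G) ^+ 2 + 72 * K ^+ 2).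
    by move: (n%:R^-1 : R) => I; ring.
  by apply: mulr_ge0 => //; rewrite !addr_ge0// mulr_ge0// sqr_ge0.
rewrite hexp_lin hexp_cst mulr1 /B /c' addrA lerD2r lerD2r.
have h := @hexp_sqr_transform R m m_le1 n (retained_weight \o size) (fun i => i.+1%:R `^ (- (2 * g))).
have hQ : hexp m n (fun l => T l ^+ 2) <= Q n.
  apply: h => i l _ hl; have sz : size l = i by move: hl => /andP[/eqP].
  rewrite /= /retained_weight sz exprMn -[leRHS]mul1r; apply: ler_pM => //; rewrite ?sqr_ge0//.
    by case: (ret _); rewrite ?expr1n ?expr0n.
  by rewrite -powR_mulrn ?powR_ge0// -powRrM mulNr mulrC.
have cc : 0 <= c by rewrite mulr_ge0// divr_ge0 ?powR_ge0// exprn_ge0.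
apply: le_trans (ler_wpM2l cc hQ) _.
rewrite /c -mulrA ler_wpM2l// mulrC powRB; last by rewrite (gt_eqF N0) implybT.
by rewrite -powR_mulrn ?(ltW N0)// invf_div.
Unshelve. all: by end_near. Qed.

Definition drift_fluctuation n : R := hexp m n (fun l => `|1 - m l ^+ 2 - (1 - s ^+ 2)|).

Lemma drift_fluctuation_ge0 n : 0 <= drift_fluctuation n.
Proof. by apply: (hexp_ge0 m_le1) => l _. Qed.

Lemma cvg_drift_fluctuation : drift_fluctuation @ \oo --> (0 : R).
Proof.
apply/cvgrPdist_le => e e0.
have e4 : 0 < e ^+ 2 / 4 by rewrite divr_gt0// exprn_gt0.
near=> n; rewrite sub0r normrN ger0_norm ?drift_fluctuation_ge0//.
have s1 := norm_limit_mean_le1 hp hlam kap0 kap1.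
have h : hexp m n (fun l => (m l - s) ^+ 2) <= e ^+ 2 / 4.
  near: n; have /cvgrPdist_le/(_ _ e4) := cvg_hexp_drift_sqr.
  apply: filterS => n; rewrite sub0r normrN; apply: le_trans; exact: ler_norm.
(* Passing from L^2 to L^1 by [2 * x <= 2 / e * x ^+ 2 + e / 2]. *)
apply: (@le_trans _ _ (hexp m n (fun l => 2 / e * (m l - s) ^+ 2 + e / 2 * 1))).
  apply: (hexp_le m_le1) => l hl.
  have -> : 1 - m l ^+ 2 - (1 - s ^+ 2) = - ((m l - s) * (m l + s)) by ring.
  rewrite normrN normrM; have ml := m_le1 hl.
  have h2 : `|m l + s| <= 2 by apply: le_trans (ler_normD _ _) _; lra.
  have h3 : `|m l - s| * `|m l + s| <= `|m l - s| * 2 by rewrite ler_wpM2l.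
  apply: le_trans h3 _; rewrite -[(m l - s) ^+ 2]real_normK ?num_real//.
  set x := `|m l - s|.
  rewrite -subr_ge0 (_ : _ - _ = 2 / e * (x - e / 2) ^+ 2); last by field; rewrite gt_eqF.
  by rewrite mulr_ge0 ?sqr_ge0// divr_ge0// ltW.
rewrite hexp_lin hexp_cst mulr1.
have : 2 / e * hexp m n (fun l => (m l - s) ^+ 2) <= 2 / e * (e ^+ 2 / 4).
  by rewrite ler_wpM2l// divr_ge0// ltW.
have -> : 2 / e * (e ^+ 2 / 4) = e / 2 by field; rewrite gt_eqF.
lra.
Unshelve. all: by end_near. Qed.

Section normalization.
Variables (N : R^nat) (S0 : R).
Hypothesis N0 : forall n, 0 <= N n.
(** [H1] fixes the limiting variance, [H2] lets the conditional variances be replaced by their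
    limit, [H3] is Lyapunov's condition of order three, and [H4] makes the pathwise remainder
    negligible. *)
Hypothesis H1 : (\sum_(i < n) clt_weight n i ^+ 2) / N n ^+ 2 @[n --> \oo] --> S0.
Hypothesis H2 :
  (\sum_(i < n) clt_weight n i ^+ 2 * drift_fluctuation i) / N n ^+ 2 @[n --> \oo] --> (0 : R).
Hypothesis H3 : (\sum_(i < n) `|clt_weight n i| ^+ 3) / N n ^+ 3 @[n --> \oo] --> (0 : R).
Hypothesis H4 : remainder_bound n / N n @[n --> \oo] --> (0 : R).

Definition normalized_walk n l : R := (\sum_(x <- l) x - n%:R * s) / N n.

(** No single [|c i|] exceeds the sum of cubes plus 1, so Lyapunov's condition also disposes of the
    fourth-order remainders. *)
Let sum4 (k : nat) (c : nat -> R) :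
  \sum_(i < k) c i ^+ 4 <= (\sum_(i < k) `|c i| ^+ 3) * (\sum_(i < k) `|c i| ^+ 3 + 1).
Proof.
set B := \sum_(i < k) `|c i| ^+ 3.
have cB (i : 'I_k) : `|c i| <= B + 1.
  have h : `|c i| ^+ 3 <= B.
    by rewrite /B (bigD1 i)//= lerDl sumr_ge0// => j _; rewrite exprn_ge0.
  have [c1|c1] := leP `|c i| 1.
    by apply: le_trans c1 _; rewrite lerDr; apply: le_trans h; rewrite exprn_ge0.
  apply: (@le_trans _ _ (`|c i| ^+ 3)); last by apply: le_trans h _; rewrite lerDl.
  by rewrite -{1}[ `|c i|]expr1 ler_weXn2l// ltW.
rewrite mulr_suml; apply: ler_sum => i _.
rewrite -[c i ^+ 4]ger0_norm; last by rewrite (_ : 4%N = 2 * 2)%N// exprM sqr_ge0.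
by rewrite normrX exprSr ler_wpM2l// exprn_ge0.
Qed.

(** The cosine being Lipschitz, [H4] allows the walk to be replaced by its martingale; then
    [hexp_cos_transform] applies with [v = 1 - s ^+ 2]. *)
Lemma cvg_hexp_cos (t v0 : R) :
  hexp m n (fun l => cos (t * normalized_walk n l + v0)) @[n --> \oo] -->
  cos v0 * expR (- ((1 - s ^+ 2) * S0 * t ^+ 2 / 2)).
Proof.
have [C C0 HC] := walk_transform.
have s1 : 0 <= 1 - s ^+ 2 <= 1.
  have := norm_limit_mean_le1 hp hlam kap0 kap1.
  rewrite -(@ler_pXn2r _ 2)// ?nnegrE// expr1n real_normK ?num_real// => h.
  by rewrite subr_ge0 h gerBl sqr_ge0.
pose c n i := t / N n * clt_weight n i.
pose E n := expR (- ((1 - s ^+ 2) * (\sum_(i < n) c n i ^+ 2) / 2)) * cos v0.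
pose B3 n := \sum_(i < n) `|c n i| ^+ 3.
pose err n := `|t| * C * (remainder_bound n / N n) +
  (t ^+ 2 * ((\sum_(i < n) clt_weight n i ^+ 2 * drift_fluctuation i) / N n ^+ 2) +
  (8 * B3 n + 17 * (B3 n * (B3 n + 1)))).
have sumE k n (x : nat -> R) : \sum_(i < n) (t / N n) ^+ k * x i =
    t ^+ k * ((\sum_(i < n) x i) / N n ^+ k).
  by rewrite -mulr_sumr expr_div_n; ring.
have B3E n : B3 n = `|t| ^+ 3 * ((\sum_(i < n) `|clt_weight n i| ^+ 3) / N n ^+ 3).
  rewrite /B3 -[N n in RHS]ger0_norm// mulr_suml mulr_sumr; apply: eq_bigr => i _.
  by rewrite /c !normrM normfV !exprMn exprVn; ring.
have B30 : B3 @ \oo --> (0 : R).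
  rewrite (funext B3E) -[X in _ --> X](mulr0 (`|t| ^+ 3)).
  by apply: cvgM; [exact: cvg_cst|exact: H3].
have err0 : err @ \oo --> (0 : R).
  rewrite -[X in _ --> X](_ : `|t| * C * 0 + (t ^+ 2 * 0 + (8 * 0 + 17 * (0 * (0 + 1)))) = 0); last by ring.
  apply: cvgD; first by apply: cvgM; [exact: cvg_cst|exact: H4].
  apply: cvgD; first by apply: cvgM; [exact: cvg_cst|exact: H2].
  apply: cvgD; first by apply: cvgM; [exact: cvg_cst|exact: B30].
  apply: cvgM; first exact: cvg_cst.
  by apply: cvgM; [exact: B30|apply: cvgD; [exact: B30|exact: cvg_cst]].
have Elim : E @ \oo --> cos v0 * expR (- ((1 - s ^+ 2) * S0 * t ^+ 2 / 2)).
  rewrite mulrC; apply: cvgM; last exact: cvg_cst.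
  apply: (cvg_comp _ expR); last exact: continuous_expR.
  apply: cvgN; apply: cvgM; last exact: cvg_cst.
  rewrite -mulrA; apply: cvgM; first exact: cvg_cst.
  rewrite mulrC; have -> : (fun n => \sum_(i < n) c n i ^+ 2) =
      fun n => t ^+ 2 * ((\sum_(i < n) clt_weight n i ^+ 2) / N n ^+ 2).
    by apply/funext => n; rewrite -(sumE 2 n (fun i => clt_weight n i ^+ 2)); apply: eq_bigr => i _; rewrite /c exprMn.
  by apply: cvgM; [exact: cvg_cst|exact: H1].
have bound n : `|hexp m n (fun l => cos (t * normalized_walk n l + v0)) - E n| <= err n.
  pose T l := transform m (c n \o size) l.
  have TE l : T l = t / N n * transform m (clt_weight n \o size) l.
    rewrite /T; elim: l => [|x l /= ->]; first by rewrite /= mulr0.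
    by rewrite /c; ring.
  rewrite (_ : _ - E n = (hexp m n (fun l => cos (t * normalized_walk n l + v0)) -
    hexp m n (fun l => cos (T l + v0))) + (hexp m n (fun l => cos (T l + v0)) - E n)); last by ring.
  apply: le_trans (ler_normD _ _) _; apply: lerD.
    rewrite -[X in _ - X]mul1r -mulNr -[X in `|X + _|]mul1r -hexp_lin.
    rewrite -[leRHS](hexp_cst m n); apply: (norm_hexp_le m_le1) => l hl.
    rewrite mul1r mulN1r; apply: le_trans (cos_lipschitz _ _) _.
    have -> : t * normalized_walk n l + v0 - (T l + v0) = t * ((N n)^-1 *
       (\sum_(x <- l) x - n%:R * s - transform m (clt_weight n \o size) l)).
      by rewrite TE /normalized_walk; ring.
    rewrite normrM -mulrA ler_wpM2l// normrM normfV (ger0_norm (N0 n)).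
    rewrite [leLHS]mulrC [leRHS]mulrA ler_wpM2r ?invr_ge0//.
    exact: HC.
  apply: le_trans (hexp_cos_transform m_le1 n (c n) v0 s1) _.
  rewrite !big_split/= lerD//.
    rewrite -(sumE 2 n (fun i => clt_weight n i ^+ 2 * drift_fluctuation i)) le_eqVlt; apply/orP; left; apply/eqP.
    by apply: eq_bigr => i _; rewrite /c exprMn mulrA.
  rewrite -!mulr_sumr lerD2l ler_wpM2l//; exact: sum4.
have D0 : hexp m n (fun l => cos (t * normalized_walk n l + v0)) - E n @[n --> \oo] --> (0 : R).
  by apply: cvg_near0 err0 _; apply: nearW => n; exact: bound.
have := cvgD D0 Elim; rewrite add0r => /(_ _ _) H; apply: eq_cvg_seq H => n.
by rewrite ?fctE subrK.
Qed.

Lemma hexp_sqr_normalized_walk : exists C, forall n,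
  hexp m n (fun l => normalized_walk n l ^+ 2) <= C.
Proof.
have [C C0 HC] := walk_transform.
have [B1 HB1] : exists B1, forall n, (\sum_(i < n) clt_weight n i ^+ 2) / N n ^+ 2 <= B1.
  have [M [_ HM]] := cvg_seq_bounded (cvgP _ H1).
  exists (M + 1) => n; apply: le_trans (ler_norm _) _; apply: HM => //.
  by rewrite ltrDl.
have [B2 HB2] : exists B2, forall n, remainder_bound n / N n <= B2.
  have [M [_ HM]] := cvg_seq_bounded (cvgP _ H4).
  exists (M + 1) => n; apply: le_trans (ler_norm _) _; apply: HM => //.
  by rewrite ltrDl.
exists (2 * B1 + 2 * (C * B2) ^+ 2) => n.
have rN0 : 0 <= remainder_bound n / N n by rewrite divr_ge0// remainder_bound_ge0.
pose T l := transform m (clt_weight n \o size) l.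
apply: (@le_trans _ _ (hexp m n (fun l => 2 / N n ^+ 2 * T l ^+ 2 + 2 * (C * B2) ^+ 2 * 1))).
  apply: (hexp_le m_le1) => l hl.
  have h := HC _ _ hl; rewrite /normalized_walk; set S := \sum_(x <- l) x - n%:R * s in h *; rewrite -/(T l) in h.
  have -> : S / N n = T l / N n + (S - T l) / N n by ring.
  have h2 : ((S - T l) / N n) ^+ 2 <= (C * B2) ^+ 2.
    rewrite -[leLHS]real_normK ?num_real//.
    have hh : `|(S - T l) / N n| <= C * B2.
      rewrite normrM normfV (ger0_norm (N0 n)).
      apply: (@le_trans _ _ (C * (remainder_bound n / N n))); last by rewrite ler_wpM2l.
      by rewrite mulrA ler_wpM2r ?invr_ge0.
    by rewrite ler_pXn2r// nnegrE//; apply: le_trans hh.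
  have -> : 2 / N n ^+ 2 * T l ^+ 2 = 2 * (T l / N n) ^+ 2 by rewrite expr_div_n; ring.
  rewrite mulr1; set x := T l / N n; set y := (S - T l) / N n in h2 *.
  have := sqr_ge0 (x - y); nra.
rewrite hexp_lin hexp_cst mulr1 lerD2r.
have h := @hexp_sqr_transform R m m_le1 n (clt_weight n \o size) (fun i => clt_weight n i ^+ 2).
have {}h : hexp m n (fun l => T l ^+ 2) <= \sum_(i < n) clt_weight n i ^+ 2.
  by apply: h => i l _ /andP[/eqP sz _]; rewrite /= sz.
apply: (@le_trans _ _ (2 / N n ^+ 2 * \sum_(i < n) clt_weight n i ^+ 2)).
  by rewrite ler_wpM2l// divr_ge0// exprn_ge0.
by rewrite -mulrA ler_wpM2l// mulrC.
Qed.

Theorem functional_clt f M : 0 <= S0 -> continuous f -> (forall x, `|f x| <= M) ->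
  hexp m n (fun l => f (normalized_walk n l)) @[n --> \oo] -->
  \int[normal_law 0 ((1 - s ^+ 2) * S0)]_x f x.
Proof.
move=> S00 cf fM.
have [C HC] := hexp_sqr_normalized_walk.
have s1 : 0 <= 1 - s ^+ 2.
  have := norm_limit_mean_le1 hp hlam kap0 kap1.
  rewrite -(@ler_pXn2r _ 2)// ?nnegrE// expr1n real_normK ?num_real// => h.
  by rewrite subr_ge0.
have V0 : 0 <= (1 - s ^+ 2) * S0 by rewrite mulr_ge0.
set V := (1 - s ^+ 2) * S0 in V0 *.
have lin n : positive_linear (fun f : R -> R => hexp m n (fun l => f (normalized_walk n l))).
  split; first by move=> f1 f2 c1 c2 _ _; exact: hexp_lin.
  by move=> f1 f2 _ _ h; apply: (hexp_le m_le1) => l _.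
(* With variance 0 the limit functional is evaluation at 0, which falls under the same convergence
   criterion. *)
rewrite /normal_law; case: (eqVneq V 0) => [VE|Vn0].
  have E (h : R -> R) : continuous h -> \int[dirac (0 : measurableTypeR R)]_x h x = h 0.
    move=> ch; rewrite /Rintegral integral_dirac//=; first by rewrite indicE mem_set// mul1r.
    by apply/measurable_EFinP; exact: continuous_measurable_fun.
  rewrite E//.
  apply: (@cos_cvg_bounded_continuous _ (fun n f => hexp m n (fun l => f (normalized_walk n l)))
     (fun f => f 0) (Num.max C 0)) cf fM => //.
  - by move=> n; exact: hexp_cst.
  - by move=> n; rewrite le_max HC.
  - by rewrite expr0n le_max lexx orbT.
  - move=> t u0; have := @cvg_hexp_cos t u0.
    by rewrite -/V VE !mul0r oppr0 expR0 mulr1 mulr0 add0r.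
have sV : Num.sqrt V != 0 by rewrite sqrtr_eq0 -ltNge lt_neqAle eq_sym Vn0.
pose L (f : R -> R) : R := \int[normal_prob 0 (Num.sqrt V)]_x f x.
apply: (@cos_cvg_bounded_continuous _ (fun n f => hexp m n (fun l => f (normalized_walk n l)))
     L (Num.max C (L (fun x => x ^+ 2)))) cf fM => //.
- exact: positive_linear_Rintegral (integrable_normal_prob_sqr sV).
- by move=> n; exact: hexp_cst.
- exact: Rintegral_probability1.
- by move=> n; rewrite le_max HC.
- by rewrite le_max lexx orbT.
- move=> t u0; rewrite /L (Rintegral_normal_cos sV) sqr_sqrtr//.
  exact: cvg_hexp_cos.
Qed.

End normalization.

End functional_clt.

(** The limit, term by term, of the expansion [sum_clt_weight_sqr] divided by [n]. *)
Definition diffusive_factor (R : realType) (kap g : R) : R :=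
  1 + (kap ^- 2 - 2 / kap) * kap + 2 * (1 - kap^-1) / kap * (kap / (1 - g)) +
  kap ^- 2 * (kap / (1 - 2 * g)).

Lemma diffusive_factor_gt0 (R : realType) (kap g : R) :
  0 < kap < 1 -> g < 2^-1 -> 0 < diffusive_factor kap g.
Proof.
move=> /andP[k0 k1] g2; have g1 : 0 < 1 - g by lra.
have g3 : 0 < 1 - 2 * g by lra.
(* Tampered indices have density [1 - kap] and weight 1. Retained ones have density [kap] and weight
   [1 - 1 / kap + x ^ (- g) / kap] with [x = i / n] uniform in the limit; the other two terms are
   [kap] times the squared mean and the variance of that weight. *)
have -> : diffusive_factor kap g = (1 - kap) +
    kap * ((1 - kap^-1) + (kap * (1 - g))^-1) ^+ 2 +
    kap^-1 * (g ^+ 2 / ((1 - 2 * g) * (1 - g) ^+ 2)).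
  by rewrite /diffusive_factor; field; rewrite !gt_eqF.
rewrite -addrA ltr_pwDl ?subr_gt0// addr_ge0//.
  by rewrite mulr_ge0 ?sqr_ge0// ltW.
by rewrite mulr_ge0 ?invr_ge0 ?(ltW k0)// divr_ge0 ?sqr_ge0// mulr_ge0 ?sqr_ge0// ltW.
Qed.

(** * The conditions of the central limit theorem in the diffusive and critical regimes *)

Section regimes.
Variables (R : realType) (ret : pred nat) (p lam q kap K : R).
Hypotheses (hp : 0 <= p <= 1) (hlam : 0 <= lam <= 1) (hq : `|q| <= 1).
Hypotheses (kap0 : 0 < kap) (kap1 : kap < 1).
Hypothesis hK : forall n, `|retained_excess ret kap n| <= K.

Local Notation a := (2 * p - 1).
Local Notation g := (a * kap).
Local Notation r i := ((ret i)%:R : R).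
Local Notation weight := (clt_weight ret p kap).
Local Notation fluct := (drift_fluctuation ret p lam q kap).
Local Notation rem := (remainder_bound p kap).

Let r2 i : r i ^+ 2 = r i.
Proof. by case: (ret i); rewrite ?expr1n ?expr0n. Qed.

Lemma sum_clt_weight_sqr n : \sum_(i < n) weight n i ^+ 2 =
  n%:R + (kap ^- 2 - 2 / kap) * retained_count R ret n +
  2 * (1 - kap^-1) / kap * (n%:R `^ g * \sum_(i < n) r i.+1 * i.+1%:R `^ (- g)) +
  kap ^- 2 * (n%:R `^ (2 * g) * \sum_(i < n) r i.+1 * i.+1%:R `^ (- (2 * g))).
Proof.
have {1}-> : n%:R = \sum_(i < n) 1 :> R by rewrite sumr_const card_ord.
rewrite /retained_count big_add1 big_mkord/= !mulr_sumr -!big_split/=.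
apply: eq_bigr => i _; rewrite /clt_weight /walk_weight /retained_weight.
have -> : n%:R `^ (2 * g) = (n%:R `^ g) ^+ 2 :> R.
  by rewrite -powR_mulrn ?powR_ge0// -powRrM; congr powR; ring.
have -> : i.+1%:R `^ (- (2 * g)) = (i.+1%:R `^ (- g)) ^+ 2 :> R.
  by rewrite -powR_mulrn ?powR_ge0// -powRrM; congr powR; ring.
move: (r2 i.+1); set y := r _; set G := _ `^ g; set P := _ `^ (- g) => yy.
have k0 : kap != 0 by rewrite gt_eqF.
have -> : (1 - y / kap + G / kap * (y * P)) ^+ 2 =
   1 - 2 / kap * y + kap ^- 2 * y ^+ 2 + 2 / kap * G * P * y - 2 * kap ^- 2 * G * P * y ^+ 2
   + kap ^- 2 * (G ^+ 2 * (y ^+ 2 * P ^+ 2)) by field.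
by rewrite yy; field.
Qed.

Lemma norm_clt_weight_le n i :
  `|weight n i| <= kap^-1 * (1 + n%:R `^ g * i.+1%:R `^ (- g)).
Proof.
have kv : 1 < kap^-1 by rewrite invf_gt1.
have G0 : 0 <= n%:R `^ g :> R by exact: powR_ge0.
have P0 : 0 <= i.+1%:R `^ (- g) :> R by exact: powR_ge0.
rewrite mulrDr mulr1; apply: le_trans (ler_normD _ _) _; apply: lerD.
  by rewrite /walk_weight; case: (ret _); rewrite ?mul1r ?mul0r ?subr0 ler_norml; lra.
rewrite /retained_weight !normrM (ger0_norm G0) (ger0_norm P0) normfV (gtr0_norm kap0).
have rN : `|r i.+1| <= 1 by case: (ret _); rewrite ?normr1 ?normr0.
rewrite (_ : kap^-1 * _ = n%:R `^ g / kap * (1 * i.+1%:R `^ (- g))); last by ring.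
by rewrite ler_wpM2l ?ler_wpM2r// mulr_ge0// invr_ge0 ltW.
Qed.

Let sqrD (x y : R) : (x + y) ^+ 2 <= 2 * (x ^+ 2 + y ^+ 2).
Proof. by have := sqr_ge0 (x - y); nra. Qed.

Let cubeD (x y : R) : 0 <= x -> 0 <= y -> (x + y) ^+ 3 <= 4 * (x ^+ 3 + y ^+ 3).
Proof.
move=> x0 y0; rewrite -subr_ge0.
have -> : 4 * (x ^+ 3 + y ^+ 3) - (x + y) ^+ 3 = 3 * ((x + y) * (x - y) ^+ 2) by ring.
by rewrite mulr_ge0// mulr_ge0 ?sqr_ge0// addr_ge0.
Qed.

Lemma clt_weight_sqr_le n i : weight n i ^+ 2 <=
  2 * kap ^- 2 * (1 + n%:R `^ (2 * g) * i.+1%:R `^ (- (2 * g))).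
Proof.
have h := norm_clt_weight_le n i.
have -> : n%:R `^ (2 * g) = (n%:R `^ g) ^+ 2 :> R.
  by rewrite -powR_mulrn ?powR_ge0// -powRrM; congr powR; ring.
have -> : i.+1%:R `^ (- (2 * g)) = (i.+1%:R `^ (- g)) ^+ 2 :> R.
  by rewrite -powR_mulrn ?powR_ge0// -powRrM; congr powR; ring.
rewrite -[leLHS]real_normK ?num_real//.
apply: (@le_trans _ _ ((kap^-1 * (1 + n%:R `^ g * i.+1%:R `^ (- g))) ^+ 2)).
  by rewrite ler_pXn2r// nnegrE//; apply: le_trans h.
rewrite exprMn exprVn [2 / _]mulrC -[leRHS]mulrA ler_wpM2l ?invr_ge0 ?sqr_ge0//.
by apply: le_trans (sqrD _ _) _; rewrite expr1n exprMn.
Qed.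

Lemma clt_weight_cube_le n i : `|weight n i| ^+ 3 <=
  4 * kap ^- 3 * (1 + n%:R `^ (3 * g) * i.+1%:R `^ (- (3 * g))).
Proof.
have h := norm_clt_weight_le n i.
have -> : n%:R `^ (3 * g) = (n%:R `^ g) ^+ 3 :> R.
  by rewrite -powR_mulrn ?powR_ge0// -powRrM; congr powR; ring.
have -> : i.+1%:R `^ (- (3 * g)) = (i.+1%:R `^ (- g)) ^+ 3 :> R.
  by rewrite -powR_mulrn ?powR_ge0// -powRrM; congr powR; ring.
apply: (@le_trans _ _ ((kap^-1 * (1 + n%:R `^ g * i.+1%:R `^ (- g))) ^+ 3)).
  by rewrite ler_pXn2r// nnegrE//; apply: le_trans h.
rewrite exprMn exprVn [4 / _]mulrC -[leRHS]mulrA ler_wpM2l ?invr_ge0 ?exprn_ge0 ?(ltW kap0)//.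
by apply: le_trans (cubeD _ _) _; rewrite ?expr1n ?exprMn//.
Qed.

Let fluct_lim : fluct @ \oo --> (0 : R).
Proof. exact: cvg_drift_fluctuation hp hlam hq kap0 kap1 hK. Qed.

Let fluct_ge0 n : 0 <= fluct n.
Proof. exact: drift_fluctuation_ge0. Qed.

Let sum_fluct_le n : \sum_(i < n) weight n i ^+ 2 * fluct i <=
  2 * kap ^- 2 * (\sum_(i < n) fluct i +
    n%:R `^ (2 * g) * \sum_(i < n) i.+1%:R `^ (- (2 * g)) * fluct i).
Proof.
rewrite mulr_sumr -big_split/= mulr_sumr; apply: ler_sum => i _.
apply: le_trans (ler_wpM2r (fluct_ge0 i) (clt_weight_sqr_le n i)) _.
by rewrite le_eqVlt; apply/orP; left; apply/eqP; ring.
Qed.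

Let sum_cube_le n : \sum_(i < n) `|weight n i| ^+ 3 <=
  4 * kap ^- 3 * (n%:R + n%:R `^ (3 * g) * \sum_(i < n) i.+1%:R `^ (- (3 * g))).
Proof.
have {1}-> : n%:R = \sum_(i < n) 1 :> R by rewrite sumr_const card_ord.
rewrite mulr_sumr -big_split/= mulr_sumr; apply: ler_sum => i _.
exact: clt_weight_cube_le.
Qed.

Let sum_fluct_lim t : -1 < t ->
  (\sum_(i < n) i.+1%:R `^ t * fluct i) / n%:R `^ (t + 1) @[n --> \oo] --> (0 : R).
Proof.
move=> t1; apply: (@power_sum_small _ (fun i => i.+1%:R `^ t * fluct i)); first lra.
rewrite addrK; apply: eq_cvg_seq fluct_lim => n.
by rewrite mulrAC divff ?mul1r// gt_eqF// powR_gt0.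
Qed.

Let mean_fluct_lim : (\sum_(i < n) fluct i) / n%:R @[n --> \oo] --> (0 : R).
Proof.
have := @sum_fluct_lim 0; rewrite ltrN10 add0r => /(_ isT) H.
apply: eq_cvg_seq H => n; rewrite powRr1//; congr (_ / _).
by apply: eq_bigr => i _; rewrite powRr0 mul1r.
Qed.

Let powR_nat_div (n : nat) (t s : R) : (0 < n)%N -> n%:R `^ t / n%:R `^ s = n%:R `^ (t - s).
Proof. by move=> n0; rewrite powR_ratio// ltr0n. Qed.

Let powR_natV (n : nat) (t : R) : (0 < n)%N -> n%:R `^ t / n%:R = (n%:R `^ (- t + 1))^-1.
Proof.
by move=> n0; rewrite -powRN opprD opprK -powR_nat_div// powRr1.
Qed.

Section diffusive.
Hypothesis g2 : g < 2^-1.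
Let N n : R := Num.sqrt n%:R.

Let N2 n : N n ^+ 2 = n%:R.
Proof. by rewrite sqr_sqrtr. Qed.

Let NE n : N n = n%:R `^ 2^-1.
Proof. by rewrite powR12_sqrt. Qed.

Let N3 n : N n ^+ 3 = n%:R `^ (3 / 2).
Proof. by rewrite NE -powR_mulrn ?powR_ge0// -powRrM; congr powR; ring. Qed.

Let g1 : g < 1. Proof. by apply: lt_trans g2 _; lra. Qed.

Lemma diffusive_variance :
  (\sum_(i < n) weight n i ^+ 2) / N n ^+ 2 @[n --> \oo] --> diffusive_factor kap g.
Proof.
have h1 := retained_frequency hK.
have h2 : (\sum_(i < n) r i.+1 * i.+1%:R `^ (- g)) / n%:R `^ (- g + 1) @[n --> \oo] --> kap / (- g + 1).
  by apply: (retained_power_sum hK); have := g1; lra.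
have h3 : (\sum_(i < n) r i.+1 * i.+1%:R `^ (- (2 * g))) / n%:R `^ (- (2 * g) + 1) @[n --> \oo] --> kap / (- (2 * g) + 1).
  by apply: (retained_power_sum hK); move: g2; lra.
rewrite /diffusive_factor [1 - g]addrC [1 - 2 * g]addrC.
have H := cvg_seqD (cvg_seqD (cvg_seqD (@cvg_seq_cst R (1 : R)) (cvg_seqM (@cvg_seq_cst R (kap ^- 2 - 2 / kap)) h1))
  (cvg_seqM (@cvg_seq_cst R (2 * (1 - kap^-1) / kap)) h2)) (cvg_seqM (@cvg_seq_cst R (kap ^- 2)) h3).
apply: near_eq_cvg_seq H; near=> n.
have n0 : (0 < n)%N by near: n; exact: nbhs_infty_gt.
rewrite /= sum_clt_weight_sqr N2 -!powR_natV//.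
move: (\sum_(i < n) _) (\sum_(i < n) _) => S1 S2.
by field; rewrite pnatr_eq0 -lt0n n0 gt_eqF.
Unshelve. all: by end_near. Qed.

Lemma diffusive_fluctuation :
  (\sum_(i < n) weight n i ^+ 2 * fluct i) / N n ^+ 2 @[n --> \oo] --> (0 : R).
Proof.
have h1 : (\sum_(i < n) i.+1%:R `^ (- (2 * g)) * fluct i) / n%:R `^ (- (2 * g) + 1) @[n --> \oo] --> (0 : R).
  by apply: sum_fluct_lim; move: g2; lra.
have H := cvg_seqM (@cvg_seq_cst R (2 * kap ^- 2)) (cvg_seqD mean_fluct_lim h1).
rewrite addr0 mulr0 in H.
apply: cvg_near0 H _; near=> n.
have n0 : (0 < n)%N by near: n; exact: nbhs_infty_gt.
have N0 : 0 < n%:R :> R by rewrite ltr0n.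
rewrite N2 ger0_norm; last first.
  by rewrite divr_ge0// sumr_ge0// => i _; rewrite mulr_ge0// sqr_ge0.
rewrite ler_pdivrMr//; apply: le_trans (sum_fluct_le n) _.
rewrite /= -powR_natV//; move: (\sum_(i < n) _) (\sum_(i < n) _) => S1 S2.
by rewrite le_eqVlt; apply/orP; left; apply/eqP; field; rewrite !gt_eqF.
Unshelve. all: by end_near. Qed.

Let powR_natV2 (n : nat) (t s : R) : (0 < n)%N -> n%:R `^ t / n%:R `^ s = (n%:R `^ (s - t))^-1.
Proof. by move=> n0; rewrite powR_nat_div// -powRN opprB. Qed.

Lemma diffusive_cube :
  (\sum_(i < n) `|weight n i| ^+ 3) / N n ^+ 3 @[n --> \oo] --> (0 : R).
Proof.
have h1 : (\sum_(i < n) i.+1%:R `^ (- (3 * g))) / n%:R `^ (3 / 2 - 3 * g) @[n --> \oo] --> (0 : R).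
  by apply: power_sum_powR_small; move: g2; lra.
have h2 : (n%:R : R) `^ (- 2^-1) @[n --> \oo] --> (0 : R) by apply: cvg_natr_powR_0; lra.
have H := cvg_seqM (@cvg_seq_cst R (4 * kap ^- 3)) (cvg_seqD h2 h1).
rewrite addr0 mulr0 in H.
apply: cvg_near0 H _; near=> n.
have n0 : (0 < n)%N by near: n; exact: nbhs_infty_gt.
have N0 : 0 < n%:R :> R by rewrite ltr0n.
have P0 : 0 < n%:R `^ (3 / 2) :> R by rewrite powR_gt0.
rewrite N3 ger0_norm; last first.
  by rewrite divr_ge0 ?(ltW P0)// sumr_ge0// => i _; rewrite exprn_ge0.
rewrite ler_pdivrMr//; apply: le_trans (sum_cube_le n) _.
rewrite /= -powR_natV2//; move: (\sum_(i < n) _) => S1.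
have -> : n%:R `^ (- 2^-1) = n%:R / n%:R `^ (3 / 2) :> R.
  by rewrite -{2}[n%:R]powRr1 ?(ltW N0)// powR_nat_div//; congr powR; field.
by rewrite le_eqVlt; apply/orP; left; apply/eqP; field; rewrite !gt_eqF.
Unshelve. all: by end_near. Qed.

Lemma diffusive_remainder : rem n / N n @[n --> \oo] --> (0 : R).
Proof.
have h1 : (n%:R : R) `^ (- 2^-1) @[n --> \oo] --> (0 : R) by apply: cvg_natr_powR_0; lra.
have h2 : (n%:R : R) `^ (g - 2^-1) @[n --> \oo] --> (0 : R).
  by apply: cvg_natr_powR_0; rewrite subr_lt0.
have h3 : (\sum_(i < n) (i.+1%:R : R) `^ (- g - 1)) / n%:R `^ (2^-1 - g) @[n --> \oo] --> (0 : R).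
  by apply: power_sum_powR_small; move: g2; lra.
have h4 : (\sum_(i < n) (i.+1%:R : R) `^ (- 1)) / n%:R `^ 2^-1 @[n --> \oo] --> (0 : R).
  by apply: power_sum_powR_small; lra.
have H := cvg_seqD (cvg_seqD (cvg_seqD h1 h2) h3) h4; rewrite !addr0 in H.
apply: near_eq_cvg_seq H; near=> n.
have n0 : (0 < n)%N by near: n; exact: nbhs_infty_gt.
rewrite /= NE /remainder_bound -powR_natV2// -powR_nat_div// powRN.
have -> : \sum_(i < n) (i.+1%:R : R) `^ (- 1) = \sum_(i < n) i.+1%:R^-1.
  by apply: eq_bigr => i _; rewrite powR_inv1.
by ring.
Unshelve. all: by end_near. Qed.

Theorem diffusive_functional_clt f M : continuous f -> (forall x, `|f x| <= M) ->
  hexp (memory_drift ret p lam q) n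
    (fun l => f ((\sum_(x <- l) x - n%:R * limit_mean p lam kap) / Num.sqrt n%:R))
    @[n --> \oo] -->
  \int[normal_law 0 ((1 - limit_mean p lam kap ^+ 2) * diffusive_factor kap g)]_x f x.
Proof.
move=> cf fM.
apply: (functional_clt hp hlam hq kap0 kap1 hK (N := N)) cf fM.
- by move=> n; exact: sqrtr_ge0.
- exact: diffusive_variance.
- exact: diffusive_fluctuation.
- exact: diffusive_cube.
- exact: diffusive_remainder.
- by apply/ltW/diffusive_factor_gt0 => //; rewrite kap0.
Qed.

End diffusive.

Section critical.
Hypothesis g2 : g = 2^-1.
Let N n : R := Num.sqrt (n%:R * ln n%:R).

Let ln0 (n : nat) : 0 <= ln n%:R :> R.
Proof.
case: n => [|n]; first by rewrite ln0.
by rewrite ln_ge0// ler1n.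
Qed.

Let N2 n : N n ^+ 2 = n%:R * ln n%:R.
Proof. by rewrite sqr_sqrtr// mulr_ge0. Qed.

Let NE n : N n = n%:R `^ 2^-1 * Num.sqrt (ln n%:R).
Proof. by rewrite /N sqrtrM// powR12_sqrt. Qed.

Let cvg_inv_sqrt_ln : (Num.sqrt (ln n%:R))^-1 @[n --> \oo] --> (0 : R).
Proof.
have h : Num.sqrt (ln n%:R) @[n --> \oo] --> (+oo : set_system R).
  apply/cvgryPge => A; near=> n.
  have h : A ^+ 2 <= ln n%:R by near: n; exact: (cvgry_ge (@cvg_ln_nat_y R)).
  by apply: le_trans (ler_norm _) _; rewrite -sqrtr_sqr ler_wsqrtr.
apply/gtr0_cvgV0 => //; near=> n.
by near: n; exact: (cvgry_gt h).
Unshelve. all: by end_near. Qed.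

Let cvg_inv_ln : (ln n%:R)^-1 @[n --> \oo] --> (0 : R).
Proof.
rewrite -[X in _ --> X](mulr0 0).
have H := cvg_seqM cvg_inv_sqrt_ln cvg_inv_sqrt_ln.
apply: eq_cvg_seq H => n.
by rewrite /= -invfM -expr2 sqr_sqrtr.
Qed.

(** When [2 * g = 1] the last sum of [sum_clt_weight_sqr] is harmonic and grows like [kap * ln n];
    the other terms are of order [n] and disappear after division by [n * ln n]. *)
Lemma critical_variance :
  (\sum_(i < n) weight n i ^+ 2) / N n ^+ 2 @[n --> \oo] --> kap^-1.
Proof.
have h1 := retained_frequency hK.
have h2 : (\sum_(i < n) r i.+1 * i.+1%:R `^ (- g)) / n%:R `^ (- g + 1) @[n --> \oo] --> kap / (- g + 1).
  by apply: (retained_power_sum hK); rewrite g2; lra.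
have h3 := retained_log_sum hK.
have H := cvg_seqD (cvg_seqM (cvg_seqD (cvg_seqD (@cvg_seq_cst R (1 : R)) (cvg_seqM (@cvg_seq_cst R (kap ^- 2 - 2 / kap)) h1))
  (cvg_seqM (@cvg_seq_cst R (2 * (1 - kap^-1) / kap)) h2)) cvg_inv_ln) (cvg_seqM (@cvg_seq_cst R (kap ^- 2)) h3).
rewrite mulr0 add0r in H.
have <- : kap ^- 2 * kap = kap^-1 by field; rewrite gt_eqF.
apply: near_eq_cvg_seq H; near=> n.
have n0 : (0 < n)%N by near: n; exact: nbhs_infty_gt.
have l0 : 0 < ln n%:R :> R by near: n; exact: (cvgry_gt (@cvg_ln_nat_y R)).
rewrite /= sum_clt_weight_sqr N2 -!powR_natV//.
have -> : 2 * g = 1 by rewrite g2; field.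
have -> : \sum_(i < n) r i.+1 * i.+1%:R `^ (- 1) = \sum_(i < n) r i.+1 * i.+1%:R^-1.
  by apply: eq_bigr => i _; rewrite powR_inv1.
rewrite powRr1//; move: (\sum_(i < n) _) (\sum_(i < n) _) => S1 S2.
by field; rewrite !gt_eqF// ltr0n.
Unshelve. all: by end_near. Qed.

Lemma critical_fluctuation :
  (\sum_(i < n) weight n i ^+ 2 * fluct i) / N n ^+ 2 @[n --> \oo] --> (0 : R).
Proof.
have h1 : (\sum_(i < n) i.+1%:R `^ (- (2 * g)) * fluct i) / ln n%:R @[n --> \oo] --> (0 : R).
  apply: log_sum_cvg; apply: eq_cvg_seq fluct_lim => n.
  rewrite big_ord_recr/= addrAC subrr add0r (_ : - (2 * g) = -1); last by rewrite g2; field.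
  by rewrite powR_inv1// mulrAC mulVf ?mul1r ?pnatr_eq0.
have H := cvg_seqM (@cvg_seq_cst R (2 * kap ^- 2)) (cvg_seqD (cvg_seqM mean_fluct_lim cvg_inv_ln) h1).
rewrite mulr0 addr0 mulr0 in H.
apply: cvg_near0 H _; near=> n.
have n0 : (0 < n)%N by near: n; exact: nbhs_infty_gt.
have N0 : 0 < n%:R :> R by rewrite ltr0n.
have l0 : 0 < ln n%:R :> R by near: n; exact: (cvgry_gt (@cvg_ln_nat_y R)).
rewrite N2 ger0_norm; last first.
  rewrite divr_ge0//; first by rewrite sumr_ge0// => i _; rewrite mulr_ge0// sqr_ge0.
  by rewrite mulr_ge0// ltW.
rewrite ler_pdivrMr ?mulr_gt0//; apply: le_trans (sum_fluct_le n) _.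
rewrite /= (_ : n%:R `^ (2 * g) = n%:R); last first.
  by rewrite (_ : 2 * g = 1) ?powRr1//; rewrite g2; field.
move: (\sum_(i < n) _) (\sum_(i < n) _) => S1 S2.
by rewrite le_eqVlt; apply/orP; left; apply/eqP; field; rewrite !gt_eqF.
Unshelve. all: by end_near. Qed.

Lemma critical_cube :
  (\sum_(i < n) `|weight n i| ^+ 3) / N n ^+ 3 @[n --> \oo] --> (0 : R).
Proof.
(* At [g = 1 / 2] the exponent [3 * g] exceeds 1, so the sum is bounded and the logarithms in the
   normalization make the quotient vanish. *)
have [C HC] := @sum_powR_bounded R 2^-1 ltac:(lra).
have h2 : (n%:R : R) `^ (- 2^-1) @[n --> \oo] --> (0 : R) by apply: cvg_natr_powR_0; lra.
have i3 := cvg_seqM cvg_inv_sqrt_ln cvg_inv_ln; rewrite mulr0 in i3.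
have H := cvg_seqM (@cvg_seq_cst R (4 * kap ^- 3)) (cvg_seqM (cvg_seqD h2 (@cvg_seq_cst R C)) i3).
rewrite mulr0 mulr0 in H.
apply: cvg_near0 H _; near=> n.
have n0 : (0 < n)%N by near: n; exact: nbhs_infty_gt.
have N0 : 0 < n%:R :> R by rewrite ltr0n.
have l0 : 0 < ln n%:R :> R by near: n; exact: (cvgry_gt (@cvg_ln_nat_y R)).
have sl0 : 0 < Num.sqrt (ln n%:R) :> R by rewrite sqrtr_gt0.
have P0 : 0 < n%:R `^ (3 / 2) :> R by rewrite powR_gt0.
have N3 : N n ^+ 3 = n%:R `^ (3 / 2) * (Num.sqrt (ln n%:R) * ln n%:R).
  rewrite NE exprMn -powR_mulrn ?powR_ge0// -powRrM exprS sqr_sqrtr//.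
  by congr (_ `^ _ * _); field.
have D0 : 0 < n%:R `^ (3 / 2) * (Num.sqrt (ln n%:R) * ln n%:R) :> R by rewrite !mulr_gt0.
rewrite N3 ger0_norm; last first.
  by rewrite divr_ge0 ?(ltW D0)// sumr_ge0// => i _; rewrite exprn_ge0.
rewrite ler_pdivrMr//; apply: le_trans (sum_cube_le n) _.
have -> : 3 * g = 3 / 2 by rewrite g2.
have HCn : \sum_(i < n) (i.+1%:R : R) `^ (- (3 / 2)) <= C.
  by have := HC n; rewrite (_ : - 2^-1 - 1 = - (3 / 2)); [|field].
rewrite /=.
have -> : n%:R `^ (- 2^-1) = n%:R / n%:R `^ (3 / 2) :> R.
  by rewrite -{2}[n%:R]powRr1 ?(ltW N0)// powR_nat_div//; congr powR; field.
set Q := \sum_(i < n) _ in HCn *.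
have -> : 4 * kap ^- 3 * ((n%:R / n%:R `^ (3 / 2) + C) * ((Num.sqrt (ln n%:R))^-1 * (ln n%:R)^-1)) *
    (n%:R `^ (3 / 2) * (Num.sqrt (ln n%:R) * ln n%:R)) =
    4 * kap ^- 3 * (n%:R + n%:R `^ (3 / 2) * C).
  by field; rewrite !gt_eqF.
rewrite ler_wpM2l ?mulr_ge0 ?invr_ge0 ?exprn_ge0 ?(ltW kap0)//.
by rewrite lerD2l ler_wpM2l// ltW.
Unshelve. all: by end_near. Qed.

Lemma critical_remainder : rem n / N n @[n --> \oo] --> (0 : R).
Proof.
have [C HC] := @sum_powR_bounded R 2^-1 ltac:(lra).
have h1 : (n%:R : R) `^ (- 2^-1) @[n --> \oo] --> (0 : R) by apply: cvg_natr_powR_0; lra.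
have h4 : (\sum_(i < n) (i.+1%:R : R) `^ (- 1)) / n%:R `^ 2^-1 @[n --> \oo] --> (0 : R).
  by apply: power_sum_powR_small; lra.
have H := cvg_seqM (cvg_seqD (cvg_seqD (cvg_seqD h1 (@cvg_seq_cst R 1)) (@cvg_seq_cst R C)) h4) cvg_inv_sqrt_ln.
rewrite mulr0 in H.
apply: cvg_near0 H _; near=> n.
have n0 : (0 < n)%N by near: n; exact: nbhs_infty_gt.
have N0 : 0 < n%:R :> R by rewrite ltr0n.
have l0 : 0 < ln n%:R :> R by near: n; exact: (cvgry_gt (@cvg_ln_nat_y R)).
have sl0 : 0 < Num.sqrt (ln n%:R) :> R by rewrite sqrtr_gt0.
have P0 : 0 < n%:R `^ 2^-1 :> R by rewrite powR_gt0.
rewrite ger0_norm; last by rewrite divr_ge0 ?sqrtr_ge0// remainder_bound_ge0.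
rewrite NE ler_pdivrMr ?mulr_gt0// /remainder_bound g2.
have HCn := HC n; set Q := \sum_(i < n) _ `^ _ in HCn *.
rewrite /= powRN.
have -> : \sum_(i < n) (i.+1%:R : R) `^ (- 1) = \sum_(i < n) i.+1%:R^-1.
  by apply: eq_bigr => i _; rewrite powR_inv1.
set B := \sum_(i < n) _^-1.
have -> : ((n%:R `^ 2^-1)^-1 + 1 + C + B / n%:R `^ 2^-1) * (Num.sqrt (ln n%:R))^-1 *
   (n%:R `^ 2^-1 * Num.sqrt (ln n%:R)) = 1 + n%:R `^ 2^-1 + n%:R `^ 2^-1 * C + B.
  by field; rewrite !gt_eqF.
by rewrite lerD2r lerD2l ler_wpM2l// ltW.
Unshelve. all: by end_near. Qed.

Theorem critical_functional_clt f M : continuous f -> (forall x, `|f x| <= M) ->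
  hexp (memory_drift ret p lam q) n
    (fun l => f ((\sum_(x <- l) x - n%:R * limit_mean p lam kap) / Num.sqrt (n%:R * ln n%:R)))
    @[n --> \oo] -->
  \int[normal_law 0 ((1 - limit_mean p lam kap ^+ 2) * kap^-1)]_x f x.
Proof.
move=> cf fM.
apply: (functional_clt hp hlam hq kap0 kap1 hK (N := N)) cf fM.
- by move=> n; exact: sqrtr_ge0.
- exact: critical_variance.
- exact: critical_fluctuation.
- exact: critical_cube.
- exact: critical_remainder.
- by rewrite invr_ge0 ltW.
Qed.

End critical.

End regimes.

(** * Almost sure convergence *)

Section maximal_inequality.
Variables (R : realType) (m : seq R -> R).
Hypothesis m_le1 : forall n l, sign_history n l -> `|m l| <= 1.
Variables (c : nat -> R) (e : R).
Hypothesis e0 : 0 < e.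
Local Notation T := (transform m (c \o size)).

Fixpoint stays_below (l : seq R) : bool :=
  if l is x :: l' then stays_below l' && (`|T l| < e) else true.

Definition stopped_weight l : R := (stays_below l)%:R * c (size l).

(** The weight is switched off only after the martingale has left the interval, so the stopped value
    stays frozen outside it. *)
Lemma transform_stopped l :
  if stays_below l then transform m stopped_weight l = T l
  else e <= `|transform m stopped_weight l|.
Proof.
elim: l => [//|x l IH].
have E : transform m stopped_weight (x :: l) =
    transform m stopped_weight l + (stays_below l)%:R * c (size l) * (x - m l) by [].
have ET : T (x :: l) = T l + c (size l) * (x - m l) by [].
have ES : stays_below (x :: l) = stays_below l && (`|T (x :: l)| < e) by [].
rewrite ES E; case: (stays_below l) IH {E} => IH; last by rewrite andFb !mul0r addr0.
by rewrite andTb mul1r IH ET; case: ltP.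
Qed.

(* Kolmogorov's inequality, by stopping the martingale when it first leaves
   ]-e, e[. *)
Lemma maximal_inequality n :
  hexp m n (fun l => (~~ stays_below l)%:R) <= (\sum_(i < n) c i ^+ 2) / e ^+ 2.
Proof.
rewrite ler_pdivlMr ?exprn_gt0// mulrC -hexpZ.
apply: (@le_trans _ _ (hexp m n (fun l => transform m stopped_weight l ^+ 2))).
  apply: (hexp_le m_le1) => l _; have := transform_stopped l.
  case: (stays_below l) => /= h; first by rewrite mulr0 sqr_ge0.
  rewrite mulr1 -[leRHS]real_normK ?num_real// ler_pXn2r// nnegrE; exact: ltW.
apply: (hexp_sqr_transform m_le1 (c := fun i => c i ^+ 2)) => i l _ /andP[/eqP sz _].
rewrite /stopped_weight sz; case: (stays_below l); first by rewrite mul1r.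
by rewrite mul0r expr0n sqr_ge0.
Qed.

End maximal_inequality.

Section kronecker.
Variable R : realType.

Lemma kronecker (x b : R^nat) (t : R) : (forall n, 0 < b n) ->
  (forall n, b n < b n.+1) -> b @ \oo --> +oo ->
  \sum_(i < n) x i / b i @[n --> \oo] --> t ->
  (\sum_(i < n) x i) / b n @[n --> \oo] --> (0 : R).
Proof.
move=> b0 bS by_ xt; pose T n := \sum_(i < n) x i / b i.
(* Summation by parts: an increment of [A] is minus the increment of [b] times [T n.+1], so
   Stolz-Cesaro sends [A / b] to [- t], which cancels [T]. *)
pose A n := \sum_(i < n) x i - b n * T n.
have hA : A n / b n @[n --> \oo] --> - t.
  apply: stolz_cesaro => //.
  have h : - T n.+1 @[n --> \oo] --> - t by apply: cvgN; exact: cvg_to_shift xt.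
  apply: eq_cvg_seq h => n.
  have d0 : b n.+1 - b n != 0 by rewrite subr_eq0 gt_eqF.
  have -> : A n.+1 - A n = - (b n.+1 - b n) * T n.+1.
    rewrite /A /T !big_ord_recr/=; set S := \sum_(i < n) x i; set S' := \sum_(i < n) _ / _.
    by field; rewrite gt_eqF.
  by rewrite mulrAC mulNr divff ?mulN1r.
have := cvg_seqD hA xt; rewrite addNr; apply: eq_cvg_seq => n /=.
rewrite /A /T mulrBl; set S' := \sum_(i < n) x i / b i.
by rewrite [b n * S']mulrC mulfK ?subrK// gt_eqF.
Qed.

End kronecker.

Section almost_sure.
Variables (d : measure_display) (T : measurableType d) (R : realType).
Variables (P : probability T R) (p lam : R) (D : nat -> set nat) (ret : pred nat).
Variables (Y eps : nat -> {RV P >-> R}) (I : nat -> {RV P >-> nat}).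
Variable X : nat -> {RV P >-> R}.
Hypotheses (hp : 0 <= p <= 1) (hlam : 0 <= lam <= 1).
Hypothesis hX : is_tmerw p lam D Y eps I X.
Hypothesis hret : forall n i, (1 <= i <= n)%N -> (D n i <-> ~~ ret i).

Let m := memory_drift ret p lam (first_mean X).

Let m_le1 n l : sign_history n l -> `|m l| <= 1.
Proof. exact: norm_memory_drift_le1 (norm_first_mean_le1 X). Qed.

Lemma measurable_retained_sum n :
  measurable_fun setT (fun w => retained_sum ret (history X n w)).
Proof.
elim: n => [|n IH] /=; first exact: measurable_cst.
apply: measurable_funD => //; under eq_fun do rewrite size_history.
exact: measurable_funM.
Qed.

Lemma measurable_memory_drift n : measurable_fun setT (fun w => m (history X n w)).
Proof.
case: n => [|n]; first exact: measurable_cst.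
rewrite /m /memory_drift [history _ _]/=.
rewrite (_ : (fun w => _) = fun w =>
  (2 * p - 1) * (retained_sum ret (history X n.+1 w) / n.+1%:R) +
  (2 * lam - 1) * ((n.+1%:R - retained_count R ret n.+1) / n.+1%:R)); last first.
  by apply/funext => w /=; rewrite size_history.
apply: measurable_funD => //; apply: measurable_funM => //.
by apply: measurable_funM => //; exact: measurable_retained_sum.
Qed.

Lemma measurable_transform (c : nat -> R) n :
  measurable_fun setT (fun w => transform m (c \o size) (history X n w)).
Proof.
elim: n => [|n IH] /=; first exact: measurable_cst.
apply: measurable_funD => //; under eq_fun do rewrite size_history.
apply: measurable_funM => //; apply: measurable_funB => //.
exact: measurable_memory_drift.
Qed.

Section tail.
Variable c : nat -> R.

Lemma measurable_stays_below e N :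
  measurable [set w | stays_below m c e (history X N w) = true].
Proof.
elim: N => [|N IH].
  by rewrite (_ : [set _ | _] = setT)//; apply/seteqP; split.
rewrite (_ : [set _ | _] = [set w | stays_below m c e (history X N w) = true] `&`
    (fun w => `|transform m (c \o size) (history X N.+1 w)|) @^-1` `]-oo, e[%classic).
  apply: measurableI => //.
  have mT := @measurable_transform c N.+1.
  have mN : measurable_fun setT (fun w => `|transform m (c \o size) (history X N.+1 w)|).
    exact: measurableT_comp.
  by rewrite -[X in measurable X]setTI; apply: mN => //; exact: measurable_itv.
apply/seteqP; split => w /=; rewrite in_itv/=.
  by move=> /andP[].
by move=> [-> ->].
Qed.

Lemma probability_stays_below e N : 0 < e ->
  (P (~` [set w | stays_below m c e (history X N w) = true]) <=
   ((\sum_(i < N) c i ^+ 2) / e ^+ 2)%:E)%E.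
Proof.
move=> e0; set B := [set w | _].
have mB : measurable B by exact: measurable_stays_below.
have mC : measurable (~` B) by exact: measurableC.
pose F l : R := (~~ stays_below m c e l)%:R.
have E : \1_(~` B) = F \o history X N.
  apply/funext => w /=; rewrite indicE /F; case: (boolP (stays_below _ _ _ _)) => h.
    by rewrite memNset//= => /(_ h).
  by rewrite mem_set//= /B/=; apply/negP.
rewrite -(expectation_indic P mC) E (expectation_history hp hlam hX hret).
  by rewrite lee_fin; exact: maximal_inequality.
by rewrite -E; exact: measurable_indic.
Qed.

Lemma stays_belowS e N w : stays_below m c e (history X N.+1 w) ->
  stays_below m c e (history X N w).
Proof. by move=> /andP[]. Qed.

Lemma stays_below_le e N j w : 0 < e -> (j <= N)%N ->
  stays_below m c e (history X N w) -> `|transform m (c \o size) (history X j w)| < e.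
Proof.
move=> e0; elim: N => [|N IH].
  by rewrite leqn0 => /eqP -> _; rewrite /= normr0.
by rewrite leq_eqVlt => /predU1P[->|/IH h] /andP[] // h' _; exact: h.
Qed.

Lemma probability_leaves e B : 0 < e -> (forall N, \sum_(i < N) c i ^+ 2 <= B) ->
  (P (\bigcup_N ~` [set w | stays_below m c e (history X N w) = true]) <=
   (B / e ^+ 2)%:E)%E.
Proof.
move=> e0 hB; set F := fun N => ~` _.
have mF N : measurable (F N) by apply: measurableC; exact: measurable_stays_below.
have ndF : nondecreasing_seq F.
  apply/nondecreasing_seqP => N; apply/subsetPset => w /= h h'; apply: h.
  exact: stays_belowS h'.
have cv := @nondecreasing_cvg_mu _ _ _ P F mF (bigcupT_measurable _ mF) ndF.
apply: (closed_cvg _ (@closed_ereal_ge_ereal _ (B / e ^+ 2)%:E)) cv.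
  apply: nearW => N; apply: le_trans (probability_stays_below N e0) _.
  by rewrite lee_fin ler_wpM2r ?invr_ge0 ?sqr_ge0.
Qed.

End tail.

(** Erasing the weights before [n] restarts the martingale at time [n], so the maximal inequality
    from time 0 bounds the oscillation after [n]. *)
Lemma transform_tail (c : nat -> R) n k w :
  transform m ((fun i => if (n <= i)%N then c i else 0) \o size) (history X (n + k) w) =
  transform m (c \o size) (history X (n + k) w) - transform m (c \o size) (history X n w).
Proof.
set c' := fun i => _; have H j : (j <= n)%N -> transform m (c' \o size) (history X j w) = 0.
  elim: j => [//|j IH] jn /=; rewrite IH ?(ltnW jn)// size_history /c' leqNgt jn/=.
  by rewrite mul0r addr0.
elim: k => [|k IH]; first by rewrite addn0 H// subrr.
by rewrite addnS /= IH size_history /c' leq_addr; ring.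
Qed.

(** The probability of ever moving by [e] after time [n] is at most the tail of the sum of squares
    over [e ^+ 2]. Letting [n] grow gives a null set [Z k] for each [e = 1 / (k + 1)], and off their
    union the path is Cauchy. *)
Theorem ae_cvg_transform (c : nat -> R) B : (forall n, \sum_(i < n) c i ^+ 2 <= B) ->
  {ae P, forall w, cvgn (fun n => transform m (c \o size) (history X n w))}.
Proof.
move=> cB.
pose S n := \sum_(i < n) c i ^+ 2.
have ndS : nondecreasing_seq S.
  by apply/nondecreasing_seqP => n; rewrite /S big_ord_recr/= lerDl sqr_ge0.
have Sc : cvgn S.
  by apply: nondecreasing_is_cvgn => //; exists B => _ [n _ <-]; exact: cB.
pose t := limn S; have St : S @ \oo --> t by exact: Sc.
have SleT n : S n <= t by exact: nondecreasing_cvgn_le.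
pose c_ n i := if (n <= i)%N then c i else 0.
have tailS n N : \sum_(i < N) c_ n i ^+ 2 <= t - S n.
  have [Nn|nN] := leqP N n.
    rewrite big1 ?subr_ge0// => i _; rewrite /c_ leqNgt (leq_trans (ltn_ord i) Nn)/=.
    by rewrite expr0n.
  rewrite lerBrDl; apply: le_trans (SleT N).
  have -> : S N = \sum_(i < N) (c i - c_ n i) ^+ 2 + \sum_(i < N) c_ n i ^+ 2.
    rewrite -big_split; apply: eq_bigr => i _ /=; rewrite /c_.
    by case: ifP => _; rewrite ?subrr ?subr0 expr0n/= ?add0r ?addr0.
  rewrite lerD2r /S -(subnKC (ltnW nN)) big_split_ord/= -[leLHS]addr0; apply: lerD.
    apply: ler_sum => i _; rewrite /c_ leqNgt ltn_ord/= subr0//.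
  by apply: sumr_ge0 => i _; exact: sqr_ge0.
pose U n e := \bigcup_N ~` [set w | stays_below m (c_ n) e (history X N w) = true].
pose Z k := \bigcap_n U n (k.+1%:R^-1).
have mU n e : measurable (U n e).
  by apply: bigcupT_measurable => N; apply: measurableC; exact: measurable_stays_below.
have PZ k : P (Z k) = 0%E.
  have e0 : 0 < (k.+1%:R : R)^-1 by rewrite invr_gt0.
  have mZ : measurable (Z k) by apply: bigcapT_measurable => n; exact: mU.
  have PZle n : (P (Z k) <= ((t - S n) / k.+1%:R^-1 ^+ 2)%:E)%E.
    apply: (@le_trans _ _ (P (U n k.+1%:R^-1))).
      by apply: le_measure; rewrite ?inE//; exact: bigcap_inf.
    exact: probability_leaves.
  have f : P (Z k) \is a fin_num by exact: fin_num_measure.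
  apply/eqP; rewrite eq_le measure_ge0 andbT -(fineK f) lee_fin.
  apply/ler_addgt0Pl => r r0.
  have /cvgrPdist_le/(_ (r * k.+1%:R^-1 ^+ 2)) := St.
  rewrite mulr_gt0 ?exprn_gt0// => /(_ isT)[n _ /(_ n (leqnn n)) /=].
  move=> h; rewrite addr0 -lee_fin fineK//; apply: le_trans (PZle n) _.
  rewrite lee_fin ler_pdivrMr ?exprn_gt0//.
  by apply: le_trans h; exact: ler_norm.
have : {ae P, forall w k, ~ Z k w}.
  apply: ae_foralln => k; exists (Z k); split.
  - by apply: bigcapT_measurable => n; exact: mU.
  - exact: PZ.
  - by move=> w /= /contrapT.
apply: filterS => w nZ.
apply/cauchy_cvgP; apply: cauchy_exP => e e0.
pose k := Num.truncn e^-1.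
have ke : k.+1%:R^-1 <= e.
  by rewrite -[leRHS]invrK lef_pV2 ?posrE ?invr_gt0// ltW// truncnS_gt.
have [n hn] : exists n, ~ U n k.+1%:R^-1 w.
  by apply/existsNP => h; apply: (nZ k) => n _; exact: h.
exists (transform m (c \o size) (history X n w)).
exists n => // N /= nN; rewrite /ball/= distrC.
rewrite -(subnKC nN) -transform_tail.
apply: lt_le_trans ke; apply: stays_below_le (leqnn _) _; first by rewrite invr_gt0.
apply: contrapT => h; apply: hn; exists (n + (N - n))%N => //.
Qed.

End almost_sure.

Lemma ae_cvg_random_variable (d : measure_display) (T : measurableType d) (R : realType)
    (P : probability T R) (f : nat -> T -> R) :
  (forall n, measurable_fun setT (f n)) -> {ae P, forall w, cvgn (f ^~ w)} ->
  exists xi : {RV P >-> R}, {ae P, forall w, f n w @[n --> \oo] --> xi w}.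
Proof.
(* The upper limit is measurable everywhere, including where the sequence diverges; [fine] makes it
   real-valued. *)
move=> mf cf; pose xi w := fine (limn_esup (fun n => (f n w)%:E)).
have mxi : measurable_fun setT xi.
  apply: measurableT_comp => //.
  by apply: measurable_fun_limn_esup => n; exact/measurable_EFinP.
exists (mfun_Sub (mem_set mxi)).
apply: filterS cf => w /cvg_ex[l fl].
have E : xi w = l.
  have h : (f n w)%:E @[n --> \oo] --> l%:E by apply/fine_cvgP; split; [exact: nearW|].
  rewrite /xi is_cvg_limn_esupE; first by rewrite (cvg_lim _ h).
  by apply/cvg_ex; exists l%:E.
by rewrite /= E.
Qed.

Lemma cvg_summable_increments (R : realType) (a c : R^nat) (B : R) :
  (forall n, `|a n.+1 - a n| <= c n) -> (forall n, \sum_(i < n) c i <= B) -> cvgn a.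
Proof.
move=> ac cB; pose t n := a n.+1 - a n.
have aE n : a n = a 0%N + series t n.
  elim: n => [|n IH]; first by rewrite /series/= big_geq// addr0.
  by rewrite seriesSr addrA -IH /t; ring.
suff ct : cvgn (series t).
  rewrite (_ : a = fun n => a 0%N + series t n); last exact/funext.
  by apply: is_cvgD => //; exact: is_cvg_cst.
apply: normed_cvg; apply: nondecreasing_is_cvgn.
  by apply/nondecreasing_seqP => n; rewrite /= seriesSr lerDl.
exists B => _ [n _ <-]; rewrite /= /series/= big_mkord; apply: le_trans (cB n).
by apply: ler_sum => i _; exact: ac.
Qed.

(** * The superdiffusive regime *)

Section superdiffusive.
Variables (d : measure_display) (T : measurableType d) (R : realType).
Variables (P : probability T R) (p lam kap K : R) (D : nat -> set nat) (ret : pred nat).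
Variables (Y eps : nat -> {RV P >-> R}) (I : nat -> {RV P >-> nat}).
Variable X : nat -> {RV P >-> R}.
Hypotheses (hp : 0 <= p <= 1) (hlam : 0 <= lam <= 1).
Hypothesis hX : is_tmerw p lam D Y eps I X.
Hypothesis hret : forall n i, (1 <= i <= n)%N -> (D n i <-> ~~ ret i).
Hypotheses (kap0 : 0 < kap) (kap1 : kap < 1).
Hypothesis hK : forall n, `|retained_excess ret kap n| <= K.

Local Notation g := ((2 * p - 1) * kap).
Hypothesis g2 : 2^-1 < g.

Let q := first_mean X.
Let m := memory_drift ret p lam q.
Local Notation s := (limit_mean p lam kap).
Local Notation u := (scaled_retained ret p lam kap).
Local Notation z := (walk_part ret p lam q kap).
Local Notation h := (history X).

Let hq : `|q| <= 1. Proof. exact: norm_first_mean_le1. Qed.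
Let g0 : 0 < g. Proof. by move: g2; lra. Qed.

Let summable_square (c : nat -> R) (B : R) :
  (forall i, `|c i| <= B) ->
  exists C : R, forall n, \sum_(i < n) (c i * i.+1%:R `^ (- g)) ^+ 2 <= C.
Proof.
move=> cB; have B0 : 0 <= B := le_trans (normr_ge0 _) (cB 0).
(* This is where [g > 1 / 2] enters: the exponent [2 * g] of the squares exceeds 1. *)
have [C HC] : exists C, forall n, \sum_(i < n) (i.+1%:R : R) `^ (- (2 * g - 1) - 1) <= C.
  by apply: sum_powR_bounded; move: g2; lra.
exists (B ^+ 2 * C) => n; apply: (@le_trans _ _ (B ^+ 2 *
    \sum_(i < n) (i.+1%:R : R) `^ (- (2 * g - 1) - 1))); last first.
  by rewrite ler_wpM2l// exprn_ge0.
rewrite mulr_sumr; apply: ler_sum => i _; rewrite exprMn.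
apply: ler_pM; rewrite ?sqr_ge0//.
  by rewrite -real_normK ?num_real// ler_pXn2r// nnegrE.
have n0 : i.+1%:R != 0 :> R by rewrite pnatr_eq0.
by rewrite expr2 -powRD ?n0 ?implybT// le_eqVlt; apply/orP/or_introl/eqP; congr powR; ring.
Qed.

Let ret01 i : 0 <= ((ret i)%:R : R) <= 1.
Proof. by case: (ret i) => /=; lra. Qed.

Let norm_walk_weight i : `|walk_weight ret kap i| <= 1 + kap^-1.
Proof.
apply: le_trans (ler_normB _ _) _; rewrite normr1 lerD2l normrM normfV (gtr0_norm kap0).
have /andP[r0 r1] := ret01 i.+1.
by rewrite ger0_norm// -[leRHS]mul1r ler_wpM2r// invr_ge0 ltW.
Qed.

Let transform_history (c : nat -> R) n w : transform m (c \o size) (h n w) =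
  \sum_(i < n) c i * (X i.+1 w - m (h i w)).
Proof.
elim: n => [|n IH]; first by rewrite big_ord0.
by rewrite big_ord_recr/= IH size_history.
Qed.

Let cvg_walk_part w : (forall n, sign_history n (h n w)) ->
  cvgn (fun n => transform m ((fun i => walk_weight ret kap i * i.+1%:R `^ (- g)) \o size) (h n w)) ->
  z (h n w) / n%:R `^ g @[n --> \oo] --> (0 : R).
Proof.
move=> hw /cvg_ex[t ht].
pose x i := walk_weight ret kap i * (X i.+1 w - m (h i w)).
have /(@kronecker R x (fun i => i.+1%:R `^ g) t) k :
    \sum_(i < n) x i / i.+1%:R `^ g @[n --> \oo] --> t.
  apply: eq_cvg_seq ht => n; rewrite transform_history; apply: eq_bigr => i _.
  by rewrite powRN /x mulrAC.
have k0 : (\sum_(i < n) x i) / n.+1%:R `^ g @[n --> \oo] --> (0 : R).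
  apply: k => [n|n|]; first by rewrite powR_gt0.
    by rewrite gt0_ltr_powR ?nnegrE// ltr_nat.
  exact: (cvg_to_shift (cvg_natr_powR_y g0)).
(* Kronecker's lemma normalizes by [(n + 1) ^ g]; [C] compares this with [n ^ g]. *)
pose C := 2 `^ `|g| : R.
pose e n := C * `|(\sum_(i < n) x i) / n.+1%:R `^ g| +
  4 * K / kap * ((\sum_(i < n) (i.+1%:R : R) `^ (-1)) / n%:R `^ g).
have e0 : e @ \oo --> (0 : R).
  have h1 : `|(\sum_(i < n) x i) / n.+1%:R `^ g| @[n --> \oo] --> `|0 : R| by exact: cvg_norm.
  have h2 : (\sum_(i < n) (i.+1%:R : R) `^ (-1)) / n%:R `^ g @[n --> \oo] --> (0 : R).
    by apply: power_sum_powR_small => //; move: g2; lra.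
  have := cvg_seqD (cvg_seqM (@cvg_seq_cst R C) h1) (cvg_seqM (@cvg_seq_cst R (4 * K / kap)) h2).
  by rewrite normr0 !mulr0 addr0.
apply: (cvg_near0 e0); near=> n.
have n0 : 0 < n%:R :> R by near: n; exact: nbhs_infty_gtr.
have n1 : 1 <= n%:R :> R by rewrite ler1n -(ltr0n R).
have ng : 0 < n%:R `^ g :> R by rewrite powR_gt0.
have H := walk_part_transform hp hlam hq kap0 hK (hw n).
rewrite -/q -/m transform_history in H.
rewrite normrM normfV (gtr0_norm ng) ler_pdivrMr//.
rewrite /e mulrDl -[4 * K / kap * _ * _]mulrA divfK ?gt_eqF//.
have -> : z (h n w) = \sum_(i < n) x i + (z (h n w) - \sum_(i < n) x i) by ring.
apply: le_trans (ler_normD _ _) _; apply: lerD; last first.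
  have K0 : 0 <= K := le_trans (normr_ge0 _) (hK 0).
  apply: le_trans H _; rewrite ler_wpM2l//; first by rewrite divr_ge0 ?mulr_ge0// ltW.
  by apply: ler_sum => i _; rewrite powRN powRr1.
have sg : 0 < n.+1%:R `^ g :> R by rewrite powR_gt0.
rewrite normrM normfV (gtr0_norm sg).
have -> : C * (`|\sum_(i < n) x i| / n.+1%:R `^ g) * n%:R `^ g =
  `|\sum_(i < n) x i| * (C * n%:R `^ g) / n.+1%:R `^ g by ring.
rewrite ler_pdivlMr// ler_wpM2l// powR_le_comparable// -natr1; lra.
Unshelve. all: by end_near. Qed.

Lemma superdiffusive_ae_cvg :
  {ae P, forall w, cvgn (fun n => (\sum_(x <- h n w) x - n%:R * s) / n%:R `^ g)}.
Proof.
have [B1 HB1] : exists B, forall n, \sum_(i < n) retained_weight ret p kap i ^+ 2 <= B.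
  apply: (@summable_square (fun i => (ret i.+1)%:R) 1) => i; have /andP[r0 r1] := ret01 i.+1.
  by rewrite ger0_norm.
have [B2 HB2] := summable_square norm_walk_weight.
have A1 := ae_cvg_transform (c := retained_weight ret p kap) hp hlam hX hret HB1.
have A2 := ae_cvg_transform (c := fun i => walk_weight ret kap i * i.+1%:R `^ (- g))
  hp hlam hX hret HB2.
have A3 := ae_sign_history hp hlam hX hret.
apply: filterS3 A1 A2 A3 => w c1 c2 hw.
have cz := cvg_walk_part hw c2.
have cu : cvgn (fun n => u (h n w)).
  have [C C0 HC] := scaled_retained_step hp hlam hq kap0 kap1 hK.
  have [B HB] := sum_powR_bounded g0.
  pose e n := u (h n w) - transform m (retained_weight ret p kap \o size) (h n w).
  have ce : cvgn e.
    apply: (@cvg_summable_increments R e (fun n => C * n.+1%:R `^ (- g - 1)) (C * B)) => n.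
      have := HC n (X n.+1 w) (h n w) (hw n.+1).
      rewrite (_ : e n.+1 - e n = u (X n.+1 w :: h n w) - u (h n w) -
        (ret n.+1)%:R * n.+1%:R `^ (- g) * (X n.+1 w - m (h n w)))//.
      by rewrite /e /= size_history /retained_weight; ring.
    by rewrite -mulr_sumr ler_wpM2l.
  rewrite (_ : (fun n => _) = e \+ fun n =>
    transform m (retained_weight ret p kap \o size) (h n w)); first exact: is_cvgD.
  by apply/funext => n; rewrite /= /e subrK.
have [C C0 HC] := walk_decomposition hp hlam hq kap0 kap1 hK.
(* Only the scaled retained sum survives division by [n ^ g], so the limit is its limit [l] divided
   by [kap]. *)
move: cu => /cvg_ex[l ul]; apply/cvg_ex; exists (l / kap).
pose E n := \sum_(x <- h n w) x - n%:R * s - (z (h n w) + n%:R `^ g / kap * u (h n w)).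
have cE : E n / n%:R `^ g @[n --> \oo] --> (0 : R).
  have : C * n%:R `^ (- g) @[n --> \oo] --> (0 : R).
    have := cvg_seqM (@cvg_seq_cst R C) (cvg_natr_powR_0 (s := - g) _).
    by rewrite mulr0 oppr_lt0; exact.
  move=> /cvg_near0; apply; near=> n; rewrite powRN normrM normfV.
  by rewrite (ger0_norm (powR_ge0 _ _)) ler_wpM2r ?invr_ge0 ?powR_ge0// HC.
have := cvg_seqD (cvg_seqD cE cz) (cvg_seqM ul (@cvg_seq_cst R kap^-1)).
rewrite !add0r; apply: near_eq_cvg_seq; near=> n.
have n0 : 0 < n%:R :> R by near: n; exact: nbhs_infty_gtr.
have ng : n%:R `^ g != 0 by rewrite gt_eqF// powR_gt0.
by rewrite /E; field; rewrite ng gt_eqF.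
Unshelve. all: by end_near. Qed.


End superdiffusive.

Lemma walkE (d : measure_display) (T : measurableType d) (R : realType)
    (P : probability T R) (X : nat -> {RV P >-> R}) n w :
  walk X n w = \sum_(x <- history X n w) x.
Proof.
rewrite /walk; elim: n => [|n IH]; first by rewrite big_geq// big_nil.
by rewrite big_nat_recr//= big_cons IH addrC.
Qed.

Lemma measurable_walk (d : measure_display) (T : measurableType d) (R : realType)
    (P : probability T R) (X : nat -> {RV P >-> R}) n :
  measurable_fun setT (walk X n).
Proof. by apply: measurable_sum. Qed.

(** * Arithmetic progressions *)

Section arithmetic_progression.
Variables mu k : nat.
Hypothesis kmu : (k < mu)%N.

(** Blocks start at 1, so the position within a block is the residue of the predecessor. *)
Definition ap_ret : pred nat := fun i => (i.-1 %% mu < k)%N.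

Lemma ap_tamperedE n i : (1 <= i <= n)%N -> ap_tampered mu k n i <-> ~~ ap_ret i.
Proof.
case: i => [//|i] hi; rewrite /ap_ret /= -leqNgt; split.
  case=> _ [j [m [/andP[km mmu] e]]]; case: m km mmu e => // m km mmu.
  by rewrite addnS => -[->]; rewrite modnMDl modn_small.
move=> ki; split=> //; exists (i %/ mu)%N, (i %% mu).+1; split.
  by rewrite ltnS ki ltn_pmod// (leq_ltn_trans _ kmu).
by rewrite addnS -divn_eq.
Qed.

Variable R : realType.

Lemma ap_retained_count n :
  retained_count R ap_ret n = ((n %/ mu) * k + minn (n %% mu) k)%:R.
Proof.
have mu0 : (0 < mu)%N by apply: leq_ltn_trans kmu.
elim: n => [|n IH]; first by rewrite /retained_count big_nil div0n mod0n min0n.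
rewrite retained_countS IH -natrD /ap_ret /= divnS// modnS; congr (_%:R).
have r_mu := ltn_pmod n mu0.
case: ifPn => /= h.
  have rE : (n %% mu).+1 = mu.
    move: r_mu; rewrite leq_eqVlt => /predU1P[//|r_mu].
    by move: h; rewrite /dvdn -addn1 -modnDml addn1 modn_small.
  have kr : (k <= n %% mu)%N by rewrite -ltnS rE.
  by rewrite ltnNge kr min0n (minn_idPr kr) mulnDl mul1n !addn0 addnC.
rewrite add0n -addnA; congr (_ + _)%N; case: (ltnP (n %% mu) k) => rk.
  by rewrite (minn_idPl rk) addn1.
by rewrite (minn_idPr (leqW rk)) addn0.
Qed.

Lemma norm_ap_retained_excess n :
  `|retained_excess ap_ret (k%:R / mu%:R) n| <= k%:R :> R.
Proof.
have mu0 : (0 < mu)%N by apply: leq_ltn_trans kmu.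
have m0 : 0 < mu%:R :> R by rewrite ltr0n.
have nE : n%:R = (n %/ mu)%:R * mu%:R + (n %% mu)%:R :> R.
  by rewrite -natrM -natrD -divn_eq.
rewrite /retained_excess ap_retained_count nE natrD natrM.
(* Complete blocks have exactly the density [k / mu] and cancel; both terms left by the last block
   lie between 0 and [k]. *)
have -> : (n %/ mu)%:R * k%:R + (minn (n %% mu) k)%:R -
    k%:R / mu%:R * ((n %/ mu)%:R * mu%:R + (n %% mu)%:R) =
    (minn (n %% mu) k)%:R - k%:R * ((n %% mu)%:R / mu%:R) :> R.
  by field; rewrite gt_eqF.
have h1 : 0 <= ((minn (n %% mu) k)%:R : R) <= k%:R by rewrite ler0n ler_nat geq_minr.
have h2 : 0 <= (k%:R * ((n %% mu)%:R / mu%:R) : R) <= k%:R.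
  rewrite mulr_ge0 ?divr_ge0//= ler_piMr// ler_pdivrMr// mul1r ler_nat ltnW// ltn_pmod//.
by rewrite ler_norml; lra.
Qed.

End arithmetic_progression.

Section laws.
Variables (d : measure_display) (T : measurableType d) (R : realType).
Variables (P : probability T R) (p lam : R) (D : nat -> set nat) (ret : pred nat).
Variables (Y eps : nat -> {RV P >-> R}) (I : nat -> {RV P >-> nat}).
Variable X : nat -> {RV P >-> R}.
Hypotheses (hp : 0 <= p <= 1) (hlam : 0 <= lam <= 1).
Hypothesis hX : is_tmerw p lam D Y eps I X.
Hypothesis hret : forall n i, (1 <= i <= n)%N -> (D n i <-> ~~ ret i).

Lemma cvg_in_law_hexp (N : nat -> R) (s : R) (nu : probability (measurableTypeR R) R) :
  (forall f M, continuous f -> (forall x, `|f x| <= M) ->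
    hexp (memory_drift ret p lam (first_mean X)) n
      (fun l => f ((\sum_(x <- l) x - n%:R * s) / N n))
    @[n --> \oo] --> \int[nu]_x f x) ->
  cvg_in_law P (fun n w => (walk X n w - n%:R * s) / N n) nu.
Proof.
move=> H f cf bf.
have [M fM] : exists M, forall x, `|f x| <= M.
  by have [M [_ hM]] := bf; exists (M + 1) => x; apply: hM; rewrite ?ltrDl.
have fi : nu.-integrable setT (EFin \o f).
  apply: measurable_bounded_integrable => //.
    by rewrite fin_num_fun_lty//; exact: fin_num_measure.
  exact: continuous_measurable_fun.
rewrite -[(\int[nu]_x _)%E]fineK; last exact: integrable_fin_num.
rewrite (_ : (fun n => _) = fun n =>
    (hexp (memory_drift ret p lam (first_mean X)) n
      (fun l => f ((\sum_(x <- l) x - n%:R * s) / N n)))%:E).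
  by apply/fine_cvgP; split; [exact: nearW|exact: H cf fM].
apply/funext => n.
rewrite -(expectation_history hp hlam hX hret (n := n)).
  by congr ('E_P[_])%E; apply/funext => w; rewrite /= walkE.
rewrite (_ : _ \o _ = f \o (fun w => (walk X n w - n%:R * s) / N n)); last first.
  by apply/funext => w; rewrite /= walkE.
apply: measurableT_comp; first exact: continuous_measurable_fun.
apply: measurable_funM => //; apply: measurable_funB => //; exact: measurable_walk.
Qed.

End laws.

Lemma ap_driftE (R : realType) mu k (p lam : R) : (0 < mu)%N ->
  ap_drift mu k p lam = limit_mean p lam (k%:R / mu%:R).
Proof.
move=> mu0; have m0 : mu%:R != 0 :> R by rewrite pnatr_eq0 -lt0n.
rewrite /ap_drift /limit_mean.
have -> : 1 - k%:R / mu%:R = (mu%:R - k%:R) / mu%:R :> R by field.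
have -> : 1 - (2 * p - 1) * (k%:R / mu%:R) = (mu%:R - (2 * p - 1) * k%:R) / mu%:R by field.
by rewrite invfM invrK; move: (mu%:R - (2 * p - 1) * k%:R)^-1 => E; field.
Qed.

(** The denominator [1 - a * kap] is at least [1 - kap], strictly more unless [p = 1], and the
    numerator reaches [1 - kap] in absolute value only if [lam] is 0 or 1. *)
Lemma sqr_limit_mean_lt1 (R : realType) (p lam kap : R) :
  0 <= p <= 1 -> 0 <= lam <= 1 -> 0 < kap < 1 -> ~ (p = 1 /\ (lam = 0 \/ lam = 1)) ->
  limit_mean p lam kap ^+ 2 < 1.
Proof.
move=> hp hlam /andP[k0 k1] nd; rewrite /limit_mean.
set b := 2 * lam - 1; set a := 2 * p - 1.
have ak : a * kap <= kap by rewrite ger_pMl// /a; lra.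
have g0 : 0 < 1 - a * kap by lra.
rewrite -real_normK ?num_real// expr_lt1//.
rewrite normrM normfV (gtr0_norm g0) ltr_pdivrMr// mul1r normrM (gtr0_norm (_ : 0 < 1 - kap)); last by lra.
have b1 : `|b| <= 1 by rewrite ler_norml /b; lra.
have [p1|p1] := eqVneq p 1.
  have {}b1 : `|b| < 1.
    rewrite lt_neqAle b1 andbT; apply/eqP => h; apply: nd; split=> //.
    by move: h; rewrite /b; case: ler0P => _ h; [left|right]; lra.
  have : `|b| * (1 - kap) < 1 - kap by rewrite gtr_pMl//; lra.
  lra.
have : a * kap < kap by rewrite gtr_pMl// /a; move: p1 hp; rewrite lt_neqAle; lra.
have : `|b| * (1 - kap) <= 1 - kap by rewrite ger_pMl//; lra.
lra.
Qed.

Theorem theorem1p10 (R : realType) (mu k : nat) (p lam : R)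
    (hk : (1 <= k)%N) (hkmu : (k < mu)%N)
    (hp : 0 <= p <= 1) (hlam : 0 <= lam <= 1) :
  exists Sigma Sigmat : R,
    [/\ 0 <= Sigma, 0 <= Sigmat,
        ~ ap_degenerate mu k p lam -> 0 < Sigma /\ 0 < Sigmat
      & forall (d : measure_display) (T : measurableType d)
          (P : probability T R) (Y eps : nat -> {RV P >-> R})
          (I : nat -> {RV P >-> nat}) (X : nat -> {RV P >-> R}),
        is_tmerw p lam (ap_tampered mu k) Y eps I X ->
        let centered n w := walk X n w - n%:R * ap_drift mu k p lam in
        let diffusive :=
          cvg_in_law P (fun n w => centered n w / Num.sqrt n%:R)
            (normal_law 0 Sigma) in
        let critical :=
          cvg_in_law P (fun n w => centered n w / Num.sqrt (n%:R * ln n%:R))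
            (normal_law 0 Sigmat) in
        let superdiffusive :=
          exists xi : {RV P >-> R},
            {ae P, forall w,
              centered n w / n%:R `^ (1 - ap_rho mu k p) @[n --> \oo]
                --> xi w} in
        [/\ mu%:R / 2 < k%:R :> R ->
              [/\ p < 2^-1 + mu%:R / (4 * k%:R) -> diffusive,
                  p = 2^-1 + mu%:R / (4 * k%:R) -> critical
                & 2^-1 + mu%:R / (4 * k%:R) < p <= 1 -> superdiffusive],
            k%:R = mu%:R / 2 :> R ->
              (0 <= p < 1 -> diffusive) /\ (p = 1 -> critical)
          & k%:R < mu%:R / 2 :> R -> 0 <= p <= 1 -> diffusive]].
Proof.
have mu0 : (0 < mu)%N by apply: leq_ltn_trans hkmu.
have m0 : 0 < mu%:R :> R by rewrite ltr0n.
have k0 : 0 < k%:R :> R by rewrite ltr0n.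
have km : k%:R < mu%:R :> R by rewrite ltr_nat.
pose kap : R := k%:R / mu%:R; pose g := (2 * p - 1) * kap; pose s := limit_mean p lam kap.
have kap0 : 0 < kap by rewrite divr_gt0.
have kap1 : kap < 1 by rewrite ltr_pdivrMr// mul1r.
have kE : k%:R = kap * mu%:R :> R by rewrite /kap divfK// gt_eqF.
have s1 : s ^+ 2 <= 1 by rewrite -real_normK ?num_real// expr_le1// norm_limit_mean_le1.
(* If [p = 1] then [g = kap], so [g <= 1 / 2] means [k <= mu / 2]; a squared limit mean equal to 1
   would then put the parameters in the degenerate case. *)
have s_lt1 : ~ ap_degenerate mu k p lam -> g <= 2^-1 -> s ^+ 2 < 1.
  move=> nd g2; apply: sqr_limit_mean_lt1 => //; first by rewrite kap0.
  case=> p1 lam01; apply: nd; split=> //.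
  by rewrite kE mulrC ler_wpM2l ?(ltW m0)//; move: g2; rewrite /g p1; lra.
(* Outside its own regime each constant is given the arbitrary positive value 1, as the
   corresponding limit law is then not asserted. *)
pose Sigma := if g < 2^-1 then (1 - s ^+ 2) * diffusive_factor kap g else 1.
pose Sigmat := if g == 2^-1 then (1 - s ^+ 2) * kap^-1 else 1.
have dfac : g < 2^-1 -> 0 < diffusive_factor kap g.
  by apply: diffusive_factor_gt0; rewrite kap0.
exists Sigma, Sigmat; split.
- rewrite /Sigma; case: ifPn => // g2.
  by rewrite mulr_ge0 ?subr_ge0// ltW// dfac.
- by rewrite /Sigmat; case: ifPn => // _; rewrite mulr_ge0 ?subr_ge0// invr_ge0 ltW.
- move=> nd; split.
    rewrite /Sigma; case: ifPn => // g2.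
    by rewrite mulr_gt0 ?dfac// subr_gt0 s_lt1// ltW.
  rewrite /Sigmat; case: ifPn => // /eqP g2.
  by rewrite mulr_gt0 ?invr_gt0// subr_gt0 s_lt1// g2.
move=> d T P Y eps I X hX centered diffusive critical superdiffusive.
have hret := @ap_tamperedE mu k hkmu.
have hK := norm_ap_retained_excess hkmu R.
have hq := norm_first_mean_le1 X.
have sE : ap_drift mu k p lam = s by rewrite ap_driftE.
have Hd : g < 2^-1 -> diffusive.
  move=> g2; rewrite /diffusive /centered sE /Sigma g2.
  apply: (cvg_in_law_hexp hp hlam hX hret) => f M cf fM.
  exact: (diffusive_functional_clt hp hlam hq kap0 kap1 hK g2 cf fM).
have Hc : g = 2^-1 -> critical.
  move=> g2; rewrite /critical /centered sE /Sigmat g2 eqxx.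
  apply: (cvg_in_law_hexp hp hlam hX hret) => f M cf fM.
  exact: (critical_functional_clt hp hlam hq kap0 kap1 hK g2 cf fM).
have Hs : 2^-1 < g -> superdiffusive.
  move=> g2; apply: ae_cvg_random_variable => [n|].
    apply: measurable_funM => //; apply: measurable_funB => //; exact: measurable_walk.
  have := superdiffusive_ae_cvg hp hlam hX hret kap0 kap1 hK g2.
  apply: filterS => w /cvg_ex[l hl]; apply/cvg_ex; exists l; apply: eq_cvg_seq hl => n.
  rewrite /centered sE walkE /ap_rho; congr (_ / _ `^ _).
  by rewrite /kap; ring.
(* Multiplied by [kap], the threshold for [p] reads [g = 1 / 2]. When [k <= mu / 2] the comparison
   follows from [g <= kap] instead. *)
have thr : 2^-1 + mu%:R / (4 * k%:R) = 2^-1 + (4 * kap)^-1.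
  by rewrite kE; field; rewrite !gt_eqF.
have half : kap * (4 * kap)^-1 = 4^-1 by field; rewrite gt_eqF.
have g_le : g <= kap by rewrite /g ger_pMl//; move: hp; lra.
split.
- move=> _; rewrite thr; split => [h|h|/andP[h _]].
  + apply: Hd; have : p * kap < (2^-1 + (4 * kap)^-1) * kap by rewrite ltr_pM2r.
    by rewrite /g; lra.
  + by apply: Hc; rewrite /g h; lra.
  + apply: Hs; have : (2^-1 + (4 * kap)^-1) * kap < p * kap by rewrite ltr_pM2r.
    by rewrite /g; lra.
- move=> h; have kapE : kap = 2^-1 by rewrite /kap h mulrAC divff ?mul1r// gt_eqF.
  by split => [/andP[_ p1]|p1]; [apply: Hd|apply: Hc]; rewrite /g kapE; lra.
- move=> h _; apply: Hd; apply: le_lt_trans g_le _.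
  by rewrite /kap ltr_pdivrMr// mulrC.
Qed.
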